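(* For any $\alpha \in (0, 32\pi^2)$ there exists a constant $C(\alpha) > 0$ such that for all $u \in C^{\infty}_c(\mathbb{H}^4)$ with $\int_{\mathbb{H}^4} (P_2u)\,u \, dv_g \leq 1$, $$\int_{\mathbb{H}^4} \left(e^{\alpha u^2} - 1\right) dv_g \leq C(\alpha) \|u\|^2_{L^2(\mathbb{H}^4)}.$$ The inequality fails for any $\alpha \geq 32\pi^2$; that is, for every $\alpha\ge 32\pi^2$ there is no constant $C(\alpha)>0$ for which it holds for all $u \in C^{\infty}_c(\mathbb{H}^4)$ with $\int_{\mathbb{H}^4} (P_2u)\,u \, dv_g \leq 1$.
   Context: Functions are real-valued. $\mathbb{H}^4$ is the hyperbolic 4-space in the conformal (Poincaré) ball model: the unit ball $\mathbb{B}^4=\{x\in\mathbb{R}^4:|x|<1\}$ with the metric $g=\sum_{i=1}^4\left(\frac{2}{1-|x|^2}\right)^2dx_i^2$. Its volume element is $dv_g=\left(\frac{2}{1-|x|^2}\right)^4dx$, and $\|u\|_{L^2(\mathbb{H}^4)}$ is the $L^2$ norm with respect to $dv_g$. The Laplace-Beltrami operator is $\Delta_g=\left(\frac{1-|x|^2}{2}\right)^2\Delta+2\left(\frac{1-|x|^2}{2}\right)\langle x,\nabla\rangle$, where $\Delta,\nabla,\langle\cdot,\cdot\rangle$ are the Euclidean Laplacian, gradient and inner product. $P_2$ is the fourth order GJMS operator on $\mathbb{H}^4$: $P_2=P_1(P_1+2)$ with $P_1=-\Delta_g-2$ (the Yamabe operator $-\Delta_g-\frac{N(N-2)}{4}$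 for $N=4$). *)

(* Defs.v *)
From HB Require Import structures.
From mathcomp Require Import all_boot all_order all_algebra.
From mathcomp Require Import all_classical all_reals all_analysis.
From mathcomp Require Import measurable_realfun.
Set Implicit Arguments.
Unset Strict Implicit.
Unset Printing Implicit Defensive.
Import Order.TTheory GRing.Theory Num.Theory numFieldNormedType.Exports.
Local Open Scope classical_set_scope.
Local Open Scope ring_scope.

Section measurable_rV.
Variables (R : realType) (n : nat).

Definition rV_coord (i : 'I_n) (x : 'rV[R]_n) : measurableTypeR R := x ord0 i.

Let rV_set0 : g_sigma_preimage rV_coord set0.
Proof. exact: sigma_algebra0. Qed.

Let rV_setC A : g_sigma_preimage rV_coord A -> g_sigma_preimage rV_coord (~` A).
Proof. exact: sigma_algebraC. Qed.

Let rV_bigcup (F : _^nat) : (forall i, g_sigma_preimage rV_coord (F i)) ->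
  g_sigma_preimage rV_coord (\bigcup_i (F i)).
Proof. exact: sigma_algebra_bigcup. Qed.

(* The sigma-algebra generated by the coordinates, as for n.-tuple; on R^n it
   is the Borel sigma-algebra. *)
HB.instance Definition _ := @isMeasurable.Build
  (measure_tuple_display R.-ocitv.-measurable.-sigma) 'rV[R]_n
  (g_sigma_preimage rV_coord) rV_set0 rV_setC rV_bigcup.

Lemma measurable_rV_coord i : measurable_fun [set: 'rV[R]_n] (rV_coord i).
Proof.
move=> _ Y mY; rewrite setTI; apply: sub_sigma_algebra => /=.
rewrite -bigcup_seq/=; exists i => /=; first by rewrite mem_index_enum.
by exists Y => //; rewrite setTI.
Qed.

Lemma measurable_fun_rV d (T : measurableType d) (f : T -> 'rV[R]_n) :
  (forall i, measurable_fun [set: T] (rV_coord i \o f)) ->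
  measurable_fun [set: T] f.
Proof.
move=> mf; apply: (measurability
  (\big[setU/set0]_(i < n) preimage_set_system setT (@rV_coord i) measurable)).
  by [].
move=> _ [B + <-]; rewrite -bigcup_seq/= => -[i _ [C mC <-]].
by rewrite setTI -comp_preimage; exact: mf.
Qed.

End measurable_rV.

Section lebesgue_rV4.
Variable R : realType.
Local Notation mR := (measurableTypeR R).
Local Notation mu := (@lebesgue_measure R).

Definition rV4 (p : mR * mR * mR * mR) : 'rV[R]_4 :=
  \row_(i < 4) [tuple p.1.1.1; p.1.1.2; p.1.2; p.2]`_i.

Lemma measurable_rV4 : measurable_fun [set: mR * mR * mR * mR] rV4.
Proof.
have f1 := @measurable_fst _ _ (mR * mR * mR)%type mR.
have f2 := @measurable_fst _ _ (mR * mR)%type mR.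
have f3 := @measurable_fst _ _ mR mR.
apply: measurable_fun_rV => -[[|[|[|[|//]]]] i4].
- rewrite [X in measurable_fun _ X](_ : _ = fst \o (fst \o fst)); last first.
    by apply/funext => p; rewrite /rV_coord /= mxE.
  by apply: measurableT_comp => //; exact: measurableT_comp.
- rewrite [X in measurable_fun _ X](_ : _ = snd \o (fst \o fst)); last first.
    by apply/funext => p; rewrite /rV_coord /= mxE.
  by apply: measurableT_comp => //; exact: measurableT_comp.
- rewrite [X in measurable_fun _ X](_ : _ = snd \o fst); last first.
    by apply/funext => p; rewrite /rV_coord /= mxE.
  exact: measurableT_comp.
- rewrite [X in measurable_fun _ X](_ : _ = snd); last first.
    by apply/funext => p; rewrite /rV_coord /= mxE.
  exact: measurable_snd.
Qed.

Definition lebesgue_rV4 : set 'rV[R]_4 -> \bar R :=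
  pushforward (mu \x mu \x mu \x mu)%E rV4.

Let lebesgue_rV4_0 : lebesgue_rV4 set0 = 0%E.
Proof. by rewrite /lebesgue_rV4 /pushforward preimage_set0 measure0. Qed.

Let lebesgue_rV4_ge0 A : (0 <= lebesgue_rV4 A)%E.
Proof. by rewrite /lebesgue_rV4 /pushforward measure_ge0. Qed.

Let lebesgue_rV4_sigma_additive : semi_sigma_additive lebesgue_rV4.
Proof.
move=> F mF tF mUF; rewrite /lebesgue_rV4 /pushforward preimage_bigcup.
apply: measure_semi_sigma_additive.
- by move=> n; rewrite -[X in measurable X]setTI; exact: measurable_rV4.
- apply/trivIsetP => /= i j _ _ ij; rewrite -preimage_setI.
  by move/trivIsetP : tF => /(_ _ _ _ _ ij) ->//; rewrite preimage_set0.
- by rewrite -preimage_bigcup -[X in measurable X]setTI; exact: measurable_rV4.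
Qed.

HB.instance Definition _ := isMeasure.Build _ _ _ lebesgue_rV4
  lebesgue_rV4_0 lebesgue_rV4_ge0 lebesgue_rV4_sigma_additive.

End lebesgue_rV4.

Section hyperbolic_volume.
Variable R : realType.
Implicit Types x : 'rV[R]_4.

(* The library norm `|x| on 'rV is the sup norm, hence this definition. *)
Definition sqnorm x : R := \sum_(i < 4) x ord0 i ^+ 2.

Definition B4 : set 'rV[R]_4 := [set x | sqnorm x < 1].

Definition conf x : R := 2 / (1 - sqnorm x).

Lemma measurable_sqnorm : measurable_fun [set: 'rV[R]_4] sqnorm.
Proof.
apply: measurable_sum => i; apply: measurable_funX.
exact: measurable_rV_coord.
Qed.

Lemma measurable_B4 : measurable B4.
Proof.
rewrite [X in measurable X](_ : _ = [set: 'rV[R]_4] `&` sqnorm @^-1` `]-oo, 1[).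
  exact: measurable_sqnorm.
by apply/seteqP; split=> x; rewrite /B4 /= in_itv/= => // -[].
Qed.

Lemma measurable_conf : measurable_fun B4 conf.
Proof.
apply: measurable_funM => //.
pose posR : set R := [set` `]0, +oo[%R].
apply: (@measurable_comp _ _ _ _ _ _ posR (@GRing.inv R) B4
  (fun x => 1 - sqnorm x)).
- exact: measurable_itv.
- by move=> _ [x x1 <-]; rewrite /posR /= in_itv/= andbT subr_gt0.
- apply: open_continuous_measurable_fun; first exact: interval_open.
  move=> x; rewrite inE /posR /= in_itv/= andbT => x0.
  by apply: inv_continuous; rewrite gt_eqF.
- by apply: measurable_funB => //; apply: measurable_funTS;
    exact: measurable_sqnorm.
Qed.

Local Open Scope ereal_scope.

(* dv_g, as a measure on R^4 that gives no mass to the complement of the ball. *)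
Definition hyp_vol (A : set 'rV[R]_4) : \bar R :=
  \int[@lebesgue_rV4 R]_(x in A `&` B4) (conf x ^+ 4)%:E.

Let hyp_vol0 : hyp_vol set0 = 0.
Proof. by rewrite /hyp_vol set0I integral_set0. Qed.

Let hyp_vol_ge0 A : 0 <= hyp_vol A.
Proof. by apply: integral_ge0 => x _; rewrite lee_fin exprn_even_ge0. Qed.

Let hyp_vol_sigma_additive : semi_sigma_additive hyp_vol.
Proof.
move=> F mF tF mUF; rewrite /hyp_vol setI_bigcupl ge0_integral_bigcup//=.
- apply: is_cvg_ereal_nneg_natsum_cond => // n _ _.
  by apply: integral_ge0 => x _; rewrite lee_fin exprn_even_ge0.
- by move=> k; apply: measurableI => //; exact: measurable_B4.
- rewrite -setI_bigcupl; apply: (@measurable_funS _ _ _ _ B4).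
  + exact: measurable_B4.
  + exact: subIsetr.
  + by apply/measurable_EFinP; apply: measurable_funX; exact: measurable_conf.
- by move=> x _; rewrite lee_fin exprn_even_ge0.
- exact: trivIset_setIr.
Qed.

HB.instance Definition _ := isMeasure.Build _ _ _ hyp_vol
  hyp_vol0 hyp_vol_ge0 hyp_vol_sigma_additive.

End hyperbolic_volume.

Section GJMS.
Variable R : realType.
Implicit Types u : 'rV[R]_4 -> R.

Definition partial (i : 'I_4) u : 'rV[R]_4 -> R :=
  fun x => 'D_(delta_mx ord0 i) u x.

Fixpoint Ck (k : nat) u : Prop :=
  match k with
  | 0%N => continuous u
  | S k' => continuous u /\ forall i : 'I_4,
      (forall x, derivable u x (delta_mx ord0 i)) /\ Ck k' (partial i u)
  end.

(* C^oo_c(H^4): a function on the ball with compact support is identified with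
   its extension by 0 to R^4. *)
Definition Cinf_c u : Prop :=
  [/\ forall k, Ck k u,
      compact (closure [set x | u x != 0]) &
      closure [set x | u x != 0] `<=` @B4 R].

Definition hyp_laplacian u : 'rV[R]_4 -> R := fun x =>
  ((1 - sqnorm x) / 2) ^+ 2 * (\sum_(i < 4) partial i (partial i u) x)
  + 2 * ((1 - sqnorm x) / 2) * (\sum_(i < 4) x ord0 i * partial i u x).

Definition P1 u : 'rV[R]_4 -> R := fun x => - hyp_laplacian u x - 2 * u x.

Definition P2 u : 'rV[R]_4 -> R := P1 (fun x => P1 u x + 2 * u x).

Local Open Scope ereal_scope.

Definition adams_ineq (alpha C : R) : Prop :=
  forall u, Cinf_c u ->
    \int[@hyp_vol R]_x (P2 u x * u x)%:E <= 1 ->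
    \int[@hyp_vol R]_x (expR (alpha * u x ^+ 2) - 1)%:E
      <= C%:E * 'N[@hyp_vol R]_(2%:E)[EFin \o u] ^+ 2.

End GJMS.

(* Main.v *)
(* With [W x = 1 - |x|^2], the conformal covariance [P2 u = (W / 2)^4 Lap (Lap u)] turns the
   energy into [\int (Lap u)^2 dx], and two integrations by parts give
   [4 \int u^2 / W^4 <= \int (Lap u)^2].

   Subcritical case. Let [H_t u] be the average of [u] for the Gaussian density proportional
   to [exp (- t |z|^2)]. Integrating the heat equation in [t] and using Cauchy-Schwarz,
   [|H_B u - H_A u| <= sqrt (ln (B / A) / (16 pi^2))] when the energy is at most 1. At the
   scale [A ~ |u|_2^-1 W x^-2] the average [H_A u x] is bounded by a constant, so where
   [|u x| >= s] a choice of [B] with [ln (B / A)] slightly below [16 pi^2 s^2] makes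
   [u x - H_B u x] larger than a multiple of [s]. But the integral over the ball of [W^-4]
   times the square of that oscillation is [O ((A / B)^2 |u|_2^2)], hence [{|u| >= s}] has
   volume [O (|u|_2^2 exp (- 32 pi^2 (1 - eps) s^2))], and summing over the levels of [u^2]
   concludes.

   Critical case. Multiples of smooth truncations of [- ln (|x|^2 + e)] satisfy
   [32 pi^2 u^2 >= 2 ln (1 / e) - O(1)] on the ball [|x|^2 <= e], whose volume is of order
   [e^2], so that the left-hand side stays bounded below whereas [|u|_2 -> 0]. *)

Require Import Defs.
From HB Require Import structures.
From mathcomp Require Import all_boot all_order all_algebra.
From mathcomp Require Import all_classical all_reals all_analysis.
From mathcomp Require Import measurable_realfun.
From mathcomp Require Import ring lra.
Set Implicit Arguments.
Unset Strict Implicit.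
Unset Printing Implicit Defensive.
Import Order.TTheory GRing.Theory Num.Theory numFieldNormedType.Exports.
Local Open Scope classical_set_scope.
Local Open Scope ring_scope.

(** * Lebesgue measure on ['rV_4] *)

(** Only the passage from [A] to [B] has to be sharp: the kernel taking [lap u] to
    [heat B u - heat A u] has squared [L^2] norm at most [ln (B / A) / (16 pi^2)], with the right
    leading coefficient. Every other term costs a constant or a small multiple of the level, which
    the gap below [32 pi^2] absorbs. The exponent doubles because the oscillation is of second
    order: its weighted square is bounded by the fourth power of the averaging length relative to
    [W x], that is by [B^-2] up to that normalisation. A gradient term would not scale like this; it
    cancels by reflection in each coordinate. The volume is infinite, so the averaging length at [x]
    has to be proportional to [W x], and the oscillation is restricted to [|z| <= W x / 4], where
    [W] stays comparable; the rest is controlled by the weighted [L^2] norm through tail estimates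
    that are scale invariant in dimension 4. Starting from a length tied to [|u|_2] is what makes
    the level set bound proportional to [|u|_2^2]. *)

Section topology_rV4.
Variable R : realType.
Implicit Types (x y : 'rV[R]_4) (U : set 'rV[R]_4).

(** The sigma-algebra is generated by the coordinates, so an open set is exhibited as a countable
    union: that of the boxes with rational centre and radius [1 / (n + 1)] which it contains. *)
Lemma open_measurable_rV4 U : open U -> measurable U.
Proof.
move=> oU.
pose box (cn : 'rV[rat]_4 * nat) : set 'rV[R]_4 :=
  [set x | forall i : 'I_4, `|x ord0 i - ratr (cn.1 ord0 i)| < cn.2.+1%:R^-1].
have mbox cn : measurable (box cn).
  rewrite (_ : box cn = \bigcap_(i in [set: 'I_4])
    (@rV_coord R 4 i @^-1` [set r | `|r - ratr (cn.1 ord0 i)| < cn.2.+1%:R^-1])).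
    apply: fin_bigcap_measurable => // i _.
    rewrite -[X in measurable X]setTI; apply: measurable_rV_coord => //.
    rewrite (_ : [set r | _] = ball (ratr (cn.1 ord0 i) : R) cn.2.+1%:R^-1).
      exact: measurable_ball.
    by apply/seteqP; split => r; rewrite /ball /= distrC.
  by apply/seteqP; split => x /=; [move=> H i _; exact: H|move=> H i; exact: H].
rewrite (_ : U = \bigcup_cn (if `[< box cn `<=` U >] then box cn else set0)).
  apply: countable_bigcupT_measurable => // cn.
  by case: ifPn => // _; exact: mbox.
apply/seteqP; split => [x Ux|x [cn _]]; last first.
  by case: ifPn => // /asboolP; exact.
have /nbhs_ballP[e /= e0 xeU] : nbhs x U by exact: open_nbhs_nbhs.
(* Half the radius: the box containing [x] is centred at a rational point up to [e / 2] away from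
   it. *)
have [n ne] : exists n : nat, n.+1%:R^-1 < e / 2.
  have e20 : 0 < e / 2 by rewrite divr_gt0.
  have := near_infty_natSinv_lt (PosNum e20).
  by move=> -[n _ /(_ n (leqnn n)) /= ?]; exists n.
have hc i : exists q : rat, `|x ord0 i - ratr q| < n.+1%:R^-1.
  have lt : x ord0 i - n.+1%:R^-1 < x ord0 i by rewrite ltrBlDr ltrDl invr_gt0.
  have [q] := rat_in_itvoo lt.
  rewrite in_itv/= => /andP[q1 q2]; exists q.
  by rewrite gtr0_norm ?subr_gt0// ltrBlDr -ltrBlDl.
pose c : 'rV[rat]_4 := \row_i sval (cid (hc i)).
have cE i : `|x ord0 i - ratr (c ord0 i)| < n.+1%:R^-1.
  by rewrite mxE; exact: (svalP (cid (hc i))).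
have sub : box (c, n) `<=` U.
  move=> y yb; apply: xeU; split=> // i j /=; rewrite (ord1 i) /ball /=.
  rewrite (le_lt_trans (ler_distD (ratr (c ord0 j)) _ _))//.
  rewrite [ltRHS]splitr ltrD//; first exact: lt_trans (cE j) ne.
  by rewrite distrC; exact: lt_trans (yb j) ne.
by exists (c, n) => //; case: ifPn => [//|/asboolP].
Qed.

Lemma continuous_measurable_rV4 (f : 'rV[R]_4 -> R) :
  continuous f -> measurable_fun [set: 'rV[R]_4] f.
Proof.
move=> /continuousP cf.
apply: (measurability (@RGenOpens.G R) (RGenOpens.measurableE R)).
move=> _ [A [a [b ->]] <-]; rewrite setTI; apply: open_measurable_rV4.
by apply: cf; exact: interval_open.
Qed.

End topology_rV4.

(** * Invariance of integrals on the line and on products *)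

Section lebesgue_1d.
Variable R : realType.
Local Notation mR := (measurableTypeR R).
Local Notation mu := (@lebesgue_measure R).
Local Open Scope ereal_scope.

Section product_sigma_finite.
Context d1 d2 (T1 : measurableType d1) (T2 : measurableType d2).
Variables (m1 : {sigma_finite_measure set T1 -> \bar R})
  (m2 : {sigma_finite_measure set T2 -> \bar R}).

Let sigma_finite_prod : sigma_finite setT (m1 \x m2).
Proof.
have /sigma_finiteP[F [TF ndF Foo]] := sigma_finiteT m1.
have /sigma_finiteP[G [TG ndG Goo]] := sigma_finiteT m2.
exists (fun n => F n `*` G n).
  rewrite -setXTT TF TG; apply/seteqP; split=> -[x y].
    move=> [/= [n _ Fnx] [k _ Gky]]; exists (maxn n k) => //; split.
    - by move: x Fnx; exact/subsetPset/ndF/leq_maxl.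
    - by move: y Gky; exact/subsetPset/ndG/leq_maxr.
  by move=> [n _ []/= ? ?]; split; exists n.
move=> k; have [? ?] := Foo k; have [? ?] := Goo k.
split; first exact: measurableX.
by rewrite product_measure1E// lte_mul_pinfty// ge0_fin_numE.
Qed.

(* The library instance on [m1 \x m2] is only found for finite measures. *)
Definition product_sigma_finite :
    {sigma_finite_measure set (T1 * T2)%type -> \bar R} :=
  HB.pack_for {sigma_finite_measure set (T1 * T2)%type -> \bar R} (m1 \x m2)
    (Measure_isSigmaFinite.Build _ _ _ (m1 \x m2) sigma_finite_prod).

End product_sigma_finite.

(** Invariance is phrased with integrals of nonnegative functions and not with measures of sets, so
    that it passes to products by Tonelli alone. *)
Definition preserves d (T : measurableType d) (m : set T -> \bar R)
    (t : T -> T) :=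
  measurable_fun [set: T] t /\
  forall f : T -> \bar R, measurable_fun [set: T] f -> (forall x, 0 <= f x) ->
    \int[m]_x f (t x) = \int[m]_x f x.

Lemma preserves_id d (T : measurableType d) (m : {measure set T -> \bar R}) :
  preserves m id.
Proof. by split. Qed.

Lemma preserves_pair d1 d2 (T1 : measurableType d1) (T2 : measurableType d2)
    (m1 : {sigma_finite_measure set T1 -> \bar R})
    (m2 : {sigma_finite_measure set T2 -> \bar R}) t1 t2 :
  preserves m1 t1 -> preserves m2 t2 ->
  preserves (m1 \x m2) (fun p => (t1 p.1, t2 p.2)).
Proof.
move=> [mt1 p1] [mt2 p2].
have mt : measurable_fun setT (fun p : T1 * T2 => (t1 p.1, t2 p.2)).
  by apply: measurable_fun_pair; apply: measurableT_comp.
split=> // f mf f0.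
rewrite fubini_tonelli1//; last exact: measurableT_comp.
rewrite fubini_tonelli1// /fubini_F/=.
transitivity (\int[m1]_x (fun x => \int[m2]_y f (x, y)) (t1 x)).
  apply: eq_integral => x _ /=.
  by rewrite (p2 (fun y => f (t1 x, y)))//; exact: measurableT_comp.
apply: (p1 (fun x => \int[m2]_y f (x, y))).
- exact: (measurable_fun_fubini_tonelli_F f).
- by move=> x; exact: integral_ge0.
Qed.

Section quadruple.
Context d1 d2 d3 d4 (T1 : measurableType d1) (T2 : measurableType d2)
  (T3 : measurableType d3) (T4 : measurableType d4).
Variables (m1 : {sigma_finite_measure set T1 -> \bar R})
  (m2 : {sigma_finite_measure set T2 -> \bar R})
  (m3 : {sigma_finite_measure set T3 -> \bar R})
  (m4 : {sigma_finite_measure set T4 -> \bar R}).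

Lemma preserves_quadruple t1 t2 t3 t4 : preserves m1 t1 -> preserves m2 t2 ->
  preserves m3 t3 -> preserves m4 t4 ->
  preserves (m1 \x m2 \x m3 \x m4)
    (fun p => (t1 p.1.1.1, t2 p.1.1.2, t3 p.1.2, t4 p.2)).
Proof.
move=> p1 p2 p3 p4.
have p12 := preserves_pair p1 p2.
have p123 := @preserves_pair _ _ _ _ (product_sigma_finite m1 m2) m3 _ _ p12 p3.
exact: (@preserves_pair _ _ _ _
  (product_sigma_finite (product_sigma_finite m1 m2) m3) m4 _ _ p123 p4).
Qed.

End quadruple.

Lemma ge0_integral_prod d1 d2 (T1 : measurableType d1) (T2 : measurableType d2)
    (m1 : {sigma_finite_measure set T1 -> \bar R})
    (m2 : {sigma_finite_measure set T2 -> \bar R})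
    (f1 : T1 -> \bar R) (f2 : T2 -> \bar R) :
  measurable_fun setT f1 -> measurable_fun setT f2 ->
  (forall x, 0 <= f1 x) -> (forall x, 0 <= f2 x) ->
  \int[m1 \x m2]_p (f1 p.1 * f2 p.2) = \int[m1]_x f1 x * \int[m2]_x f2 x.
Proof.
move=> m1f m2f f10 f20; rewrite fubini_tonelli1/=; last 2 first.
- by apply: emeasurable_funM; apply: measurableT_comp.
- by move=> p; rewrite mule_ge0.
rewrite /fubini_F/=.
transitivity (\int[m1]_x (f1 x * \int[m2]_y f2 y)).
  by apply: eq_integral => x _; rewrite ge0_integralZl.
by rewrite ge0_integralZr//; exact: integral_ge0.
Qed.

Lemma ge0_integral_quadruple d1 d2 d3 d4 (T1 : measurableType d1)
    (T2 : measurableType d2) (T3 : measurableType d3) (T4 : measurableType d4)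
    (m1 : {sigma_finite_measure set T1 -> \bar R})
    (m2 : {sigma_finite_measure set T2 -> \bar R})
    (m3 : {sigma_finite_measure set T3 -> \bar R})
    (m4 : {sigma_finite_measure set T4 -> \bar R})
    (f1 : T1 -> \bar R) (f2 : T2 -> \bar R) (f3 : T3 -> \bar R) (f4 : T4 -> \bar R) :
  measurable_fun setT f1 -> measurable_fun setT f2 ->
  measurable_fun setT f3 -> measurable_fun setT f4 ->
  (forall x, 0 <= f1 x) -> (forall x, 0 <= f2 x) ->
  (forall x, 0 <= f3 x) -> (forall x, 0 <= f4 x) ->
  \int[m1 \x m2 \x m3 \x m4]_p (f1 p.1.1.1 * f2 p.1.1.2 * f3 p.1.2 * f4 p.2) =
  \int[m1]_x f1 x * \int[m2]_x f2 x * \int[m3]_x f3 x * \int[m4]_x f4 x.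
Proof.
move=> mf1 mf2 mf3 mf4 f10 f20 f30 f40.
transitivity (\int[m1 \x m2 \x m3]_p (f1 p.1.1 * f2 p.1.2 * f3 p.2) *
  \int[m4]_x f4 x).
  apply: (@ge0_integral_prod _ _ _ _ (product_sigma_finite (product_sigma_finite m1 m2) m3) m4 (fun p => f1 p.1.1 * f2 p.1.2 * f3 p.2) f4) => //.
  + apply: emeasurable_funM; first apply: emeasurable_funM.
    * by apply: measurableT_comp => //; exact: measurableT_comp.
    * by apply: measurableT_comp => //; exact: measurableT_comp.
    * exact: measurableT_comp.
  + by move=> x; rewrite !mule_ge0.
congr (_ * _).
transitivity (\int[m1 \x m2]_p (f1 p.1 * f2 p.2) * \int[m3]_x f3 x).
  apply: (@ge0_integral_prod _ _ _ _ (product_sigma_finite m1 m2) m3 (fun p => f1 p.1 * f2 p.2) f3) => //.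
  + by apply: emeasurable_funM; apply: measurableT_comp.
  + by move=> x; rewrite !mule_ge0.
by congr (_ * _); exact: ge0_integral_prod.
Qed.

Lemma preserves_pushforward (t : mR -> mR) :
  measurable_fun setT t -> (forall A, measurable A -> pushforward mu t A = mu A) ->
  preserves mu t.
Proof.
move=> mt H; split=> // f mf f0.
rewrite -(@ge0_integral_pushforward _ _ _ _ _ t mt mu setT f)//.
by apply: eq_measure_integral => A mA _; first [exact: H|exact/esym/H].
Qed.

(** Lebesgue measure is determined by its values on the intervals []u, v]]. *)
Lemma preserves_shift (a : R) : preserves mu (fun x : mR => (x + a)%R).
Proof.
have mt : @measurable_fun _ _ mR mR setT (fun x : mR => (x + a)%R).
  exact: measurable_funD.
apply: preserves_pushforward => // A mA.
pose tm : {mfun mR >-> mR} := HB.pack (fun x : mR => (x + a)%R : mR)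
  (isMeasurableFun.Build _ _ _ _ _ mt).
apply/esym; apply: (@lebesgue_measure_unique R (pushforward mu tm)) => //= _ [[u v]] _ <-.
rewrite /pushforward (_ : _ @^-1` _ = `](u - a)%R, (v - a)%R]%classic).
  rewrite !lebesgue_measure_itv/= !lte_fin ltrD2r -!EFinB.
  by case: ifPn => // _; congr EFin; ring.
by apply/seteqP; split => x; rewrite /= !in_itv/= ltrBlDr lerBrDr.
Qed.

Lemma preserves_opp : preserves mu (fun x : mR => (- x)%R).
Proof.
apply: preserves_pushforward; first exact: measurableT_comp.
by move=> A mA; exact: lebesgue_measureN.
Qed.

(** Read off from the normal density of variance [1 / (2 c)], whose total mass is 1. *)
Lemma ge0_integral_gauss (c : R) : (0 < c)%R ->
  \int[mu]_x (expR (- c * x ^+ 2))%:E = (Num.sqrt (pi / c))%:E.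
Proof.
move=> c0; pose s := Num.sqrt (c *+ 2)^-1.
have s2 : (s ^+ 2 = (c *+ 2)^-1)%R by rewrite sqr_sqrtr// invr_ge0 mulrn_wge0// ltW.
have s0 : s != 0%R.
  by rewrite gt_eqF// sqrtr_gt0 invr_gt0 mulrn_wgt0.
have := integral_normal_pdf (0 : R) s.
have cne : c != 0%R by rewrite gt_eqF.
have -> : (fun x => (normal_pdf 0 s x)%:E) =
   (fun x => (normal_peak s)%:E * (expR (- c * x ^+ 2))%:E).
  apply/funext => x; rewrite normal_pdfE// -EFinM; congr (_ * expR _)%:E.
  by rewrite subr0 s2; field.
have p0 := normal_peak_gt0 s0.
rewrite ge0_integralZl//; last 2 first.
- apply/measurable_EFinP; apply: measurableT_comp => //.
  by apply: measurable_funM => //; apply: measurable_funX.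
- by rewrite lee_fin ltW.
move=> /(congr1 (fun e => (normal_peak s)^-1%:E * e)).
rewrite muleA -EFinM mulVf ?gt_eqF// mul1e mule1 => ->.
congr EFin; rewrite /normal_peak invrK s2; congr Num.sqrt; field => //.
Qed.

End lebesgue_1d.

(** * Invariance and Gaussian integrals on R^4 *)

Section lebesgue_rV4_theory.
Variable R : realType.
Local Notation mR := (measurableTypeR R).
Local Notation mu := (@lebesgue_measure R).
Local Notation lam := (@lebesgue_rV4 R).
Local Open Scope ereal_scope.
Notation i0 := (@Ordinal 4 0 isT).
Notation i1 := (@Ordinal 4 1 isT).
Notation i2 := (@Ordinal 4 2 isT).
Notation i3 := (@Ordinal 4 3 isT).

Lemma forall_ord4 (P : 'I_4 -> Prop) :
  P i0 -> P i1 -> P i2 -> P i3 -> forall i, P i.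
Proof.
move=> P0 P1 P2 P3 [[|[|[|[|//]]]] h].
- by have -> : Ordinal h = i0 by exact: val_inj.
- by have -> : Ordinal h = i1 by exact: val_inj.
- by have -> : Ordinal h = i2 by exact: val_inj.
- by have -> : Ordinal h = i3 by exact: val_inj.
Qed.

Lemma sum_ord4 (V : nmodType) (F : 'I_4 -> V) :
  (\sum_(i < 4) F i = F i0 + F i1 + F i2 + F i3)%R.
Proof.
rewrite !big_ord_recr big_ord0 /= add0r.
congr (F _ + F _ + F _ + F _)%R; exact: val_inj.
Qed.

Lemma rV4E (p : mR * mR * mR * mR) :
  [/\ rV4 p ord0 i0 = p.1.1.1, rV4 p ord0 i1 = p.1.1.2,
      rV4 p ord0 i2 = p.1.2 & rV4 p ord0 i3 = p.2].
Proof. by rewrite !mxE. Qed.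

Lemma sqnorm_rV4 (p : mR * mR * mR * mR) :
  (sqnorm (rV4 p) = p.1.1.1 ^+ 2 + p.1.1.2 ^+ 2 + p.1.2 ^+ 2 + p.2 ^+ 2)%R.
Proof. by rewrite /sqnorm sum_ord4; have [-> -> -> ->] := rV4E p. Qed.

Lemma ge0_integral_rV4 (f : 'rV[R]_4 -> \bar R) :
  measurable_fun setT f -> (forall x, 0 <= f x) ->
  \int[lam]_x f x = \int[mu \x mu \x mu \x mu]_p f (rV4 p).
Proof.
move=> mf f0.
rewrite (@ge0_integral_pushforward _ _ _ _ _ _ (@measurable_rV4 R) _ setT)//.
Qed.

Lemma lebesgue_cube_fin (n : nat) :
  lam [set x : 'rV[R]_4 | forall i : 'I_4, x ord0 i \in `[(- n%:R)%R, n%:R]] < +oo.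
Proof.
rewrite /lebesgue_rV4 /pushforward.
pose I : set mR := `[(- n%:R)%R, n%:R]%classic.
have mI : measurable I by exact: measurable_itv.
rewrite (_ : _ @^-1` _ = I `*` I `*` I `*` I); last first.
  apply/seteqP; split => -[[[a b] c] d].
    move=> H; have [h0 h1 h2 h3] := rV4E (a, b, c, d).
    move: (H i0) (H i1) (H i2) (H i3); rewrite h0 h1 h2 h3 /= => *.
    by split; [split; [split|]|].
  move=> [[[/= ha hb] hc] hd]; have [h0 h1 h2 h3] := rV4E (a, b, c, d).
  by apply: forall_ord4; [rewrite h0|rewrite h1|rewrite h2|rewrite h3].
have mI2 : measurable (I `*` I) by exact: measurableX.
have mI3 : measurable (I `*` I `*` I) by exact: measurableX.
have e1 := @product_measure1E _ _ _ _ R mu mu I I mI mI.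
have e2 := @product_measure1E _ _ _ _ R (product_sigma_finite mu mu) mu _ I mI2 mI.
have e3 := @product_measure1E _ _ _ _ R
  (product_sigma_finite (product_sigma_finite mu mu) mu) mu _ I mI3 mI.
rewrite [X in X < _]e3 [X in X * _ < _]e2 [X in X * _ * _ < _]e1.
have If : mu I < +oo.
  rewrite /I lebesgue_measure_itv/=; case: ifPn => // _.
  by rewrite -EFinB ltry.
have If' : mu I \is a fin_num by rewrite ge0_fin_numE.
by rewrite !lte_mul_pinfty//; rewrite ?fin_numM// ?mule_ge0.
Qed.

Lemma sigma_finite_rV4 : sigma_finite setT lam.
Proof.
exists (fun n : nat => [set x : 'rV[R]_4 | forall i : 'I_4, x ord0 i \in `[(- n%:R)%R, n%:R]]).
  apply/seteqP; split => // x _.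
  pose n := Num.truncn (\sum_(i < 4) `|x ord0 i|)%R.
  exists n.+1 => // i; rewrite in_itv/= -ler_norml ltW//.
  apply: le_lt_trans (truncnS_gt _).
  by rewrite (bigD1 i)//= lerDl sumr_ge0.
move=> n.
have mB : measurable [set x : 'rV[R]_4 | forall i : 'I_4, x ord0 i \in `[(- n%:R)%R, n%:R]].
  rewrite (_ : mkset _ = \bigcap_(i in [set: 'I_4])
    (@rV_coord R 4 i @^-1` `[(- n%:R)%R, n%:R]%classic)).
    apply: fin_bigcap_measurable => // i _.
    by rewrite -[X in measurable X]setTI; apply: measurable_rV_coord.
  by apply/seteqP; split => x /=; [move=> H i _; exact: H|move=> H i; exact: H].
by split => //; exact: lebesgue_cube_fin.
Qed.

HB.instance Definition _ := Measure_isSigmaFinite.Build _ _ _ lam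
  sigma_finite_rV4.

Lemma preserves_rV4 (t : 'I_4 -> mR -> mR) :
  (forall i, preserves mu (t i)) ->
  preserves lam (fun x => \row_i t i (x ord0 i)).
Proof.
move=> pt.
have mt : measurable_fun [set: 'rV[R]_4] (fun x => \row_i t i (x ord0 i)).
  apply: measurable_fun_rV => i.
  rewrite (_ : _ \o _ = t i \o @rV_coord R 4 i); last first.
    by apply/funext => x; rewrite /rV_coord /= mxE.
  by apply: measurableT_comp; [exact: (pt i).1|exact: measurable_rV_coord].
split=> // f mf f0.
rewrite ge0_integral_rV4//; last exact: measurableT_comp.
rewrite ge0_integral_rV4//.
have p4 := preserves_quadruple (pt i0) (pt i1) (pt i2) (pt i3).
rewrite -(p4.2 (fun p => f (rV4 p)))//=; last first.
  by apply: measurableT_comp => //; exact: measurable_rV4.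
apply: eq_integral => -[[[a b] c] d] _; congr f.
apply/rowP; have [h0 h1 h2 h3] := rV4E (a, b, c, d).
have [k0 k1 k2 k3] := rV4E (t i0 a, t i1 b, t i2 c, t i3 d).
by apply: forall_ord4; rewrite mxE ?k0 ?k1 ?k2 ?k3 ?h0 ?h1 ?h2 ?h3.
Qed.

Lemma preserves_translate (a : 'rV[R]_4) : preserves lam (fun x => x + a)%R.
Proof.
have := preserves_rV4 (fun i => preserves_shift (a ord0 i)).
by congr preserves; apply/funext => x; apply/rowP => i; rewrite !mxE.
Qed.

(** Reflections serve to discard the first order terms of the Taylor expansions, which are odd in
    one coordinate. *)
Lemma preserves_flip (j : 'I_4) :
  preserves lam (fun x => \row_i (if i == j then - x ord0 i else x ord0 i)%R).
Proof.
pose t (i : 'I_4) : mR -> mR := if i == j then (fun x => - x)%R else id.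
have pt i : preserves mu (t i).
  by rewrite /t; case: ifPn => _; [exact: preserves_opp|exact: preserves_id].
have := preserves_rV4 pt.
by congr preserves; apply/funext => x; apply/rowP => i; rewrite !mxE /t; case: ifP.
Qed.

Lemma preserves_integral d (T : measurableType d) (m : {measure set T -> \bar R})
    t (f : T -> \bar R) : preserves m t -> measurable_fun setT f ->
  \int[m]_x f (t x) = \int[m]_x f x.
Proof.
move=> [mt p] mf; rewrite [LHS]integralE [RHS]integralE.
congr (_ - _).
- have := p f^\+ (measurable_funepos mf) (funepos_ge0 f).
  by move=> <-; apply: eq_integral => x _; rewrite -[fun x0 => f (t x0)]/(f \o t) funepos_comp.
- have := p f^\- (measurable_funeneg mf) (funeneg_ge0 f).
  by move=> <-; apply: eq_integral => x _; rewrite -[fun x0 => f (t x0)]/(f \o t) funeneg_comp.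
Qed.

Lemma ge0_integral_gauss4 (c : R) : (0 < c)%R ->
  \int[lam]_x (expR (- c * sqnorm x))%:E = (pi ^+ 2 / c ^+ 2)%:E.
Proof.
move=> c0.
pose g (x : mR) : \bar R := (expR (- c * x ^+ 2))%:E.
have mg : measurable_fun setT g.
  apply/measurable_EFinP; apply: measurableT_comp => //.
  by apply: measurable_funM => //; apply: measurable_funX.
have g0 x : 0 <= g x by rewrite lee_fin expR_ge0.
rewrite ge0_integral_rV4; last 2 first.
- apply/measurable_EFinP; apply: measurableT_comp => //.
  by apply: measurable_funM => //; exact: measurable_sqnorm.
- by move=> x; rewrite lee_fin expR_ge0.
transitivity (\int[mu \x mu \x mu \x mu]_p (g p.1.1.1 * g p.1.1.2 * g p.1.2 * g p.2)).
  apply: eq_integral => p _; rewrite sqnorm_rV4 /g -!EFinM -!expRD.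
  by congr (expR _)%:E; ring.
rewrite (ge0_integral_quadruple mu mu mu mu)//.
rewrite /g ge0_integral_gauss// -!EFinM; congr EFin.
have pc : (0 <= pi / c)%R by rewrite divr_ge0 ?pi_ge0 ?ltW.
by rewrite -mulrA -!expr2 sqr_sqrtr// exprMn exprVn.
Qed.

End lebesgue_rV4_theory.

(** * Differential calculus *)

Section derive_lines.
Variables (R : realType) (V : normedModType R).

Lemma is_derive_line (f : V -> R) (x v : V) (t : R) d :
  is_derive (x + t *: v) v f d ->
  is_derive t 1 (fun s : R => f (x + s *: v)) d.
Proof.
move=> [df dE].
have E : (fun h : R => h^-1 *: (((fun s : R => f (x + s *: v)) \o shift t) (h *: 1)
    - f (x + t *: v)))
  = (fun h : R => h^-1 *: ((f \o shift (x + t *: v)) (h *: v) - f (x + t *: v))).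
  apply/funext => h /=; rewrite /shift; congr (_ *: (f _ - _)).
  by rewrite scalerDl scaler1 addrCA.
split; first by rewrite /derivable E.
by rewrite -dE /derive E.
Qed.

End derive_lines.

(** * Calculus of iterated partial derivatives *)

Section Ck_theory.
Variable R : realType.
Implicit Types (u v : 'rV[R]_4 -> R) (x : 'rV[R]_4) (i : 'I_4).
Local Notation e_ i := (delta_mx ord0 i : 'rV[R]_4).

Lemma Ck_continuous k u : Ck k u -> continuous u.
Proof. by case: k => [//|k] []. Qed.

Lemma Ck_derivable k u : Ck k.+1 u -> forall i x, derivable u x (e_ i).
Proof. by move=> [_ H] i x; have [] := H i. Qed.

Lemma Ck_partial k u i : Ck k.+1 u -> Ck k (partial i u).
Proof. by move=> [_ H]; have [] := H i. Qed.

Lemma CkW k u : Ck k.+1 u -> Ck k u.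
Proof.
elim: k u => [|k IH] u; first by move=> [].
move=> [cu H]; split=> // i; have [du Cu] := H i; split=> //; exact: IH.
Qed.

Lemma Ck_le k l u : (k <= l)%N -> Ck l u -> Ck k u.
Proof.
elim: l => [|l IH]; first by rewrite leqn0 => /eqP ->.
by rewrite leq_eqVlt => /predU1P[->//|kl] /CkW; exact: IH.
Qed.

Lemma is_partial k u i x : Ck k.+1 u -> is_derive x (e_ i) u (partial i u x).
Proof. by move=> Cu; split => //; exact: Ck_derivable Cu i x. Qed.

Lemma partialE u du i : (forall x, is_derive x (e_ i) u (du x)) -> partial i u = du.
Proof. by move=> H; apply/funext => x; rewrite /partial; exact: derive_val. Qed.

Lemma Ck_intro k u (du : 'I_4 -> 'rV[R]_4 -> R) : continuous u ->
  (forall i x, is_derive x (e_ i) u (du i x)) -> (forall i, Ck k (du i)) -> Ck k.+1 u.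
Proof.
move=> cu H Cdu; split=> // i; split; first by move=> x; case: (H i x).
by rewrite (partialE (H i)).
Qed.

Lemma Ck_cst k (c : R) : Ck k (fun=> c).
Proof.
elim: k c => [|k IH] c; first exact: cst_continuous.
apply: (@Ck_intro _ _ (fun _ _ => 0)) => //.
- exact: cst_continuous.
Qed.

Lemma is_partialD k u v i x : Ck k.+1 u -> Ck k.+1 v ->
  is_derive x (e_ i) (fun x => u x + v x) (partial i u x + partial i v x).
Proof. by move=> Cu Cv; apply: is_deriveD; apply: is_partial; eauto. Qed.

Lemma is_partialM k u v i x : Ck k.+1 u -> Ck k.+1 v ->
  is_derive x (e_ i) (fun x => u x * v x) (partial i u x * v x + u x * partial i v x).
Proof.
move=> Cu Cv; have du := is_partial i x Cu; have dv := is_partial i x Cv.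
apply: (is_derive_eq (is_deriveM du dv)).
by rewrite /GRing.scale/= mulrC addrC [_ * v x]mulrC addrC [partial i v x * _]mulrC addrC.
Qed.

Lemma partialD k u v i : Ck k.+1 u -> Ck k.+1 v ->
  partial i (fun x => u x + v x) = (fun x => partial i u x + partial i v x).
Proof. by move=> Cu Cv; apply: partialE => x; exact: is_partialD Cu Cv. Qed.

Lemma partialM k u v i : Ck k.+1 u -> Ck k.+1 v ->
  partial i (fun x => u x * v x) = (fun x => partial i u x * v x + u x * partial i v x).
Proof. by move=> Cu Cv; apply: partialE => x; exact: is_partialM Cu Cv. Qed.

Lemma CkD k u v : Ck k u -> Ck k v -> Ck k (fun x => u x + v x).
Proof.
have IH0 (f g : 'rV[R]_4 -> R) : continuous f -> continuous g -> continuous (fun x => f x + g x).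
  by move=> cf cg x; apply: (@continuousD _ _ _ f g x); [exact: cf|exact: cg].
elim: k u v => [|k IH] u v Cu Cv; first exact: IH0.
apply: (@Ck_intro _ _ (fun i x => partial i u x + partial i v x)).
- by apply: (IH0 u v); [exact: (Ck_continuous Cu)|exact: (Ck_continuous Cv)].
- by move=> i x; exact: is_partialD Cu Cv.
- by move=> i; apply: IH; exact: Ck_partial.
Qed.

Lemma CkM k u v : Ck k u -> Ck k v -> Ck k (fun x => u x * v x).
Proof.
have IH0 (f g : 'rV[R]_4 -> R) : continuous f -> continuous g -> continuous (fun x => f x * g x).
  by move=> cf cg x; apply: (@continuousM _ _ f g x); [exact: cf|exact: cg].
elim: k u v => [|k IH] u v Cu Cv; first exact: IH0.
apply: (@Ck_intro _ _ (fun i x => partial i u x * v x + u x * partial i v x)).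
- by apply: (IH0 u v); [exact: (Ck_continuous Cu)|exact: (Ck_continuous Cv)].
- by move=> i x; exact: is_partialM Cu Cv.
- by move=> i; apply: CkD; apply: IH; do ?[exact: Ck_partial|exact: CkW].
Qed.

Lemma CkZ k (c : R) u : Ck k u -> Ck k (fun x => c * u x).
Proof. by move=> Cu; apply: CkM => //; exact: Ck_cst. Qed.

Lemma partial_cst (c : R) i : partial i (fun=> c) = (fun=> 0).
Proof. by apply: partialE => x; exact: is_derive_cst. Qed.

Lemma partialZ k c u i : Ck k.+1 u ->
  partial i (fun x => c * u x) = (fun x => c * partial i u x).
Proof.
move=> Cu; rewrite (partialM i (Ck_cst k.+1 c) Cu) partial_cst.
by apply/funext => x; rewrite mul0r add0r.
Qed.

Lemma CkN k u : Ck k u -> Ck k (fun x => - u x).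
Proof.
move=> Cu; rewrite (_ : (fun x => - u x) = (fun x => -1 * u x)); first exact: CkZ.
by apply/funext => x; rewrite mulN1r.
Qed.

Lemma Ck_sum k n (u : 'I_n -> 'rV[R]_4 -> R) : (forall l, Ck k (u l)) ->
  Ck k (fun x => \sum_(i < n) u i x).
Proof.
elim: n u => [|n IH] u Cu.
  rewrite (_ : (fun x => _) = fun=> 0); first exact: Ck_cst.
  by apply/funext => x; rewrite big_ord0.
rewrite (_ : (fun x => _) = fun x => u ord0 x + \sum_(i < n) u (lift ord0 i) x).
  by apply: CkD => //; apply: IH.
by apply/funext => x; rewrite big_ord_recl.
Qed.

Lemma partial_sum k n (u : 'I_n -> 'rV[R]_4 -> R) i : (forall l, Ck k.+1 (u l)) ->
  partial i (fun x => \sum_(l < n) u l x) = (fun x => \sum_(l < n) partial i (u l) x).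
Proof.
elim: n u => [|n IH] u Cu.
  rewrite (_ : (fun x => _) = fun=> 0); last by apply/funext => x; rewrite big_ord0.
  by rewrite partial_cst; apply/funext => x; rewrite big_ord0.
rewrite (_ : (fun x => _) = fun x => u ord0 x + \sum_(i < n) u (lift ord0 i) x).
  rewrite (@partialD k)//; last by apply: Ck_sum.
  by rewrite IH//; apply/funext => x; rewrite big_ord_recl.
by apply/funext => x; rewrite big_ord_recl.
Qed.

Lemma continuous_coord i : continuous (fun x : 'rV[R]_4 => x ord0 i).
Proof. exact: coord_continuous. Qed.

Lemma is_partial_coord l i x :
  is_derive x (e_ l) (fun x : 'rV[R]_4 => x ord0 i) (i == l)%:R.
Proof.
have E : (fun h : R => h^-1 *: (((fun x : 'rV[R]_4 => x ord0 i) \o shift x) (h *: e_ l)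
    - x ord0 i)) @ 0^' --> ((i == l)%:R : R).
  apply: cvg_near_cst; near=> h.
  rewrite /= /shift !mxE eqxx /= addrK /GRing.scale /= mulrA mulVf ?mul1r//.
  near: h; exact: nbhs_dnbhs_neq.
split; first by apply/cvg_ex; exists ((i == l)%:R).
by apply/cvg_lim.
Unshelve. all: by end_near. Qed.

Lemma Ck_coord k i : Ck k (fun x : 'rV[R]_4 => x ord0 i).
Proof.
case: k => [|k]; first exact: continuous_coord.
apply: (@Ck_intro _ _ (fun l _ => (i == l)%:R)).
- exact: continuous_coord.
- by move=> l x; exact: is_partial_coord.
- by move=> l; exact: Ck_cst.
Qed.

Lemma partial_coord l i : partial l (fun x : 'rV[R]_4 => x ord0 i) = fun=> (i == l)%:R.
Proof. by apply: partialE => x; exact: is_partial_coord. Qed.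

Lemma Ck_sqnorm k : Ck k (@sqnorm R).
Proof. by apply: Ck_sum => i; apply: CkM; exact: Ck_coord. Qed.

Lemma partial_sqnorm i : partial i (@sqnorm R) = fun x => 2 * x ord0 i.
Proof.
rewrite /sqnorm (@partial_sum 0 4 (fun l x => x ord0 l ^+ 2)); last first.
  by move=> l; apply: CkM; exact: Ck_coord.
apply/funext => x; rewrite (bigD1 i)//= big1 ?addr0; last first.
  move=> l li; rewrite (@partialM 0 _ _ i (Ck_coord 1 l) (Ck_coord 1 l)) partial_coord.
  by rewrite (negbTE li) mul0r mulr0 addr0.
rewrite (@partialM 0 _ _ i (Ck_coord 1 i) (Ck_coord 1 i)) partial_coord eqxx.
by rewrite mul1r mulr1 mulr_natl mulr2n.
Qed.

Fixpoint Ck1 (k : nat) (g : R -> R) : Prop :=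
  match k with
  | 0%N => continuous g
  | S k' => continuous g /\ (forall t, derivable g t 1) /\ Ck1 k' (derive1 g)
  end.

Lemma Ck1W k g : Ck1 k.+1 g -> Ck1 k g.
Proof.
elim: k g => [|k IH] g; first by move=> [].
by move=> [cg [dg Cg]]; split=> //; split=> //; exact: IH.
Qed.

Lemma Ck1_continuous k g : Ck1 k g -> continuous g.
Proof. by case: k => [//|k] []. Qed.

(** [u] is only assumed derivable in the direction [e_ i], not differentiable, so the one-variable
    chain rule is applied to its restriction to the line through [x]. *)
Lemma is_derive_comp1 (g : R -> R) u i x dg du :
  is_derive (u x) 1 g dg -> is_derive x (e_ i) u du ->
  is_derive x (e_ i) (g \o u) (dg * du).
Proof.
move=> Hg Hu.
have Hu' : is_derive (0 : R) 1 (fun s : R => u (x + s *: e_ i)) du.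
  by apply: is_derive_line; rewrite scale0r addr0.
have Hc : is_derive (0 : R) 1 (g \o (fun s : R => u (x + s *: e_ i))) (dg * du).
  by apply: is_derive1_comp => //; rewrite scale0r addr0.
case: Hc => c1 c2.
have E : (fun h : R => h^-1 *: (((g \o u) \o shift x) (h *: e_ i) - (g \o u) x)) =
  (fun h : R => h^-1 *: (((g \o (fun s : R => u (x + s *: e_ i))) \o shift (0 : R)) (h *: 1) - (g \o (fun s : R => u (x + s *: e_ i))) 0)).
  apply/funext => h /=; rewrite /shift; congr (_ *: (g (u _) - g (u _))).
    by rewrite addr0 [h *: 1]mulr1 addrC.
  by rewrite scale0r addr0.
split; first by rewrite /derivable E.
by rewrite /derive E.
Qed.

Lemma is_partial_comp k g u i x : Ck1 k.+1 g -> Ck k.+1 u ->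
  is_derive x (e_ i) (g \o u) (derive1 g (u x) * partial i u x).
Proof.
move=> [_ [dg _]] Cu; apply: is_derive_comp1; last exact: is_partial Cu.
by rewrite derive1E; split => //; exact: dg.
Qed.

Lemma partial_comp k g u i : Ck1 k.+1 g -> Ck k.+1 u ->
  partial i (g \o u) = fun x => derive1 g (u x) * partial i u x.
Proof. by move=> Cg Cu; apply: partialE => x; exact: is_partial_comp Cg Cu. Qed.

Lemma Ck_comp k g u : Ck1 k g -> Ck k u -> Ck k (g \o u).
Proof.
elim: k g u => [|k IH] g u Cg Cu.
  by move=> x; apply: continuous_comp; [exact: (Cu : continuous u)|exact: (Cg : continuous g)].
apply: (@Ck_intro _ _ (fun i x => derive1 g (u x) * partial i u x)).
- by move=> x; apply: continuous_comp;
    [exact: (Ck_continuous Cu)|exact: (Ck1_continuous Cg)].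
- by move=> i x; exact: is_partial_comp Cg Cu.
- move=> i; apply: CkM; last exact: Ck_partial.
  by case: Cg => _ [_ Cg]; apply: (IH _ u) => //; exact: CkW.
Qed.

Lemma Ck_translate k u (a : 'rV[R]_4) : Ck k u ->
  Ck k (fun x => u (x + a)) /\
  (forall i, (0 < k)%N -> partial i (fun x => u (x + a)) = fun x => partial i u (x + a)).
Proof.
have H (w : 'rV[R]_4 -> R) i x d : is_derive (x + a) (e_ i) w d -> is_derive x (e_ i) (fun x => w (x + a)) d.
  move=> [dw dE].
  have E : (fun h : R => h^-1 *: (((fun x => w (x + a)) \o shift x) (h *: e_ i) - w (x + a))) =
   (fun h : R => h^-1 *: ((w \o shift (x + a)) (h *: e_ i) - w (x + a))).
    by apply/funext => h /=; rewrite /shift addrA.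
  by split; [rewrite /derivable E|rewrite /derive E].
have cont (w : 'rV[R]_4 -> R) : continuous w -> continuous (fun x => w (x + a)).
  move=> cw x; apply: (@continuous_comp _ _ _ (fun x : 'rV[R]_4 => x + a) w); last exact: cw.
  by apply: (@continuousD _ _ _ id (fun=> a)) => //; exact: cst_continuous.
have P (w : 'rV[R]_4 -> R) i : Ck 1 w -> partial i (fun x => w (x + a)) = fun x => partial i w (x + a).
  by move=> Cw; apply: partialE => x; apply: H; exact: is_partial Cw.
elim: k u => [|k IH] u Cu; first by split => //; exact: cont.
split; last first.
  by move=> i _; apply: P; apply: Ck_le Cu.
apply: (@Ck_intro k (fun x : 'rV[R]_4 => u (x + a)) (fun i (x : 'rV[R]_4) => partial i u (x + a))).
- by apply: cont; exact: Ck_continuous Cu.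
- by move=> i x; apply: H; exact: is_partial Cu.
- by move=> i; have [] := IH (partial i u) (Ck_partial i Cu).
Qed.

End Ck_theory.

(** * Symmetry of second derivatives *)

Section Schwarz.
Variable R : realType.
Implicit Types (u : 'rV[R]_4 -> R) (x : 'rV[R]_4) (i j : 'I_4).
Local Notation e_ i := (delta_mx ord0 i : 'rV[R]_4).

Lemma MVT_line u i x (h : R) : 0 < h -> Ck 1 u ->
  exists2 s, 0 < s < h & u (x + h *: e_ i) - u x = partial i u (x + s *: e_ i) * h.
Proof.
move=> h0 Cu.
pose g (s : R) := u (x + s *: e_ i).
have dg (s : R) : is_derive s 1 g (partial i u (x + s *: e_ i)).
  by apply: is_derive_line; exact: is_partial Cu.
have cg : {within `[0, h], continuous g}.
  apply: continuous_subspaceT => s.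
  apply: differentiable_continuous; apply/derivable1_diffP.
  by case: (dg s).
have [s] := MVT h0 (fun s _ => dg s) cg.
rewrite in_itv/= => s0h; rewrite /g scale0r addr0 subr0 => E.
by exists s.
Qed.

Lemma second_difference u i j x (h : R) : 0 < h -> Ck 2 u ->
  exists s t, [/\ 0 < s < h, 0 < t < h &
    u (x + h *: e_ i + h *: e_ j) - u (x + h *: e_ i) - (u (x + h *: e_ j) - u x) =
    partial j (partial i u) (x + s *: e_ i + t *: e_ j) * h * h].
Proof.
move=> h0 Cu.
(* The mean value theorem is applied to the increment in direction [j], seen as a function along
   [i], and then to [partial i u] along [j]. *)
pose w (y : 'rV[R]_4) := u (y + h *: e_ j) - u y.
have [Ct Pt] := Ck_translate (h *: e_ j) Cu.
have Cw : Ck 2 w := CkD Ct (CkN Cu).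
have [s s0 E] := MVT_line i x h0 (CkW Cw).
have Ew y : partial i w y = partial i u (y + h *: e_ j) - partial i u y.
  rewrite /w (@partialD _ 1 _ (fun x => - u x) i Ct (CkN Cu)).
  rewrite Pt// (_ : (fun x => - u x) = (fun x => -1 * u x)); last first.
    by apply/funext => z; rewrite mulN1r.
  by rewrite (@partialZ _ 1)// mulN1r.
have [t t0 E2] := MVT_line j (x + s *: e_ i) h0 (Ck_partial i Cu).
exists s, t; split => //.
by move: E; rewrite /w Ew E2 => <-.
Qed.

Lemma ler_dist_halves (a b c e : R) :
  `|a - c| < e / 2 -> `|b - c| < e / 2 -> `|a - b| <= e.
Proof.
move=> ac bc; rewrite [leRHS]splitr (le_trans (ler_distD c _ _))//.
by rewrite lerD ?ltW// distrC.
Qed.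

(** The second difference is symmetric in [i] and [j], so the two mixed derivatives agree at two
    points as close to [x] as desired; continuity of both at [x] concludes. *)
Lemma partialC u i j : Ck 2 u -> partial i (partial j u) = partial j (partial i u).
Proof.
move=> Cu; apply/funext => x; apply/eqP; rewrite -subr_eq0 -normr_le0.
apply/ler_addgt0Pl => e e0; rewrite addr0.
have c1 : continuous (partial j (partial i u)) := Ck_partial j (Ck_partial i Cu).
have c2 : continuous (partial i (partial j u)) := Ck_partial i (Ck_partial j Cu).
have e20 : 0 < e / 2 by rewrite divr_gt0.
move: (c1 x) => /cvgrPdist_lt/(_ _ e20)/nbhs_ballP[d1 /= d10 H1].
move: (c2 x) => /cvgrPdist_lt/(_ _ e20)/nbhs_ballP[d2 /= d20 H2].
(* Both displacements are shorter than [h], so that their sum stays within the smaller of the two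
   radii. *)
pose h := Num.min d1 d2 / 2.
have hm : h + h = Num.min d1 d2 by rewrite /h -splitr.
have m0 : 0 < Num.min d1 d2 by rewrite lt_min d10.
have h0 : 0 < h by rewrite divr_gt0.
have b01 (c : bool) : (c%:R : R) <= 1 by case: c; rewrite ?ler01.
have close k l (s t : R) d : Num.min d1 d2 <= d -> 0 < s < h -> 0 < t < h ->
    ball x d (x + s *: e_ k + t *: e_ l).
  move=> md /andP[s0 sh] /andP[t0 th]; split; first exact: lt_le_trans md.
  move=> a b; rewrite /ball /= !mxE.
  rewrite -addrA opprD addNKr normrN.
  rewrite (le_lt_trans (ler_normD _ _))//.
  apply: lt_le_trans md; rewrite -hm.
  rewrite !normrM (gtr0_norm s0) (gtr0_norm t0) ltr_leD//.
    by apply: le_lt_trans sh; rewrite (ler_piMr (ltW s0))// normr_nat b01.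
  by apply: le_trans (ltW th); rewrite (ler_piMr (ltW t0))// normr_nat b01.
have [s [t [s0 t0 E]]] := second_difference i j x h0 Cu.
have [s' [t' [s'0 t'0 E']]] := second_difference j i x h0 Cu.
have EE : partial j (partial i u) (x + s *: e_ i + t *: e_ j) =
          partial i (partial j u) (x + s' *: e_ j + t' *: e_ i).
  apply: (mulIf (lt0r_neq0 h0)); apply: (mulIf (lt0r_neq0 h0)).
  apply: (etrans (esym E)); apply: etrans E'.
  rewrite (addrAC x (h *: e_ j)).
  move: (u _) (u _) (u _) (u _) => p q r s''; ring.
have m1 : Num.min d1 d2 <= d1 by rewrite ge_min lexx.
have m2 : Num.min d1 d2 <= d2 by rewrite ge_min lexx orbT.
have := H1 _ (close i j _ _ _ m1 s0 t0).
have := H2 _ (close j i _ _ _ m2 s'0 t'0).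
by rewrite /= -EE => h2 h1; exact: ler_dist_halves h2 h1.
Qed.

End Schwarz.

(** * Integration against the hyperbolic volume *)

Section hyp_vol_integral.
Variable R : realType.
Local Notation lam := (@lebesgue_rV4 R).
Local Open Scope ereal_scope.

Lemma conf4_ge0 (x : 'rV[R]_4) : (0 <= conf x ^+ 4)%R.
Proof. by rewrite exprn_even_ge0. Qed.

Lemma measurable_conf4 : measurable_fun (@B4 R) (fun x => (conf x ^+ 4)%:E).
Proof. by apply/measurable_EFinP; apply: measurable_funX; exact: measurable_conf. Qed.

Import HBNNSimple.

(** [hyp_vol] is given on sets only; monotone convergence along simple functions turns it into the
    density [conf x ^+ 4] under the integral sign. *)
Lemma ge0_integral_hyp_vol (f : 'rV[R]_4 -> \bar R) :
  measurable_fun setT f -> (forall x, 0 <= f x) ->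
  \int[@hyp_vol R]_x f x = \int[lam]_(x in @B4 R) (f x * (conf x ^+ 4)%:E).
Proof.
move=> mf f0; have mB := @measurable_B4 R.
pose g (x : 'rV[R]_4) := (conf x ^+ 4)%:E.
have mg : measurable_fun (@B4 R) g := measurable_conf4.
have g0 x : 0 <= g x by rewrite lee_fin conf4_ge0.
pose h := nnsfun_approx measurableT mf.
have -> : \int[@hyp_vol R]_x f x = lim (\int[@hyp_vol R]_x (EFin \o h n) x @[n --> \oo]).
  have fE x : setT x -> f x = lim ((EFin \o h n) x @[n --> \oo]).
    by move=> Ex; apply/esym/cvg_lim => //; exact: cvg_nnsfun_approx.
  under eq_integral => x /[!inE] /fE -> //.
  apply: monotone_convergence => //.
  - by move=> n; apply/measurable_EFinP.
  - by move=> n x Ex //=; rewrite lee_fin.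
  - by move=> x Ex a b ab; rewrite lee_fin; exact/lefP/nd_nnsfun_approx.
have -> : \int[lam]_(x in @B4 R) (f x * (conf x ^+ 4)%:E) =
    lim (\int[lam]_(x in @B4 R) ((EFin \o h n) \* g) x @[n --> \oo]).
  have fg x : @B4 R x -> f x * g x = lim (((EFin \o h n) \* g) x @[n --> \oo]).
    by move=> Ex; apply/esym/cvg_lim => //; apply: cvgeZr => //; exact: cvg_nnsfun_approx.
  under eq_integral => x /[!inE] /fg -> //.
  apply: monotone_convergence => //.
  - move=> n; apply/emeasurable_funM => //; apply/measurable_funTS.
    exact/measurable_EFinP.
  - by move=> n x Ex; apply: mule_ge0 => //; rewrite lee_fin.
  - move=> x Ex a b ab; apply: lee_wpmul2r => //.
    by rewrite lee_fin; exact/lefP/nd_nnsfun_approx.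
suff suf n : \int[lam]_(x in @B4 R) ((EFin \o h n) x * g x) =
    \int[@hyp_vol R]_x (EFin \o h n) x.
  by under [in RHS]eq_fun do rewrite suf.
transitivity (\int[@hyp_vol R]_x
   (\sum_(y \in range (h n)) (y * \1_(h n @^-1` [set y]) x)%:E)); last first.
  by apply: eq_integral => t tE; rewrite /= fimfunE -fsumEFin.
have indich m r : measurable_fun setT (fun x => (r * \1_(h m @^-1` [set r]) x)%:E).
  by apply: (measurable_comp measurableT) => //; exact: measurable_funM.
rewrite ge0_integral_fsum//; last by move=> m y Ey; exact: nnfun_muleindic_ge0.
transitivity (\int[lam]_(x in @B4 R) (\sum_(y \in range (h n))
    (y * \1_(h n @^-1` [set y]) x)%:E * g x)).
  under [RHS]eq_integral => x xE.
    rewrite -ge0_mule_fsuml => [|y]; last exact: nnfun_muleindic_ge0.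
    rewrite fsumEFin // -(fimfunE _ x); over.
  by [].
rewrite ge0_integral_fsum//; last 2 first.
  - by move=> y; apply: emeasurable_funM => //; exact: measurable_funTS.
  - by move=> m y Ey; apply: mule_ge0 => //; exact: nnfun_muleindic_ge0.
apply: eq_fsbigr => r rhn.
under [RHS]eq_integral do rewrite EFinM.
rewrite integralZl_indic_nnsfun => //.
under eq_integral do rewrite EFinM -muleA.
rewrite ge0_integralZl//.
- under eq_integral do rewrite muleC.
  rewrite (eq_integral (g \_ (h n @^-1` [set r]))); last first.
    by move=> x xE; rewrite epatch_indic.
  by rewrite integral_indic// setIT -integral_mkcondr /hyp_vol setIC.
- apply: emeasurable_funM => //; first exact/measurable_EFinP.
- by move=> t Et; apply: mule_ge0 => //; rewrite lee_fin.
- by move: rhn; rewrite inE => -[t _ <-]; rewrite lee_fin.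
Qed.

Lemma integral_hyp_vol (f : 'rV[R]_4 -> R) : measurable_fun setT f ->
  (\int[@hyp_vol R]_x (f x)%:E) = \int[lam]_(x in @B4 R) (f x * conf x ^+ 4)%:E.
Proof.
move=> mf; rewrite [LHS]integralE [RHS]integralE.
have mEf : measurable_fun setT (EFin \o f) by exact/measurable_EFinP.
rewrite ge0_integral_hyp_vol//; last exact: measurable_funepos.
rewrite ge0_integral_hyp_vol//; last exact: measurable_funeneg.
congr (_ - _); apply: eq_integral => x _.
- by rewrite !funeposE maxe_pMl ?lee_fin ?conf4_ge0// mul0e -EFinM.
- by rewrite !funenegE maxe_pMl ?lee_fin ?conf4_ge0// mul0e -EFinN -EFinM mulNr.
Qed.

End hyp_vol_integral.

(** * Bounded supports and integrals of derivatives *)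

Section compact_support.
Variable R : realType.
Implicit Types (f g u : 'rV[R]_4 -> R) (x : 'rV[R]_4).
Local Notation lam := (@lebesgue_rV4 R).
Local Notation e_ i := (delta_mx ord0 i : 'rV[R]_4).

(** Vanishing outside a cube, instead of compactness of a closure: this form passes to sums,
    products, translates and derivatives without topology. *)
Definition bounded_support f := exists2 M : R, 0 < M &
  forall x, (exists i : 'I_4, M < `|x ord0 i|) -> f x = 0.

Definition cube (M : R) : set 'rV[R]_4 :=
  [set x | forall i : 'I_4, x ord0 i \in `[- M, M]].

Lemma notin_cube M x : ~ cube M x -> exists i : 'I_4, M < `|x ord0 i|.
Proof.
move=> nc; apply: contrapT => H; apply: nc => i.
rewrite in_itv/= -ler_norml leNgt; apply/negP => h; apply: H; by exists i.
Qed.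

Lemma measurable_cube M : measurable (cube M).
Proof.
rewrite (_ : cube M = \bigcap_(i in [set: 'I_4])
  (@rV_coord R 4 i @^-1` `[- M, M]%classic)).
  apply: fin_bigcap_measurable => // i _.
  by rewrite -[X in measurable X]setTI; apply: measurable_rV_coord.
by apply/seteqP; split => x /=; [move=> H i _; exact: H|move=> H i; exact: H].
Qed.

Lemma cube_fin M : (lam (cube M) < +oo)%E.
Proof.
have [n Mn] : exists n : nat, M <= n%:R.
  by exists (Num.truncn M).+1; rewrite ltW// truncnS_gt.
apply: le_lt_trans (lebesgue_cube_fin R n).
apply: le_measure; rewrite ?inE; [exact: measurable_cube|exact: measurable_cube|].
move=> x xM i; move: (xM i); rewrite !in_itv/= -!ler_norml => /le_trans; exact.
Qed.

Lemma compact_cube M : compact (cube M).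
Proof.
have := @rV_compact R 4 (fun=> `[- M, M]%classic) (fun=> @segment_compact R _ _).
by congr compact; apply/seteqP; split => x /= H i; move: (H i).
Qed.

Lemma bounded_support_bounded f : continuous f -> bounded_support f ->
  exists2 C : R, 0 <= C & forall x, `|f x| <= C.
Proof.
move=> cf [M M0 fM].
have : compact (f @` cube M).
  by apply: continuous_compact; [exact: continuous_subspaceT|exact: compact_cube].
move=> /compact_bounded[N [_ /(_ (`|N| + 1))]].
have N1 : N < `|N| + 1 by rewrite ltr_pwDr// ler_norm.
move=> /(_ N1) H; exists (`|N| + 1); first by rewrite addr_ge0.
move=> x; have [xM|/notin_cube/fM ->] := pselect (cube M x).
  by apply: H; exists x.
by rewrite normr0 addr_ge0.
Qed.

Lemma integrable_bounded_support f : continuous f -> bounded_support f ->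
  lam.-integrable setT (EFin \o f).
Proof.
move=> cf sf; have [C C0 fC] := bounded_support_bounded cf sf.
have [M M0 fM] := sf.
have mf : measurable_fun setT (EFin \o f).
  by apply/measurable_EFinP; exact: continuous_measurable_rV4.
have E : EFin \o f = ((EFin \o f) \_ (cube M)).
  apply/funext => x; rewrite /patch; case: ifPn => //.
  by rewrite notin_setE => /notin_cube/fM /= ->.
rewrite E; apply/(integrable_mkcond _ (measurable_cube M)).
apply/integrableP; split; first exact: measurable_funTS.
apply: (@le_lt_trans _ _ (\int[lam]_(x in cube M) (C%:E))%E).
  apply: ge0_le_integral => //.
  - exact: measurable_cube.
  - by apply: measurableT_comp => //; exact: measurable_funTS.
  - by move=> x _; rewrite lee_fin fC.
rewrite integral_cst; last exact: measurable_cube.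
by rewrite lte_mul_pinfty// ?lee_fin// cube_fin.
Qed.

Lemma Rintegral_preserves t f : preserves lam t -> measurable_fun setT f ->
  \int[lam]_x f (t x) = \int[lam]_x f x.
Proof.
move=> pt mf; rewrite /Rintegral; congr fine.
by rewrite (preserves_integral (f := EFin \o f) pt)//; exact/measurable_EFinP.
Qed.

Lemma Rintegral_translate f a : measurable_fun setT f ->
  \int[lam]_x f (x + a) = \int[lam]_x f x.
Proof. exact: (Rintegral_preserves (preserves_translate a)). Qed.

Lemma bounded_support_sub f g : (forall x, f x = 0 -> g x = 0) ->
  bounded_support f -> bounded_support g.
Proof. by move=> fg [M M0 fM]; exists M => // x /fM/fg. Qed.

Lemma bounded_supportMl f g : bounded_support f -> bounded_support (fun x => f x * g x).
Proof. by apply: bounded_support_sub => x ->; rewrite mul0r. Qed.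

Lemma bounded_supportD f g : bounded_support f -> bounded_support g ->
  bounded_support (fun x => f x + g x).
Proof.
move=> [M M0 fM] [N N0 gN]; exists (Num.max M N); first by rewrite lt_max M0.
by move=> x [i]; rewrite gt_max => /andP[Mi Ni]; rewrite fM ?gN ?addr0//; exists i.
Qed.

Lemma bounded_support_sum n (f : 'I_n -> 'rV[R]_4 -> R) :
  (forall l, bounded_support (f l)) -> bounded_support (fun x => \sum_(l < n) f l x).
Proof.
elim: n f => [|n IH] f H.
  by exists 1 => // x _; rewrite big_ord0.
rewrite (_ : (fun x => _) = fun x => f ord0 x + \sum_(l < n) f (lift ord0 l) x).
  by apply: bounded_supportD => //; exact: IH.
by apply/funext => x; rewrite big_ord_recl.
Qed.

Lemma bounded_support_translate f a : bounded_support f ->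
  bounded_support (fun x => f (x + a)).
Proof.
move=> [M M0 fM]; pose A := \sum_(i < 4) `|a ord0 i|.
have A0 : 0 <= A by apply: sumr_ge0.
exists (M + A); first by rewrite ltr_wpDr.
move=> x [i xi]; apply: fM; exists i; rewrite mxE.
have aA : `|a ord0 i| <= A by rewrite /A (bigD1 i)//= lerDl sumr_ge0.
rewrite -(ltrD2r A); apply: (lt_le_trans xi).
rewrite -{1}[x ord0 i](addrK (a ord0 i)) (le_trans (ler_normB _ _))//.
by rewrite lerD2l.
Qed.

Lemma bounded_support_partial i f : bounded_support f -> bounded_support (partial i f).
Proof.
move=> [M M0 fM]; exists M => // x [j Mj]; rewrite /partial.
have H : {near x, f =1 fun=> 0}.
  have cj : {for x, continuous (fun y : 'rV[R]_4 => `|y ord0 j|)}.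
    apply: (@continuous_comp _ _ _ (fun y : 'rV[R]_4 => y ord0 j) Num.norm).
      exact: coord_continuous.
    exact: norm_continuous.
  have : \forall y \near (x : 'rV[R]_4), M < `|(y : 'rV[R]_4) ord0 j|.
    exact: (cvgr_gt _ cj).
  by apply: filterS => y My; apply: fM; exists j.
rewrite (near_eq_derive _ H).
by rewrite derive_cst.
Qed.

(** The integral of [f (x + t e_i)] does not depend on [t]; differentiating it under the integral
    sign at [t = 0] gives the claim. *)
Lemma Rintegral_partial i f : Ck 1 f -> bounded_support f ->
  \int[lam]_x partial i f x = 0.
Proof.
move=> Cf sf.
have cf := Ck_continuous Cf.
have cdf : continuous (partial i f) := Ck_partial i Cf.
have sdf := bounded_support_partial i sf.
have [C C0 dfC] := bounded_support_bounded cdf sdf.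
have [M M0 dfM] := sdf.
pose F (t : R) (x : 'rV[R]_4) := f (x + t *: e_ i).
have dF (t : R) x : is_derive t 1 (F ^~ x) (partial i f (x + t *: e_ i)).
  by apply: is_derive_line; exact: is_partial Cf.
have cst_int t : \int[lam]_x F t x = \int[lam]_x f x.
  by apply: Rintegral_translate; exact: continuous_measurable_rV4.
(* The domination must hold for all [|t| < 1], whence the cube enlarged by 1. *)
pose G (x : 'rV[R]_4) := C * \1_(cube (M + 1)) x.
have := @differentiation_under_integral R _ _ lam F setT measurableT 0 (-1) 1 _ _ _ G.
have I0 : `]-1, 1[%classic (0 : R) by rewrite /= in_itv/= ltrN10 ltr01.
move=> /(_ I0).
have i1 (x : R) : `]-1, 1[%classic x -> lam.-integrable setT (EFin \o F x).
  move=> _; apply: integrable_bounded_support; last exact: bounded_support_translate.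
  by have [] := Ck_translate (x *: e_ i) (Cf : Ck 1 f) => /Ck_continuous.
move=> /(_ i1).
have i2 (x : R) (y : 'rV[R]_4) : `]-1, 1[%classic x -> setT y -> derivable (F^~ y) x 1.
  by move=> _ _; case: (dF x y).
move=> /(_ i2).
have i3 (y : 'rV[R]_4) : 0 <= G y by rewrite mulr_ge0.
move=> /(_ i3).
have i4 : lam.-integrable setT (EFin \o G).
  rewrite (_ : EFin \o G = (fun=> C%:E) \_ (cube (M + 1))); last first.
    apply/funext => x; rewrite /G /= /patch indicE; case: ifP => xc; rewrite ?mulr1 ?mulr0//.
  apply/(integrable_mkcond _ (measurable_cube _)).
  apply/integrableP; split; first exact: measurable_cst.
  rewrite integral_cst; last exact: measurable_cube.
  by rewrite lte_mul_pinfty//= ?lee_fin// ?cube_fin.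
move=> /(_ i4).
have i5 (x : R) (y : 'rV[R]_4) : `]-1, 1[%classic x -> setT y -> `|partial1of2 F x y| <= G y.
  move=> + _; rewrite /= in_itv/= => /andP[x1 x2].
  rewrite partial1of2E (@derive_val _ _ _ _ _ _ _ (dF x y)) /G indicE.
  have [_|] := boolP (y \in cube (M + 1)); first by rewrite mulr1.
  rewrite notin_setE => /notin_cube[j Mj]; rewrite mulr0 dfM ?normr0//.
  exists j; rewrite !mxE eqxx /=.
  have xb : `|x * (j == i)%:R| <= 1.
    by case: eqP => _; rewrite ?mulr1 ?mulr0 ?normr0// ler_norml !ltW.
  rewrite -(ltrD2r 1); apply: (lt_le_trans Mj).
  rewrite -{1}[y ord0 j](addrK (x * (j == i)%:R)) (le_trans (ler_normB _ _))//.
  by rewrite lerD2l.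
move=> /(_ i5).
under eq_fun do rewrite cst_int.
rewrite derive1_cst => /esym.
under eq_Rintegral do rewrite partial1of2E (@derive_val _ _ _ _ _ _ _ (dF _ _)) scale0r addr0.
by [].
Qed.

End compact_support.

Local Opaque partial.

(** * The Paneitz energy *)

Section laplacian.
Variable R : realType.
Implicit Types (u v : 'rV[R]_4 -> R) (x : 'rV[R]_4) (i : 'I_4).
Local Notation lam := (@lebesgue_rV4 R).

Definition smooth u := forall k, Ck k u.
Definition lap u : 'rV[R]_4 -> R := fun x => \sum_(i < 4) partial i (partial i u) x.
Definition euler u : 'rV[R]_4 -> R := fun x => \sum_(i < 4) x ord0 i * partial i u x.
Definition W : 'rV[R]_4 -> R := fun x => 1 - sqnorm x.

Lemma smooth_partial u i : smooth u -> smooth (partial i u).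
Proof. by move=> su k; apply: Ck_partial; exact: su. Qed.

Lemma smoothD u v : smooth u -> smooth v -> smooth (fun x => u x + v x).
Proof. by move=> su sv k; apply: (CkD (su k) (sv k)). Qed.

Lemma smoothM u v : smooth u -> smooth v -> smooth (fun x => u x * v x).
Proof. by move=> su sv k; apply: (CkM (su k) (sv k)). Qed.

Lemma smooth_lap u : smooth u -> smooth (lap u).
Proof.
move=> su k; apply: (@Ck_sum _ k 4 (fun i => partial i (partial i u))) => i.
by do 2 apply: Ck_partial; exact: su.
Qed.

Lemma smooth_coord i : smooth (fun x => x ord0 i).
Proof. by move=> k; exact: Ck_coord. Qed.

Lemma smooth_euler u : smooth u -> smooth (euler u).
Proof.
move=> su k; apply: (@Ck_sum _ k 4 (fun i x => x ord0 i * partial i u x)) => i.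
exact: (smoothM (smooth_coord i) (smooth_partial i su)).
Qed.

Lemma smooth_W : smooth W.
Proof. by move=> k; apply: CkD; [exact: Ck_cst|apply: CkN; exact: Ck_sqnorm]. Qed.

Lemma spartialM u v i : smooth u -> smooth v ->
  partial i (fun x => u x * v x) = (fun x => partial i u x * v x + u x * partial i v x).
Proof. by move=> su sv; exact: (partialM i (su 1%N) (sv 1%N)). Qed.

Lemma spartialD u v i : smooth u -> smooth v ->
  partial i (fun x => u x + v x) = (fun x => partial i u x + partial i v x).
Proof. by move=> su sv; exact: (partialD i (su 1%N) (sv 1%N)). Qed.

Lemma partial_W i : partial i W = fun x => - 2 * x ord0 i.
Proof.
rewrite /W (partialD i (Ck_cst 1 1) (CkN (@Ck_sqnorm R 1))) partial_cst.
rewrite (_ : (fun x => - sqnorm x) = (fun x => -1 * sqnorm x)); last first.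
  by apply/funext => z; rewrite mulN1r.
rewrite (partialZ (-1) i (@Ck_sqnorm R 1)) partial_sqnorm.
by apply/funext => z; rewrite add0r mulrA mulN1r.
Qed.

Lemma lap_W x : lap W x = - 8.
Proof.
rewrite /lap (eq_bigr (fun=> - 2)); last first.
  move=> i _; rewrite partial_W (partialZ (-2) i (@Ck_coord R 1 i)) partial_coord eqxx.
  by rewrite mulr1.
by rewrite sumr_const card_ord; lra.
Qed.

Definition grad_dot u v : 'rV[R]_4 -> R := fun x => \sum_(i < 4) partial i u x * partial i v x.

Lemma lapM u v x : smooth u -> smooth v ->
  lap (fun x => u x * v x) x = lap u x * v x + 2 * grad_dot u v x + u x * lap v x.
Proof.
move=> su sv; rewrite /lap /grad_dot mulr_suml !mulr_sumr -!big_split/=.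
apply: eq_bigr => i _.
have sui := smooth_partial i su; have svi := smooth_partial i sv.
rewrite (spartialM i su sv) (spartialD i (smoothM sui sv) (smoothM su svi)).
rewrite (spartialM i sui sv) (spartialM i su svi).
move: (partial i (partial i u) x) (partial i (partial i v) x) => a b.
move: (partial i u x) (partial i v x) (u x) (v x) => c d p q; ring.
Qed.

Lemma lapD u v x : smooth u -> smooth v ->
  lap (fun x => u x + v x) x = lap u x + lap v x.
Proof.
move=> su sv; rewrite /lap -big_split/=; apply: eq_bigr => i _.
have sui := smooth_partial i su; have svi := smooth_partial i sv.
by rewrite (spartialD i su sv) (spartialD i sui svi).
Qed.

Lemma eulerM u v x : smooth u -> smooth v ->
  euler (fun x => u x * v x) x = euler u x * v x + u x * euler v x.
Proof.
move=> su sv; rewrite /euler mulr_suml mulr_sumr -big_split/=; apply: eq_bigr => i _.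
by rewrite (spartialM i su sv); ring.
Qed.

Lemma eulerD u v x : smooth u -> smooth v ->
  euler (fun x => u x + v x) x = euler u x + euler v x.
Proof.
move=> su sv; rewrite /euler -big_split/=; apply: eq_bigr => i _.
by rewrite (spartialD i su sv); ring.
Qed.

Lemma grad_dot_W u x : grad_dot W u x = - 2 * euler u x.
Proof.
rewrite /grad_dot /euler mulr_sumr; apply: eq_bigr => i _.
by rewrite partial_W mulrA.
Qed.

Lemma euler_W x : euler W x = - 2 * sqnorm x.
Proof.
rewrite /euler /sqnorm mulr_sumr; apply: eq_bigr => i _.
by rewrite partial_W; ring.
Qed.

(** The commutator of the Laplacian with [x . grad] is twice the Laplacian. The third derivatives
    are reordered by two uses of [partialC]. *)
Lemma lap_euler u x : smooth u -> lap (euler u) x = 2 * lap u x + euler (lap u) x.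
Proof.
move=> su.
have slap := smooth_lap su.
have t1 j i : partial j (fun x => x ord0 i * partial i u x) =
    fun x => (i == j)%:R * partial i u x + x ord0 i * partial j (partial i u) x.
  by rewrite (spartialM j (smooth_coord i) (smooth_partial i su)) partial_coord.
have t2 j i : partial j (partial j (fun x => x ord0 i * partial i u x)) =
    fun x => 2 * ((i == j)%:R * partial j (partial i u) x) + x ord0 i * partial j (partial j (partial i u)) x.
  have sij := smooth_partial j (smooth_partial i su).
  rewrite t1 (spartialD j (smoothM (fun k => Ck_cst k _) (smooth_partial i su)) (smoothM (smooth_coord i) sij)).
  rewrite (partialZ _ j (smooth_partial i su 1%N)) (spartialM j (smooth_coord i) sij) partial_coord.
  apply/funext => y; move: (partial j (partial j (partial i u)) y) => a.
  by move: (partial j (partial i u) y) => b; ring.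
have t3 j : partial j (partial j (euler u)) = fun x => \sum_(i < 4)
   (2 * ((i == j)%:R * partial j (partial i u) x) + x ord0 i * partial j (partial j (partial i u)) x).
  have sm i : smooth (fun x => x ord0 i * partial i u x) by
    exact: (smoothM (smooth_coord i) (smooth_partial i su)).
  rewrite /euler (@partial_sum R 1 4 (fun i x => x ord0 i * partial i u x)); last by move=> l; exact: sm.
  rewrite (@partial_sum R 1 4 (fun i => partial j (fun x => x ord0 i * partial i u x))); last first.
    by move=> l; exact: (smooth_partial j (sm l)).
  by apply/funext => y; apply: eq_bigr => i _; rewrite t2.
transitivity (\sum_(j < 4) \sum_(i < 4)
   (2 * ((i == j)%:R * partial j (partial i u) x) + x ord0 i * partial j (partial j (partial i u)) x)).
  by apply: eq_bigr => j _; exact: (congr1 (fun f => f x) (t3 j)).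
rewrite exchange_big/=.
rewrite {1}/lap mulr_sumr /euler -big_split/=; apply: eq_bigr => i _.
rewrite big_split/=; congr (_ + _).
  rewrite (bigD1 i)//= eqxx mul1r big1 ?addr0// => j ji.
  by rewrite eq_sym (negbTE ji) mul0r mulr0.
rewrite /lap (@partial_sum R 1 4 (fun j => partial j (partial j u))); last first.
  by move=> l; exact: (smooth_partial l (smooth_partial l su)).
rewrite [RHS]mulr_sumr; apply: eq_bigr => j _.
have E1 : partial j (partial i u) = partial i (partial j u) := partialC j i (su 2%N).
have E2 : partial j (partial i (partial j u)) = partial i (partial j (partial j u)) :=
  partialC j i (smooth_partial j su 2%N).
exact: (congr1 (fun f => x ord0 i * f x) (etrans (congr1 (partial j) E1) E2)).
Qed.

Lemma hyp_laplacianE u : hyp_laplacian u =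
  fun x => (4^-1 * (W x * W x)) * lap u x + W x * euler u x.
Proof.
apply/funext => x; rewrite /hyp_laplacian -/(lap u x) -/(euler u x) /W.
by field.
Qed.

(* Conformal covariance of the Paneitz operator: its factors are powers of the
   conformal factor, since dim = order = 4. *)
Lemma P2E u x : smooth u -> P2 u x = (W x / 2) ^+ 4 * lap (lap u) x.
Proof.
move=> su.
(* [P1 + 2] is minus the hyperbolic Laplacian, so [P2] is the square of the latter plus twice the
   latter. *)
have -> : P2 u x = hyp_laplacian (hyp_laplacian u) x + 2 * hyp_laplacian u x.
  rewrite /P2.
  rewrite (_ : (fun x => P1 u x + 2 * u x) = (fun x => -1 * hyp_laplacian u x)); last first.
    by apply/funext => y; rewrite /P1; ring.
  have sh : smooth (hyp_laplacian u).
    rewrite hyp_laplacianE; apply: smoothD; apply: smoothM.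
    - by apply: smoothM; [move=> k; exact: Ck_cst|apply: smoothM; exact: smooth_W].
    - exact: smooth_lap.
    - exact: smooth_W.
    - exact: smooth_euler.
  rewrite /P1 {1}/hyp_laplacian.
  under eq_bigr do rewrite (partialZ (-1) _ (sh 1%N)) (partialZ (-1) _ (smooth_partial _ sh 1%N)).
  under [X in _ + _ * X]eq_bigr do rewrite (partialZ (-1) _ (sh 1%N)) mulrCA.
  rewrite -!mulr_sumr.
  have -> : hyp_laplacian (hyp_laplacian u) x = ((1 - sqnorm x) / 2) ^+ 2 *
     (\sum_(i < 4) partial i (partial i (hyp_laplacian u)) x)
    + 2 * ((1 - sqnorm x) / 2) * (\sum_(i < 4) x ord0 i * partial i (hyp_laplacian u) x) by [].
  move: (\sum_(i < 4) _) (\sum_(i < 4) _) (hyp_laplacian u x) (sqnorm x) => a b c d; ring.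
pose a x := 4^-1 * (W x * W x).
have sW := smooth_W.
have sWW := smoothM sW sW.
have sc : smooth (fun _ : 'rV[R]_4 => 4^-1 : R) by move=> k; exact: Ck_cst.
have sa : smooth a := smoothM sc sWW.
have sA := smooth_lap su; have sE := smooth_euler su.
have s1 := smoothM sa sA; have s2 := smoothM sW sE.
rewrite [in X in X + _]hyp_laplacianE [hyp_laplacian u x](congr1 (fun f => f x) (hyp_laplacianE u)).
rewrite (_ : hyp_laplacian u = fun x => a x * lap u x + W x * euler u x); last exact: hyp_laplacianE.
have da i : partial i a = fun x => - W x * x ord0 i.
  rewrite /a (partialZ _ i (sWW 1%N)) (spartialM i sW sW) partial_W.
  by apply/funext => y; field.
have ga v : grad_dot a v x = - W x * euler v x.
  by rewrite /grad_dot /euler mulr_sumr; apply: eq_bigr => i _; rewrite da mulrA.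
have ea : euler a x = - W x * sqnorm x.
  rewrite /euler /sqnorm mulr_sumr; apply: eq_bigr => i _.
  by rewrite da; ring.
have la : lap a x = 2 * sqnorm x - 4 * W x.
  have gz : grad_dot (fun=> 4^-1) (fun x => W x * W x) x = 0.
    by rewrite /grad_dot big1// => i _; rewrite partial_cst mul0r.
  have lz : lap (fun=> (4^-1 : R)) x = 0.
    rewrite /lap big1// => i _; rewrite partial_cst.
    by rewrite (partial_cst (0:R)).
  rewrite (lapM x sc sWW) (lapM x sW sW) grad_dot_W euler_W lap_W gz lz.
  by field.
rewrite (lapD x s1 s2) (eulerD x s1 s2).
rewrite (lapM x sa sA) (lapM x sW sE) (eulerM x sa sA) (eulerM x sW sE).
rewrite ga la ea grad_dot_W lap_W euler_W (lap_euler x su).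
rewrite -/(a x) /a.
(* With [|x|^2] eliminated, the coefficients of all terms other than [lap (lap u)] are polynomials
   in [W x], and they cancel. *)
have -> : sqnorm x = 1 - W x by rewrite /W; ring.
move: (lap (lap u) x) (euler (lap u) x) (euler (euler u) x) (lap u x) (euler u x) (W x).
by move=> *; field.
Qed.

End laplacian.

(** * Green's formula and the Hessian identity *)

Section integration_by_parts.
Variable R : realType.
Implicit Types (u v f g : 'rV[R]_4 -> R) (i : 'I_4).
Local Notation lam := (@lebesgue_rV4 R).

Lemma integrable_mul_support f g : continuous f -> continuous g -> bounded_support f ->
  lam.-integrable setT (EFin \o (fun x => f x * g x)).
Proof.
move=> cf cg sf; apply: integrable_bounded_support; last exact: bounded_supportMl.
by move=> x; apply: (@continuousM _ _ f g x); [exact: cf|exact: cg].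
Qed.

Lemma Rintegral_by_parts i f g : Ck 1 f -> Ck 1 g -> bounded_support f ->
  \int[lam]_x (partial i f x * g x) = - \int[lam]_x (f x * partial i g x).
Proof.
move=> Cf Cg sf; apply/eqP; rewrite -addr_eq0; apply/eqP.
have cf := Ck_continuous Cf; have cg := Ck_continuous Cg.
have cdf := Ck_continuous (Ck_partial i Cf); have cdg := Ck_continuous (Ck_partial i Cg).
rewrite -RintegralD//; last 2 first.
- by apply: integrable_mul_support => //; exact: bounded_support_partial.
- exact: integrable_mul_support.
have := Rintegral_partial i (CkM Cf Cg) (bounded_supportMl g sf).
by rewrite (partialM i Cf Cg).
Qed.

Lemma integrable_Rsum n (F : 'I_n -> 'rV[R]_4 -> R) :
  (forall l, lam.-integrable setT (EFin \o F l)) ->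
  lam.-integrable setT (EFin \o (fun x => \sum_(l < n) F l x)).
Proof.
elim: n F => [|n IH] F iF.
  rewrite (_ : EFin \o _ = cst 0%E); first exact: integrable0.
  by apply/funext => x /=; rewrite big_ord0.
rewrite (_ : EFin \o _ = ((EFin \o F ord0) \+
    (EFin \o fun x => (\sum_(l < n) F (lift ord0 l) x)%R))%E).
  by apply: integrableD => //; exact: IH.
by apply/funext => x /=; rewrite big_ord_recl.
Qed.

Lemma Rintegral_sum n (F : 'I_n -> 'rV[R]_4 -> R) :
  (forall l, lam.-integrable setT (EFin \o F l)) ->
  \int[lam]_x (\sum_(l < n) F l x) = \sum_(l < n) \int[lam]_x F l x.
Proof.
elim: n F => [|n IH] F iF.
  rewrite big_ord0; under eq_Rintegral do rewrite big_ord0.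
  by rewrite Rintegral_cst// mul0r.
rewrite big_ord_recl; under eq_Rintegral do rewrite big_ord_recl.
rewrite RintegralD//; first by rewrite IH.
exact: (integrable_Rsum (F := fun l => F (lift ord0 l))).
Qed.

Lemma Green u v : Ck 2 u -> Ck 2 v -> bounded_support u ->
  \int[lam]_x (lap u x * v x) = \int[lam]_x (u x * lap v x).
Proof.
move=> Cu Cv su.
have Cui i := Ck_partial i Cu; have Cvi i := Ck_partial i Cv.
have cuii i := Ck_continuous (Ck_partial i (Cui i)).
have cvii i := Ck_continuous (Ck_partial i (Cvi i)).
transitivity (\int[lam]_x (\sum_(i < 4) (partial i (partial i u) x * v x))).
  by apply: eq_Rintegral => x _; rewrite mulr_suml.
transitivity (\int[lam]_x (\sum_(i < 4) (u x * partial i (partial i v) x))); last first.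
  by apply: eq_Rintegral => x _; rewrite mulr_sumr.
rewrite Rintegral_sum; last first.
  move=> i; apply: integrable_mul_support; [exact: cuii|exact: Ck_continuous Cv|].
  by do 2 apply: bounded_support_partial.
rewrite Rintegral_sum; last first.
  by move=> i; apply: integrable_mul_support; [exact: Ck_continuous Cu|exact: cvii|].
apply: eq_bigr => i _.
rewrite (Rintegral_by_parts i (Cui i) (CkW Cv)); last exact: bounded_support_partial.
by rewrite (Rintegral_by_parts i (CkW Cu) (Cvi i) su) opprK.
Qed.

(** Two integrations by parts and the symmetry of derivatives turn each product [u_ii u_jj] into
    [u_ij ^+ 2]. The energy thus controls the whole Hessian, which both the Hardy inequalities and
    the oscillation estimate require. *)
Lemma Rintegral_lap_sqr u : smooth u -> bounded_support u ->
  \int[lam]_x (lap u x ^+ 2) =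
  \sum_(i < 4) \sum_(j < 4) \int[lam]_x (partial j (partial i u) x ^+ 2).
Proof.
move=> su bu.
have c3 i j : continuous (partial i (partial j u)).
  exact: (Ck_continuous (smooth_partial i (smooth_partial j su) 0%N)).
have b3 i j : bounded_support (partial i (partial j u)).
  by do 2 apply: bounded_support_partial.
transitivity (\int[lam]_x (\sum_(i < 4) \sum_(j < 4)
    (partial i (partial i u) x * partial j (partial j u) x))).
  apply: eq_Rintegral => x _; rewrite expr2 /lap mulr_suml.
  by apply: eq_bigr => i _; rewrite mulr_sumr.
have cont i j : continuous (fun x => partial i (partial i u) x * partial j (partial j u) x).
  by move=> x; apply: (@continuousM _ _ (partial i (partial i u)) (partial j (partial j u)) x); exact: c3.
rewrite Rintegral_sum; last first.
  move=> i; apply: integrable_bounded_support; last first.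
    by apply: bounded_support_sum => j; exact: bounded_supportMl.
  apply: (@Ck_continuous R 0); apply: (@Ck_sum R 0) => j; exact: cont.
apply: eq_bigr => i _; rewrite Rintegral_sum; last first.
  by move=> j; exact: integrable_mul_support.
apply: eq_bigr => j _.
have sii := smooth_partial i (smooth_partial i su).
have E1 : partial i (partial j (partial j u)) = partial j (partial i (partial j u)).
  exact: (partialC i j (smooth_partial j su 2%N)).
have E2 : partial i (partial j u) = partial j (partial i u).
  exact: (partialC i j (su 2%N)).
apply: (etrans (Rintegral_by_parts i (smooth_partial i su 1%N)
  (smooth_partial j (smooth_partial j su) 1%N) (bounded_support_partial i bu))).
have := Rintegral_by_parts j (smooth_partial i su 1%N)
  (smooth_partial j (smooth_partial i su) 1%N) (bounded_support_partial i bu).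
move=> H; apply: etrans (_ : _ = \int[lam]_x (partial j (partial i u) x * partial j (partial i u) x)) _.
  apply: etrans (esym H).
  exact: (congr1 (fun f => - \int[lam]_x (partial i u x * f x)) (etrans E1 (congr1 (partial j) E2))).
by apply: eq_Rintegral => x _; rewrite expr2.
Qed.

End integration_by_parts.

(** * Energy as an integral and Hardy inequalities *)

Section energy.
Variable R : realType.
Implicit Types (u v f g : 'rV[R]_4 -> R) (x : 'rV[R]_4) (i : 'I_4).
Local Notation lam := (@lebesgue_rV4 R).
Local Notation e_ i := (delta_mx ord0 i : 'rV[R]_4).

Lemma W_gt0 x : B4 x = (0 < W x).
Proof. by rewrite /B4 /= /W subr_gt0. Qed.

Lemma sqnorm_ge0 x : 0 <= sqnorm x.
Proof. by apply: sumr_ge0 => i _; exact: sqr_ge0. Qed.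

Lemma W_le1 x : W x <= 1.
Proof. by rewrite /W gerBl sqnorm_ge0. Qed.

Lemma sqr_coord_le i x : x ord0 i ^+ 2 <= sqnorm x.
Proof. by rewrite /sqnorm (bigD1 i)//= lerDl sumr_ge0// => j _; exact: sqr_ge0. Qed.

Lemma Cinf_c_smooth u : Cinf_c u -> smooth u.
Proof. by case. Qed.

(** [u] vanishes near every point off the ball, the sphere included. This is what lets the products
    of [u] with powers of [1 / W], singular on the sphere, be treated as regular functions on
    R^4. *)
Lemma Cinf_c_near0 u x : Cinf_c u -> ~ B4 x -> {near x, u =1 fun=> 0}.
Proof.
move=> [_ _ sB] nBx.
have nc : (~` closure [set x | u x != 0]) x by move=> /sB.
have oc : open (~` closure [set x | u x != 0]) by apply: closed_openC; exact: closed_closure.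
have : nbhs x (~` closure [set x | u x != 0]) by exact: open_nbhs_nbhs.
apply: filterS => y ny; apply/eqP; apply: contraPT ny => uy; rewrite notK.
exact: subset_closure.
Qed.

Lemma Cinf_c_out u x : Cinf_c u -> ~ B4 x -> u x = 0.
Proof. by move=> cu nBx; have /nbhs_singleton := Cinf_c_near0 cu nBx. Qed.

Lemma Cinf_c_bounded_support u : Cinf_c u -> bounded_support u.
Proof.
move=> cu; exists 1 => // x [i xi]; apply: (Cinf_c_out cu) => Bx.
have x1 : x ord0 i ^+ 2 < 1 by apply: le_lt_trans Bx; exact: sqr_coord_le.
move: xi; rewrite ltNge => /negP; apply.
by rewrite -(@expr_le1 _ 2)// -normrX ger0_norm ?sqr_ge0// ltW.
Qed.

Lemma Cinf_c_partial u i : Cinf_c u -> Cinf_c (partial i u).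
Proof.
move=> cu; have [su cs sB] := cu.
have sub : [set x | partial i u x != 0] `<=` closure [set x | u x != 0].
  move=> x; apply: contraPP => nx; apply/negP; rewrite negbK; apply/eqP.
  have oc : open (~` closure [set x | u x != 0]) by apply: closed_openC; exact: closed_closure.
  have H : {near x, u =1 fun=> 0}.
    have : nbhs x (~` closure [set x | u x != 0]) by exact: open_nbhs_nbhs.
    apply: filterS => y ny; apply/eqP; apply: contraPT ny => uy; rewrite notK.
    exact: subset_closure.
  have := near_eq_derive (e_ i) H; rewrite derive_cst; exact.
have sub' : closure [set x | partial i u x != 0] `<=` closure [set x | u x != 0].
  by rewrite [X in _ `<=` X](closure_id _).1; [exact: closureS|exact: closed_closure].
split.
- exact: smooth_partial.
- by apply: subclosed_compact cs sub'; exact: closed_closure.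
- by move=> x /sub' /sB.
Qed.

Lemma conf_W x : conf x = 2 / W x. Proof. by []. Qed.

Lemma Paneitz_energy u : Cinf_c u ->
  (\int[@hyp_vol R]_x (P2 u x * u x)%:E = (\int[lam]_x (lap u x ^+ 2))%:E)%E.
Proof.
move=> cu; have su := Cinf_c_smooth cu; have bu := Cinf_c_bounded_support cu.
have sl := smooth_lap su; have sll := smooth_lap sl.
have cl := Ck_continuous (sll 0%N).
rewrite integral_hyp_vol; last first.
  apply: measurable_funM; last exact: (continuous_measurable_rV4 (Ck_continuous (su 0%N))).
  rewrite (_ : P2 u = fun x => (W x / 2) ^+ 4 * lap (lap u) x); last first.
    by apply/funext => x; exact: P2E.
  apply: measurable_funM; last exact: continuous_measurable_rV4.
  apply: measurable_funX; apply: measurable_funM => //.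
  exact: (continuous_measurable_rV4 (Ck_continuous (@smooth_W R 0%N))).
transitivity (\int[lam]_x (lap (lap u) x * u x)%:E)%E.
  rewrite [RHS](_ : _ = \int[lam]_x (((fun x => (lap (lap u) x * u x)%:E) \_ (@B4 R)) x))%E.
    rewrite -integral_mkcond; apply: eq_integral => x; rewrite inE W_gt0 => Wx.
    by rewrite P2E// conf_W; congr EFin; field; rewrite gt_eqF.
  apply: eq_integral => x _; rewrite /patch; case: ifPn => //.
  by rewrite notin_setE => /(Cinf_c_out cu) ->; rewrite mulr0.
have ill := integrable_mul_support (Ck_continuous (su 0%N)) cl bu.
transitivity ((\int[lam]_x (u x * lap (lap u) x))%:E).
  rewrite /Rintegral fineK; first by apply: eq_integral => x _; rewrite mulrC.
  by apply: integrable_fin_num.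
have G := Green (su 2%N) (sl 2%N) bu.
have E : \int[lam]_x (lap u x * lap u x) = \int[lam]_x (lap u x ^+ 2).
  by apply: eq_Rintegral => x _; rewrite expr2.
exact: (congr1 EFin (etrans (esym G) E)).
Qed.


(** The squared hyperbolic [L^2] norm as a real integral over R^4: for [u] in [Cinf_c] the factor
    [u x ^+ 2] removes whatever the weight does off the ball. *)
Definition hyp_sqr u := \int[lam]_x ((2 / W x) ^+ 4 * u x ^+ 2).

Lemma continuous_mul_ball f g : continuous f ->
  (forall x, ~ B4 x -> {near x, f =1 fun=> 0}) ->
  (forall x, B4 x -> {for x, continuous g}) -> continuous (fun x => f x * g x).
Proof.
move=> cf f0 cg.
suff H (x : 'rV[R]_4) : {for x, continuous (fun x => f x * g x)} by move=> x; exact: H.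
have [Bx|nBx] := pselect (B4 x).
  by apply: (@continuousM _ _ f g x); [exact: cf|exact: cg].
have H : {near x, (fun x => f x * g x) =1 fun=> 0}.
  by apply: filterS (f0 x nBx) => y ->; rewrite mul0r.
have FF : Filter (nbhs x) by exact: nbhs_filter.
apply/(@cvgrPdist_lt R R^o _ (nbhs x) FF) => e e0.
have Hx : f x * g x = 0 := nbhs_singleton H.
apply: filterS H => y Hy; change (`|f x * g x - f y * g y| < e).
by rewrite Hx Hy subrr normr0.
Qed.

Lemma continuous_W : continuous (@W R).
Proof. exact: Ck_continuous (@smooth_W R 0%N). Qed.

Lemma continuous_W_inv k x : B4 x -> {for x, continuous (fun x => (W x ^+ k)^-1)}.
Proof.
rewrite W_gt0 => Wx.
apply: (@continuous_comp _ _ _ (fun x => W x ^+ k) (fun t : R => t^-1)).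
  apply: (@continuous_comp _ _ _ (@W R) (fun t : R => t ^+ k)); first exact: continuous_W.
  exact: exprn_continuous.
by apply: inv_continuous; rewrite expf_neq0// gt_eqF.
Qed.

Lemma Cinf_c_mul_continuous u v f : Cinf_c u -> continuous f ->
  (forall x, u x = 0 -> f x = 0) ->
  (forall x, B4 x -> {for x, continuous v}) ->
  continuous (fun x => f x * v x).
Proof.
move=> cu cf uf cv; apply: continuous_mul_ball => // x nBx.
by apply: filterS (Cinf_c_near0 cu nBx) => y /uf.
Qed.

Lemma integrable_weight u k f : Cinf_c u -> continuous f ->
  (forall x, u x = 0 -> f x = 0) ->
  lam.-integrable setT (EFin \o (fun x => f x * (W x ^+ k)^-1)).
Proof.
move=> cu cf uf; apply: integrable_bounded_support.
  by apply: (Cinf_c_mul_continuous cu) => // x; exact: continuous_W_inv.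
apply: bounded_supportMl; apply: bounded_support_sub uf _.
exact: Cinf_c_bounded_support.
Qed.

Lemma Lnorm_hyp_sqr u : Cinf_c u ->
  ('N[@hyp_vol R]_(2%:E)[EFin \o u] ^+ 2 = (hyp_sqr u)%:E)%E.
Proof.
move=> cu; have su := Cinf_c_smooth cu.
have cu0 := Ck_continuous (su 0%N).
have E : (\int[@hyp_vol R]_x `|(EFin \o u) x| `^ 2 = (hyp_sqr u)%:E)%E.
  transitivity (\int[@hyp_vol R]_x (u x ^+ 2)%:E)%E.
    apply: eq_integral => x _ /=.
    by rewrite powR_mulrn// real_normK// num_real.
  rewrite integral_hyp_vol; last by apply: measurable_funX; exact: continuous_measurable_rV4.
  have cuu : continuous (fun x => 16 * u x ^+ 2).
    exact: (Ck_continuous (CkZ 16 (CkM (su 0%N) (su 0%N)))).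
  have I1 : lam.-integrable setT (EFin \o (fun x => (2 / W x) ^+ 4 * u x ^+ 2)).
    have := integrable_weight 4 cu cuu.
    rewrite (_ : (fun x => 16 * u x ^+ 2 / W x ^+ 4) = (fun x => (2 / W x) ^+ 4 * u x ^+ 2)).
      by apply => x ->; rewrite expr0n mulr0.
    by apply/funext => x; rewrite exprMn exprVn; ring.
  rewrite /hyp_sqr /Rintegral fineK; last exact: integrable_fin_num.
  rewrite [RHS](_ : _ = \int[lam]_x (((fun x => ((2 / W x) ^+ 4 * u x ^+ 2)%:E) \_ (@B4 R)) x))%E.
    by rewrite -integral_mkcond; apply: eq_integral => x _; rewrite mulrC conf_W.
  apply: eq_integral => x _; rewrite /patch; case: ifPn => //.
  by rewrite notin_setE => /(Cinf_c_out cu) ->; rewrite expr0n mulr0.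
have h0 : 0 <= hyp_sqr u.
  by apply: Rintegral_ge0 => x _; rewrite mulr_ge0 ?sqr_ge0// exprn_even_ge0.
rewrite unlock E poweR_EFin powR12_sqrt//.
by rewrite -EFin_expe sqr_sqrtr.
Qed.

Lemma is_derive_exprn n (t : R) : is_derive t 1 (fun t : R => t ^+ n.+1) (n.+1%:R * t ^+ n).
Proof.
elim: n => [|n IH].
  by rewrite expr0 mulr1; exact: is_derive_id.
rewrite (_ : (fun t : R => t ^+ n.+2) = (fun t : R => t * t ^+ n.+1)); last first.
  by apply/funext => z; rewrite exprS.
apply: (is_derive_eq (is_deriveM (is_derive_id t (1 : R)) IH)).
by rewrite /GRing.scale/= [in RHS]exprS mulr1 -[in RHS]natr1 !exprS; ring.
Qed.

Lemma is_derive_W_inv k i x : B4 x ->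
  is_derive x (e_ i) (fun x => (W x ^+ k.+1)^-1)
    (2 * k.+1%:R * x ord0 i * (W x ^+ k.+2)^-1).
Proof.
rewrite W_gt0 => Wx.
have W0 : W x != 0 by rewrite gt_eqF.
have d1 : is_derive (W x) 1 (fun t : R => (t ^+ k.+1)^-1) (- (k.+1%:R * (W x ^+ k.+2)^-1)).
  have dX : is_derive (W x) 1 (fun t : R => t ^+ k.+1) (k.+1%:R * W x ^+ k).
    exact: is_derive_exprn.
  apply: (is_derive_eq (is_deriveV _ dX)); first by rewrite expf_neq0.
  rewrite /GRing.scale/= !exprS; field; by rewrite expf_neq0// W0.
have d2 := is_partial i x (@smooth_W R 1%N).
apply: (is_derive_eq (is_derive_comp1 d1 d2)).
by rewrite partial_W; ring.
Qed.

Lemma Ck1_mul_ball f g (dg : 'I_4 -> 'rV[R]_4 -> R) : Ck 1 f ->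
  (forall x, ~ B4 x -> {near x, f =1 fun=> 0}) ->
  (forall i x, ~ B4 x -> {near x, partial i f =1 fun=> 0}) ->
  (forall x, B4 x -> {for x, continuous g}) ->
  (forall i x, B4 x -> {for x, continuous (dg i)}) ->
  (forall i x, B4 x -> is_derive x (e_ i) g (dg i x)) ->
  Ck 1 (fun x => f x * g x) /\
  forall i, partial i (fun x => f x * g x) = fun x => partial i f x * g x + f x * dg i x.
Proof.
move=> Cf f0 df0 cg cdg dgE.
have H i x : is_derive x (e_ i) (fun x => f x * g x) (partial i f x * g x + f x * dg i x).
  have [Bx|nBx] := pselect (B4 x).
    apply: (is_derive_eq (is_deriveM (is_partial i x Cf) (dgE i x Bx))).
    by rewrite /GRing.scale/= addrC mulrC.
  have N : {near x, (fun x => f x * g x) =1 fun=> 0}.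
    by apply: filterS (f0 x nBx) => y ->; rewrite mul0r.
  rewrite (nbhs_singleton (f0 x nBx)) (nbhs_singleton (df0 i x nBx)) !mul0r addr0.
  split; last by rewrite (near_eq_derive _ N) derive_cst.
  have N' : {near x, (fun=> 0) =1 (fun x => f x * g x)} by apply: filterS N => y ->.
  by have /near_eq_derivable := N'; apply; exact: derivable_cst.
split; last by move=> i; apply: partialE => x; exact: H.
apply: (@Ck_intro R 0 _ (fun i x => partial i f x * g x + f x * dg i x)) => //.
  by apply: continuous_mul_ball => //; exact: Ck_continuous Cf.
move=> i; apply: (@CkD R 0 (fun x => partial i f x * g x) (fun x => f x * dg i x)).
  by apply: continuous_mul_ball; [exact: Ck_continuous (Ck_partial i Cf)|exact: df0|].
by apply: continuous_mul_ball; [exact: Ck_continuous Cf|exact: f0|exact: cdg].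
Qed.

(** [F] is the derivative along [e_ i] of [u^2 x_i / W^(k+1)]. It is used with [k = 2] and [k = 0],
    and added to an integrand without changing its integral. *)
Lemma Rintegral_div_weight u i k : Cinf_c u ->
  let F x := 2 * u x * partial i u x * x ord0 i * (W x ^+ k.+1)^-1 +
    u x ^+ 2 * (W x ^+ k.+1)^-1 + 2 * k.+1%:R * u x ^+ 2 * x ord0 i ^+ 2 * (W x ^+ k.+2)^-1 in
  lam.-integrable setT (EFin \o F) /\ \int[lam]_x F x = 0.
Proof.
move=> cu F; have su := Cinf_c_smooth cu.
pose f x := u x * u x.
have sf : smooth f := smoothM su su.
have dfE j : partial j f = fun x => partial j u x * u x + u x * partial j u x := spartialM j su su.
pose g x := x ord0 i * (W x ^+ k.+1)^-1.
pose dg j x := (i == j)%:R * (W x ^+ k.+1)^-1 +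
  x ord0 i * (2 * k.+1%:R * x ord0 j * (W x ^+ k.+2)^-1).
have f0 x : ~ B4 x -> {near x, f =1 fun=> 0}.
  by move=> nBx; apply: filterS (Cinf_c_near0 cu nBx) => y; rewrite /f => ->; rewrite mul0r.
have df0 j x : ~ B4 x -> {near x, partial j f =1 fun=> 0}.
  move=> nBx; rewrite dfE; apply: filterS (Cinf_c_near0 cu nBx) => y ->.
  by rewrite mul0r mulr0 addr0.
have cg x : B4 x -> {for x, continuous g}.
  move=> Bx; apply: (@continuousM _ _ (fun x : 'rV[R]_4 => x ord0 i) (fun x => (W x ^+ k.+1)^-1) x).
    exact: coord_continuous.
  exact: continuous_W_inv.
have dgE j x : B4 x -> is_derive x (e_ j) g (dg j x).
  move=> Bx; apply: (is_derive_eq (is_deriveM (is_partial_coord j i x) (is_derive_W_inv k j Bx))).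
  by rewrite /GRing.scale/= addrC [_ * (i == j)%:R]mulrC.
have cdg j x : B4 x -> {for x, continuous (dg j)}.
  move=> Bx.
  have c1 : {for x, continuous (fun x => (i == j)%:R * (W x ^+ k.+1)^-1)}.
    apply: (@continuousM _ _ (fun=> (i == j)%:R) (fun x => (W x ^+ k.+1)^-1) x).
      exact: cst_continuous.
    exact: continuous_W_inv.
  have c2 : {for x, continuous (fun x => (x ord0 i * (2 * k.+1%:R * x ord0 j)) * (W x ^+ k.+2)^-1)}.
    apply: (@continuousM _ _ (fun x : 'rV[R]_4 => x ord0 i * (2 * k.+1%:R * x ord0 j)) (fun x => (W x ^+ k.+2)^-1) x).
      exact: (Ck_continuous (CkM (@Ck_coord R 0 i) (CkZ _ (@Ck_coord R 0 j)))).
    exact: continuous_W_inv.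
  rewrite (_ : dg j = fun x => (i == j)%:R * (W x ^+ k.+1)^-1 + (x ord0 i * (2 * k.+1%:R * x ord0 j)) * (W x ^+ k.+2)^-1).
    exact: (continuousD c1 c2).
  by apply/funext => y; rewrite /dg !mulrA.
have [Cfg Efg] := Ck1_mul_ball (sf 1%N) f0 df0 cg cdg dgE.
have bfg : bounded_support (fun x => f x * g x).
  do 2 apply: bounded_supportMl; exact: Cinf_c_bounded_support.
have FE : F = partial i (fun x => f x * g x).
  rewrite Efg dfE; apply/funext => x; rewrite /F /f /g /dg eqxx mulr1n.
  by move: (partial i u x) (W x ^- _) (W x ^- _) => p q r; ring.
rewrite FE; split; last exact: Rintegral_partial.
apply: integrable_bounded_support; last exact: bounded_support_partial.
exact: (Ck_continuous (Ck_partial i Cfg)).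
Qed.

(* Integrating the divergence of [u^2 x / W^3] and completing a square. *)
Lemma Hardy_weight3 u : Cinf_c u ->
  4 * \int[lam]_x (u x ^+ 2 * (W x ^+ 4)^-1) <=
  \sum_(i < 4) \int[lam]_x (partial i u x ^+ 2 * (W x ^+ 2)^-1).
Proof.
move=> cu; have su := Cinf_c_smooth cu.
have cuu : continuous (fun x => u x ^+ 2) by exact: (Ck_continuous (CkM (su 0%N) (su 0%N))).
have I0 : lam.-integrable setT (EFin \o (fun x => u x ^+ 2 * (W x ^+ 4)^-1)).
  by apply: (integrable_weight 4 cu) => // x ->; rewrite expr0n.
have I1 i : lam.-integrable setT (EFin \o (fun x => partial i u x ^+ 2 * (W x ^+ 2)^-1)).
  have sui := smooth_partial i su.
  apply: (integrable_weight 2 (Cinf_c_partial i cu)); last by move=> x ->; rewrite expr0n.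
  exact: (Ck_continuous (CkM (sui 0%N) (sui 0%N))).
pose F i x := 2 * u x * partial i u x * x ord0 i * (W x ^+ 3)^-1 +
    u x ^+ 2 * (W x ^+ 3)^-1 + 2 * 3%:R * u x ^+ 2 * x ord0 i ^+ 2 * (W x ^+ 4)^-1.
have IF i : lam.-integrable setT (EFin \o F i) by have [] := Rintegral_div_weight i 2 cu.
have F0 i : \int[lam]_x F i x = 0 by have [] := Rintegral_div_weight i 2 cu.
have -> : \sum_(i < 4) \int[lam]_x (partial i u x ^+ 2 * (W x ^+ 2)^-1) =
    \int[lam]_x (\sum_(i < 4) (partial i u x ^+ 2 * (W x ^+ 2)^-1 + F i x)).
  rewrite Rintegral_sum; last by move=> i; exact: (integrableD measurableT (I1 i) (IF i)).
  by apply: eq_bigr => i _; rewrite RintegralD// F0 addr0.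
rewrite -RintegralZl//; apply: le_Rintegral => //.
- exact: (@integrableZl _ _ _ _ _ measurableT 4 _ I0).
- by apply: integrable_Rsum => i; exact: (integrableD measurableT (I1 i) (IF i)).
move=> x _; have [Bx|nBx] := pselect (B4 x); last first.
  rewrite (Cinf_c_out cu nBx) expr0n/= mul0r mulr0; apply: sumr_ge0 => i _.
  rewrite /F (Cinf_c_out cu nBx) expr0n/= !(mulr0, mul0r, addr0).
  by rewrite mulr_ge0 ?sqr_ge0// invr_ge0 sqr_ge0.
have Wx : 0 < W x by rewrite -W_gt0.
have W0 : W x != 0 by rewrite gt_eqF.
(* What remains after dropping the square [(u_i / W + u x_i / W^2)^2]. Summed over [i] it is
   [u^2 (5 - W) / W^4], and [W <= 1] leaves the constant 4. *)
apply: (@le_trans _ _ (\sum_(i < 4) (5 * u x ^+ 2 * x ord0 i ^+ 2 * (W x ^+ 4)^-1 + u x ^+ 2 * (W x ^+ 3)^-1))).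
  rewrite big_split/= sumr_const card_ord -mulr_suml -mulr_sumr -/(sqnorm x).
  have -> : sqnorm x = 1 - W x by rewrite /W; ring.
  rewrite [leRHS](_ : _ = u x ^+ 2 * (5 - W x) * (W x ^+ 4)^-1); last by field.
  rewrite mulrA ler_pM2r ?invr_gt0 ?exprn_gt0// mulrC ler_wpM2l ?sqr_ge0//.
  by have := W_le1 x; lra.
apply: ler_sum => i _; rewrite -subr_ge0.
rewrite [X in 0 <= X](_ : _ = (partial i u x / W x + u x * x ord0 i / W x ^+ 2) ^+ 2); first exact: sqr_ge0.
by rewrite /F; move: (partial i u x) => p; field.
Qed.

(** The vector field is now [u^2 x / W] and the square [(u_i + u x_i / W)^2]; the remainder sums to
    [u^2 (1 + 3 W) / W^2]. *)
Lemma Hardy_weight1 u : Cinf_c u ->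
  \int[lam]_x (u x ^+ 2 * (W x ^+ 2)^-1) <= \sum_(i < 4) \int[lam]_x (partial i u x ^+ 2).
Proof.
move=> cu; have su := Cinf_c_smooth cu.
have cuu : continuous (fun x => u x ^+ 2) by exact: (Ck_continuous (CkM (su 0%N) (su 0%N))).
have I0 : lam.-integrable setT (EFin \o (fun x => u x ^+ 2 * (W x ^+ 2)^-1)).
  by apply: (integrable_weight 2 cu) => // x ->; rewrite expr0n.
have I1 i : lam.-integrable setT (EFin \o (fun x => partial i u x ^+ 2)).
  have sui := smooth_partial i su.
  apply: integrable_mul_support; [exact: Ck_continuous (sui 0%N)|exact: Ck_continuous (sui 0%N)|].
  by apply: bounded_support_partial; exact: Cinf_c_bounded_support.
pose F i x := 2 * u x * partial i u x * x ord0 i * (W x ^+ 1)^-1 +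
    u x ^+ 2 * (W x ^+ 1)^-1 + 2 * 1%:R * u x ^+ 2 * x ord0 i ^+ 2 * (W x ^+ 2)^-1.
have IF i : lam.-integrable setT (EFin \o F i) by have [] := Rintegral_div_weight i 0 cu.
have F0 i : \int[lam]_x F i x = 0 by have [] := Rintegral_div_weight i 0 cu.
have -> : \sum_(i < 4) \int[lam]_x (partial i u x ^+ 2) =
    \int[lam]_x (\sum_(i < 4) (partial i u x ^+ 2 + F i x)).
  rewrite Rintegral_sum; last by move=> i; exact: (integrableD measurableT (I1 i) (IF i)).
  by apply: eq_bigr => i _; rewrite RintegralD// F0 addr0.
apply: le_Rintegral => //.
- by apply: integrable_Rsum => i; exact: (integrableD measurableT (I1 i) (IF i)).
move=> x _; have [Bx|nBx] := pselect (B4 x); last first.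
  rewrite (Cinf_c_out cu nBx) expr0n/= mul0r; apply: sumr_ge0 => i _.
  rewrite /F (Cinf_c_out cu nBx) expr0n/= !(mulr0, mul0r, addr0).
  exact: sqr_ge0.
have Wx : 0 < W x by rewrite -W_gt0.
have W0 : W x != 0 by rewrite gt_eqF.
apply: (@le_trans _ _ (\sum_(i < 4) (u x ^+ 2 * x ord0 i ^+ 2 * (W x ^+ 2)^-1 + u x ^+ 2 * (W x ^+ 1)^-1))).
  rewrite big_split/= sumr_const card_ord -mulr_suml -mulr_sumr -/(sqnorm x).
  have -> : sqnorm x = 1 - W x by rewrite /W; ring.
  rewrite [leRHS](_ : _ = u x ^+ 2 * (1 + 3 * W x) * (W x ^+ 2)^-1); last by field.
  rewrite ler_pM2r ?invr_gt0 ?exprn_gt0// ler_peMr ?sqr_ge0//.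
  by lra.
apply: ler_sum => i _; rewrite -subr_ge0.
rewrite [X in 0 <= X](_ : _ = (partial i u x + u x * x ord0 i / W x) ^+ 2); first exact: sqr_ge0.
by rewrite /F; move: (partial i u x) => p; field.
Qed.

(** [Hardy_weight3] for [u], then [Hardy_weight1] for each [partial i u], then the Hessian identity.
    The constant is the 16 of the density [(2 / W)^4] divided by the 4 of [Hardy_weight3]; for
    energy at most 1 it bounds the squared norm by 4. *)
Lemma hyp_sqr_le u : Cinf_c u -> hyp_sqr u <= 4 * \int[lam]_x (lap u x ^+ 2).
Proof.
move=> cu; have su := Cinf_c_smooth cu.
have -> : hyp_sqr u = 16 * \int[lam]_x (u x ^+ 2 * (W x ^+ 4)^-1).
  rewrite -RintegralZl//; last first.
    apply: (integrable_weight 4 cu); last by move=> x ->; rewrite expr0n.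
    exact: (Ck_continuous (CkM (su 0%N) (su 0%N))).
  by apply: eq_Rintegral => x _; rewrite exprMn exprVn; ring.
have := Hardy_weight3 cu.
have H i := Hardy_weight1 (Cinf_c_partial i cu).
rewrite (Rintegral_lap_sqr su (Cinf_c_bounded_support cu)) => H3.
have : \sum_(i < 4) \int[lam]_x (partial i u x ^+ 2 * (W x ^+ 2)^-1) <=
  \sum_(i < 4) \sum_(j < 4) \int[lam]_x (partial j (partial i u) x ^+ 2).
  by apply: ler_sum => i _; exact: H.
by move: H3; move: (Rintegral _ _ _) (\sum_(i < 4) _) (\sum_(i < 4) _) => a b c; lra.
Qed.

End energy.

(** * Heat kernel averages *)

Section cauchy_schwarz.
Context d (T : measurableType d) (R : realType).
Variable m : {measure set T -> \bar R}.
Local Open Scope ereal_scope.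

Lemma integral_Cauchy_Schwarz (a b : T -> R) (X Y : R) :
  measurable_fun setT a -> measurable_fun setT b -> (0 < X)%R -> (0 < Y)%R ->
  \int[m]_x (a x ^+ 2)%:E <= X%:E -> \int[m]_x (b x ^+ 2)%:E <= Y%:E ->
  \int[m]_x (`|a x * b x|)%:E <= (Num.sqrt (X * Y))%:E.
Proof.
move=> ma mb X0 Y0 aX bY.
(* The weight in [2 |a b| <= c a^2 + b^2 / c] for which both terms contribute [sqrt (X Y)]. *)
pose c := Num.sqrt (Y / X).
have c0 : (0 < c)%R by rewrite sqrtr_gt0 divr_gt0.
have cE : (c * X = Num.sqrt (X * Y))%R.
  rewrite /c -{2}[X](sqr_sqrtr (ltW X0)) expr2 mulrA -sqrtrM ?divr_ge0 ?ltW//.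
  by rewrite divfK ?gt_eqF// sqrtrM ?ltW// mulrC.
have cE' : (c^-1 * Y = Num.sqrt (X * Y))%R.
  apply: (mulfI (lt0r_neq0 c0)); rewrite mulrA divff ?gt_eqF// mul1r -cE mulrA -expr2.
  by rewrite /c sqr_sqrtr ?divr_ge0 ?ltW// divfK ?gt_eqF.
have ma2 : measurable_fun setT (fun x => (a x ^+ 2)%:E).
  by apply/measurable_EFinP; exact: measurable_funX.
have mb2 : measurable_fun setT (fun x => (b x ^+ 2)%:E).
  by apply/measurable_EFinP; exact: measurable_funX.
apply: (@le_trans _ _ (\int[m]_x ((c / 2)%:E * (a x ^+ 2)%:E + (c^-1 / 2)%:E * (b x ^+ 2)%:E))).
  apply: ge0_le_integral => //.
  - apply/measurable_EFinP; apply: measurableT_comp => //; exact: measurable_funM.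
  - by apply: emeasurable_funD; apply: emeasurable_funM => //; exact: measurable_cst.
  - move=> x _; rewrite -!EFinM -EFinD lee_fin normrM.
    rewrite -(real_normK (num_real (a x))) -(real_normK (num_real (b x))).
    move: (normr_ge0 (a x)) (normr_ge0 (b x)); set p := `|a x|%R; set q := `|b x|%R => p0 q0.
    rewrite -subr_ge0 [X in (0 <= X)%R](_ : _ = (c * p - q) ^+ 2 / (2 * c))%R; last by field; rewrite gt_eqF.
    by rewrite divr_ge0 ?sqr_ge0// mulr_ge0// ltW.
rewrite ge0_integralD//; last 4 first.
- by move=> x _; rewrite -EFinM lee_fin mulr_ge0 ?sqr_ge0// divr_ge0 ?ltW.
- by apply: emeasurable_funM => //; exact: measurable_cst.
- by move=> x _; rewrite -EFinM lee_fin mulr_ge0 ?sqr_ge0// divr_ge0 ?invr_ge0 ?ltW.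
- by apply: emeasurable_funM => //; exact: measurable_cst.
rewrite ge0_integralZl//; last 2 first.
- by move=> x _; rewrite lee_fin sqr_ge0.
- by rewrite lee_fin divr_ge0 ?ltW.
rewrite ge0_integralZl//; last 2 first.
- by move=> x _; rewrite lee_fin sqr_ge0.
- by rewrite lee_fin divr_ge0 ?invr_ge0 ?ltW.
apply: (@le_trans _ _ ((c / 2)%:E * X%:E + (c^-1 / 2)%:E * Y%:E)).
  by apply: leeD; apply: lee_wpmul2l => //; rewrite lee_fin divr_ge0 ?invr_ge0 ?ltW.
rewrite -!EFinM -EFinD lee_fin.
rewrite (_ : _ + _ = (c * X + c^-1 * Y) / 2)%R; last by field; rewrite gt_eqF.
by rewrite cE cE'; set S := Num.sqrt _; lra.
Qed.

End cauchy_schwarz.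

(** * Gaussian kernels and the sharp square integral *)

Section gaussian.
Variable R : realType.
Implicit Types (u v f g : 'rV[R]_4 -> R) (x z : 'rV[R]_4) (i j : 'I_4).
Local Notation lam := (@lebesgue_rV4 R).
Local Notation mu := (@lebesgue_measure R).
Local Notation mR := (measurableTypeR R).

Definition gauss (t : R) z := expR (- t * sqnorm z).

Lemma gauss_ge0 t z : 0 <= gauss t z. Proof. exact: expR_ge0. Qed.

Lemma measurable_gauss t : measurable_fun setT (gauss t).
Proof.
apply: measurableT_comp => //; apply: measurable_funM => //.
exact: measurable_sqnorm.
Qed.

Lemma integral_gauss t : 0 < t -> (\int[lam]_z (gauss t z)%:E = (pi ^+ 2 / t ^+ 2)%:E)%E.
Proof. exact: ge0_integral_gauss4. Qed.

Lemma expR_ge_id (t : R) : t <= expR t.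
Proof. by apply: le_trans (expR_ge1Dx t); rewrite lerDr. Qed.

Lemma expR_ge_sqr (t : R) : 0 <= t -> t ^+ 2 / 4 <= expR t.
Proof.
move=> t0; rewrite [in leRHS](splitr t) expRD -expr2.
rewrite (_ : t ^+ 2 / 4 = (t / 2) ^+ 2); last by field.
by rewrite ler_sqr ?nnegrE ?expR_ge0 ?divr_ge0//; exact: expR_ge_id.
Qed.

(** Half of the exponent absorbs the polynomial factor, here by [y <= e^y], and for the second
    moment by [y^2 / 4 <= e^y]. *)
Lemma gauss_moment1 t z : 0 < t -> sqnorm z * gauss t z <= 2 / t * gauss (t / 2) z.
Proof.
move=> t0; rewrite /gauss -[leLHS]mul1r.
have -> : expR (- t * sqnorm z) = expR (- (t / 2) * sqnorm z) * expR (- (t / 2) * sqnorm z).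
  by rewrite -expRD; congr expR; field.
rewrite mul1r mulrA ler_wpM2r ?expR_ge0// mulNr expRN -ler_pdivlMr ?invr_gt0 ?expR_gt0// invrK.
apply: (@le_trans _ _ (2 / t * (t / 2 * sqnorm z))).
  by rewrite (_ : _ * _ = sqnorm z)//; field; rewrite gt_eqF.
by apply: ler_wpM2l; [rewrite divr_ge0// ltW|exact: expR_ge_id].
Qed.

Lemma gauss_moment2 t z : 0 < t ->
  sqnorm z ^+ 2 * gauss t z <= 16 / t ^+ 2 * gauss (t / 2) z.
Proof.
move=> t0.
have -> : gauss t z = gauss (t / 2) z * gauss (t / 2) z.
  by rewrite /gauss -expRD; congr expR; field.
rewrite mulrA ler_wpM2r ?gauss_ge0// {1}/gauss mulNr expRN -ler_pdivlMr ?invr_gt0 ?expR_gt0// invrK.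
have s0 := sqnorm_ge0 z.
apply: (@le_trans _ _ (16 / t ^+ 2 * ((t / 2 * sqnorm z) ^+ 2 / 4))).
  rewrite (_ : _ / _ * _ = sqnorm z ^+ 2)//; field; rewrite gt_eqF//.
rewrite ler_wpM2l ?divr_ge0 ?sqr_ge0//; apply: expR_ge_sqr.
by rewrite mulr_ge0// divr_ge0// ltW.
Qed.

Lemma is_derive_mull (a s : R) : is_derive s 1 (fun r : R => a * r) a.
Proof.
apply: (is_derive_eq (@is_deriveM _ R (cst a) id s 1 _ _ (is_derive_cst a s 1) (is_derive_id s 1))).
by rewrite /GRing.scale/= mulr1 mulr0 addr0.
Qed.

Lemma Ck1_expR (c t : R) k : Ck1 k (fun s => c * expR (t * s)).
Proof.
have D (a : R) (s : R) : is_derive s 1 (fun s => a * expR (t * s)) (a * t * expR (t * s)).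
  have d1 := is_derive_mull t s.
  have d2 := is_derive1_comp (is_derive_expR (t * s)) d1.
  apply: (is_derive_eq (is_deriveM (is_derive_cst a s 1) d2)).
  by rewrite /GRing.scale/= mulr0 addr0; ring.
have C (a : R) : continuous (fun s : R => a * expR (t * s)).
  move=> s; apply: differentiable_continuous; apply/derivable1_diffP.
  by case: (D a s).
elim: k c => [|k IH] c; first exact: C.
split; first exact: C.
split; first by move=> s; case: (D c s).
rewrite (_ : derive1 _ = fun s => c * t * expR (t * s)); first exact: IH.
by apply/funext => s; rewrite derive1E; apply: derive_val.
Qed.

Lemma gaussE t : gauss t = (fun s => 1 * expR (- t * s)) \o @sqnorm R.
Proof. by apply/funext => z; rewrite /= mul1r. Qed.

Lemma smooth_gauss t : smooth (gauss t).
Proof.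
by move=> k; rewrite gaussE; apply: Ck_comp; [exact: Ck1_expR|exact: Ck_sqnorm].
Qed.

Lemma partial_gauss t i : partial i (gauss t) = fun z => (- 2 * t) * (z ord0 i * gauss t z).
Proof.
rewrite gaussE (partial_comp i (Ck1_expR 1 (- t) 1) (@Ck_sqnorm R 1)).
apply/funext => z; rewrite partial_sqnorm.
have d2 := is_derive1_comp (is_derive_expR (- t * sqnorm z)) (is_derive_mull (- t) (sqnorm z)).
have d3 := is_deriveM (is_derive_cst (1 : R) (sqnorm z) 1) d2.
have -> : derive1 (fun s : R => 1 * expR (- t * s)) (sqnorm z) = expR (- t * sqnorm z) * - t.
  have D : is_derive (sqnorm z) 1 (fun s : R => 1 * expR (- t * s)) (expR (- t * sqnorm z) * - t).
    by apply: (is_derive_eq d3); rewrite /GRing.scale/= mulr0 addr0 mul1r.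
  by rewrite derive1E; have [_] := D.
by rewrite /= /gauss; ring.
Qed.

Lemma lap_gauss t z : lap (gauss t) z = (4 * t ^+ 2 * sqnorm z - 8 * t) * gauss t z.
Proof.
have sg := smooth_gauss t.
rewrite /lap (eq_bigr (fun i => - 2 * t * gauss t z + 4 * t ^+ 2 * z ord0 i ^+ 2 * gauss t z)); last first.
  move=> i _; rewrite partial_gauss.
  rewrite (partialZ _ i (smoothM (smooth_coord R i) sg 1%N)).
  rewrite (spartialM i (smooth_coord R i) sg) partial_coord eqxx mulr1n partial_gauss.
  ring.
by rewrite big_split/= sumr_const card_ord -mulr_suml -mulr_sumr -/(sqnorm z); ring.
Qed.

Lemma FTC2 (F f : R -> R) (a b : R) : a < b ->
  (forall t, a <= t <= b -> is_derive t 1 F (f t)) ->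
  (forall t, a <= t <= b -> {for t, continuous f}) ->
  (\int[mu]_(t in `[a, b]) (f t)%:E = (F b - F a)%:E)%E.
Proof.
move=> ab dF cf.
have cF t : a <= t <= b -> {for t, continuous F}.
  move=> tab; apply: differentiable_continuous; apply/derivable1_diffP.
  by case: (dF t tab).
have aab : a <= a <= b by rewrite lexx ltW.
have bab : a <= b <= b by rewrite lexx ltW.
rewrite (@continuous_FTC2 _ f F a b)//.
- apply: continuous_in_subspaceT => t; rewrite inE/= in_itv/= => tab; exact: cf.
- split.
  + move=> t; rewrite in_itv/= => /andP[ta tb].
    by have [] := dF t (_ : a <= t <= b); rewrite ?ltW.
  + by apply: cvg_at_right_filter; exact: cF.
  + by apply: cvg_at_left_filter; exact: cF.
- move=> t; rewrite in_itv/= => /andP[ta tb].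
  have tab : a <= t <= b by rewrite !ltW.
  by rewrite derive1E; have [_] := dF t tab.
Qed.

Lemma integral_mul_indic d (T : measurableType d) (m : {measure set T -> \bar R})
    (I : set T) (f : T -> \bar R) :
  (\int[m]_x (f x * (\1_I x)%:E) = \int[m]_(x in I) f x)%E.
Proof.
rewrite [RHS]integral_mkcond; apply: eq_integral => x _.
by rewrite patchE indicE; case: (x \in I); rewrite ?mule1 ?mule0.
Qed.

Lemma measurable_invr : measurable_fun [set: mR] (fun t : mR => t^-1 : mR).
Proof.
rewrite -(setUv [set (0 : mR)]); apply/measurable_funU => //.
  exact: measurableC.
split; first exact: measurable_fun_set1.
apply: open_continuous_measurable_fun; first exact: closed_openC.
by move=> t; rewrite inE /= => /eqP t0; exact: inv_continuous.
Qed.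

(** Its integral in [t], times [- 1 / (4 pi^2)], is the kernel taking [lap u] to
    [heat B u - heat A u]. The indicator keeps [t] on the whole line, ready for Tonelli. *)
Definition slab (A B : R) z (t : mR) : R := gauss t z * \1_(`[A, B]%classic : set R) t.

Lemma measurable_gauss2 : measurable_fun setT (fun p : 'rV[R]_4 * mR => gauss p.2 p.1).
Proof.
apply: measurableT_comp => //; apply: measurable_funM.
  exact: measurableT_comp.
by apply: measurableT_comp => //; exact: measurable_sqnorm.
Qed.

Lemma measurable_slab A B : measurable_fun setT (fun p : 'rV[R]_4 * mR => slab A B p.1 p.2).
Proof.
apply: measurable_funM; first exact: measurable_gauss2.
have mI : measurable (`[A, B]%classic : set mR) by exact: measurable_itv.
have m1 : measurable_fun [set: mR] (\1_(`[A, B]%classic : set mR) : mR -> R).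
  exact: measurable_indic.
by apply: (measurableT_comp m1); exact: measurable_snd.
Qed.

Lemma slab_ge0 A B z t : 0 <= slab A B z t.
Proof. by rewrite mulr_ge0// gauss_ge0. Qed.

Lemma is_derive_inv_shift (a s : R) : a + s != 0 ->
  is_derive s 1 (fun r : R => - (a + r)^-1) ((a + s) ^+ 2)^-1.
Proof.
move=> as0.
have d1 : is_derive s 1 (fun r : R => a + r) 1.
  apply: (is_derive_eq (is_deriveD (is_derive_cst a s 1) (is_derive_id s (1 : R)))).
  by rewrite add0r.
have d2 := is_deriveV as0 d1.
apply: (is_derive_eq (is_deriveN d2)).
by rewrite /GRing.scale/= mulr1 opprK.
Qed.

Lemma integral_inv_sqr (c t A B : R) : 0 < t -> 0 < A -> A < B ->
  (\int[mu]_(s in `[A, B]) (c / (t + s) ^+ 2)%:E =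
    (c * - (t + B)^-1 - c * - (t + A)^-1)%:E)%E.
Proof.
move=> t0 A0 AB.
pose F (s : R) := c * - (t + s)^-1.
pose f (s : R) := c / (t + s) ^+ 2.
have ne s : A <= s <= B -> t + s != 0.
  by move=> /andP[sA _]; rewrite gt_eqF// addr_gt0// (lt_le_trans A0).
apply: (@FTC2 F f) => // s /ne ts0.
  apply: (is_derive_eq (is_deriveM (is_derive_cst c s 1) (is_derive_inv_shift ts0))).
  by rewrite /GRing.scale/= mulr0 addr0.
apply: (@continuousM _ _ (cst c) (fun s => ((t + s) ^+ 2)^-1) s); first exact: cst_continuous.
apply: (@continuous_comp _ _ _ (fun s : R => (t + s) ^+ 2) (fun r : R => r^-1)).
  apply: (@continuous_comp _ _ _ (fun s : R => t + s) (fun r : R => r ^+ 2)); last exact: exprn_continuous.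
  by apply: (@continuousD _ _ _ (cst t) id s) => //; exact: cst_continuous.
by apply: inv_continuous; rewrite expf_neq0.
Qed.

Lemma integral_cst_div (c A B : R) : 0 < A -> A < B ->
  (\int[mu]_(t in `[A, B]) (c / t)%:E = (c * ln B - c * ln A)%:E)%E.
Proof.
move=> A0 AB.
pose F (s : R) := c * ln s.
pose f (s : R) := c / s.
apply: (@FTC2 F f) => // t /andP[tA _]; have t0 : 0 < t := lt_le_trans A0 tA.
  apply: (is_derive_eq (is_deriveM (is_derive_cst c t 1) (is_derive1_ln t0))).
  by rewrite /GRing.scale/= mulr0 addr0.
apply: (@continuousM _ _ (cst c) (fun r : R => r^-1) t); first exact: cst_continuous.
by apply: inv_continuous; rewrite gt_eqF.
Qed.

(** The source of the critical constant. Tonelli turns the square into the integral of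
    [pi^2 / (t + s)^2] over the square [[A, B]^2]; bounding the inner integral by [pi^2 / t] keeps
    the leading coefficient of [ln (B / A)] sharp. *)
Lemma integral_slab_sqr A B : 0 < A -> A < B ->
  (\int[lam]_z ((\int[mu]_t (slab A B z t)%:E) * (\int[mu]_t (slab A B z t)%:E))
    <= (pi ^+ 2 * ln (B / A))%:E)%E.
Proof.
move=> A0 AB.
have B0 : 0 < B := lt_trans A0 AB.
pose k z t := (slab A B z t)%:E.
have k0 z t : (0 <= k z t)%E by rewrite lee_fin slab_ge0.
pose K z := (\int[mu]_t k z t)%E.
have mk : measurable_fun setT (fun p : 'rV[R]_4 * mR => k p.1 p.2).
  by apply/measurable_EFinP; exact: measurable_slab.
have mK : measurable_fun setT K.
  exact: (measurable_fun_fubini_tonelli_F (fun p : 'rV[R]_4 * mR => k p.1 p.2)).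
have K0 z : (0 <= K z)%E by exact: integral_ge0.
have mk1 t : measurable_fun setT (k ^~ t).
  exact: (measurableT_comp mk (pair2_measurable t)).
have mk2 z : measurable_fun setT (k z).
  exact: (measurableT_comp mk (pair1_measurable z)).
have step1 : (\int[lam]_z (K z * K z) = \int[mu]_t \int[lam]_z (k z t * K z))%E.
  transitivity (\int[lam]_z \int[mu]_t (k z t * K z))%E.
    by apply: eq_integral => z _; rewrite ge0_integralZr.
  apply: (fubini_tonelli (fun p : 'rV[R]_4 * mR => k p.1 p.2 * K p.1)%E).
  - by apply: emeasurable_funM => //; exact: measurableT_comp.
  - by move=> p; rewrite mule_ge0.
have step2 t : (\int[lam]_z (k z t * K z) = \int[mu]_s \int[lam]_z (k z t * k z s))%E.
  transitivity (\int[lam]_z \int[mu]_s (k z t * k z s))%E.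
    by apply: eq_integral => z _; rewrite ge0_integralZl.
  apply: (fubini_tonelli (fun p : 'rV[R]_4 * mR => k p.1 t * k p.1 p.2)%E).
  - apply: emeasurable_funM => //.
    exact: (measurableT_comp (mk1 t) measurable_fst).
  - by move=> p; rewrite mule_ge0.
pose I := (`[A, B]%classic : set R).
have step3 t s : (\int[lam]_z (k z t * k z s) =
    (\1_I t)%:E * ((\1_I s)%:E * (pi ^+ 2 / (t + s) ^+ 2)%:E))%E.
  have [tI|tI] := boolP (t \in I); last first.
    rewrite indicE (negbTE tI) mul0e; apply: integral0_eq => z _.
    by rewrite /k /slab indicE (negbTE tI) mulr0 mul0e.
  have [sI|sI] := boolP (s \in I); last first.
    rewrite [\1_I s]indicE (negbTE sI) mul0e mule0; apply: integral0_eq => z _.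
    by rewrite /k /slab [\1_I s]indicE (negbTE sI) mulr0 mule0.
  rewrite !indicE tI sI !mul1e -integral_gauss; last first.
    move: tI sI; rewrite !inE /I /= !in_itv/= => /andP[tA _] /andP[sA _].
    by rewrite addr_gt0// (lt_le_trans A0).
  apply: eq_integral => z _; rewrite /k /slab !indicE tI sI !mulr1 -EFinM /gauss -expRD.
  by congr (expR _)%:E; ring.
have mI : measurable I by exact: measurable_itv.
have step4 t : (\int[mu]_s \int[lam]_z (k z t * k z s) <= (\1_I t * (pi ^+ 2 / t))%:E)%E.
  under eq_integral do rewrite step3.
  have [tI|tI] := boolP (t \in I); last first.
    by rewrite indicE (negbTE tI) mul0r; under eq_integral do rewrite mul0e; rewrite integral0.
  have tA : A <= t by move: tI; rewrite inE /I /= in_itv/= => /andP[].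
  have t0 : 0 < t := lt_le_trans A0 tA.
  rewrite indicE tI mul1r; under eq_integral do rewrite mul1e muleC.
  rewrite integral_mul_indic.
  have -> : (\int[mu]_(s in I) (pi ^+ 2 / (t + s) ^+ 2)%:E)%E =
      (pi ^+ 2 * - (t + B)^-1 - pi ^+ 2 * - (t + A)^-1)%:E.
    exact: integral_inv_sqr.
  rewrite lee_fin !mulrN opprK addrC -mulrBr ler_wpM2l ?sqr_ge0//.
  rewrite lerBlDr (@le_trans _ _ t^-1)//; first by rewrite lef_pV2 ?posrE ?addr_gt0// lerDl ltW.
  by rewrite lerDl invr_ge0 addr_ge0// ltW.
rewrite -/(K _) step1; under eq_integral do rewrite step2.
apply: (@le_trans _ _ (\int[mu]_t (\1_I t * (pi ^+ 2 / t))%:E)%E).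
  apply: ge0_le_integral => //.
  - by move=> t _; apply: integral_ge0 => s _; apply: integral_ge0 => z _; exact: mule_ge0.
  - under eq_fun do rewrite -step2.
    apply: (measurable_fun_fubini_tonelli_G (fun p : 'rV[R]_4 * mR => k p.1 p.2 * K p.1)%E).
    + by apply: emeasurable_funM => //; exact: measurableT_comp.
    + by move=> p; rewrite mule_ge0.
  - apply/measurable_EFinP; apply: measurable_funM; first exact: measurable_indic.
    by apply: measurable_funM => //; exact: measurable_invr.
under eq_integral do rewrite mulrC EFinM.
rewrite integral_mul_indic.
rewrite integral_cst_div// lee_fin -mulrBr lnM ?posrE ?invr_gt0// lnV ?posrE//.
Qed.

End gaussian.

(** * Comparison of heat averages at two scales *)

Section heat.
Variable R : realType.
Implicit Types (u f : 'rV[R]_4 -> R) (x z : 'rV[R]_4) (i : 'I_4).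
Local Notation lam := (@lebesgue_rV4 R).
Local Notation mu := (@lebesgue_measure R).
Local Notation mR := (measurableTypeR R).

Lemma integral_indic_itv_fin (A B : R) :
  (\int[mu]_t (\1_(`[A, B]%classic : set mR) t)%:E < +oo)%E.
Proof.
have mI : measurable (`[A, B]%classic : set mR) by exact: measurable_itv.
rewrite integral_indic// setIT; apply: (@le_lt_trans _ _ (mu `[A, B]%classic)) => //.
rewrite lebesgue_measure_itv/=; case: ifPn => // _.
by rewrite -EFinB ltry.
Qed.

Lemma slab_le A B z (t : mR) : 0 < A -> slab A B z t <= \1_(`[A, B]%classic : set mR) t.
Proof.
move=> A0; rewrite /slab !indicE.
have [pI|pI] := boolP (t \in _); last by rewrite !mulr0.
rewrite mulr1 /gauss -expR0 ler_expR mulNr oppr_le0 mulr_ge0 ?sqnorm_ge0//.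
by move: pI; rewrite inE /= in_itv/= => /andP[/(lt_le_trans A0)/ltW].
Qed.

Lemma integrable_slab1 A B z : 0 < A -> mu.-integrable setT (EFin \o slab A B z).
Proof.
move=> A0; have mz : measurable_fun setT (slab A B z).
  exact: (measurableT_comp (measurable_slab A B) (pair1_measurable z)).
have mI : measurable (`[A, B]%classic : set mR) by exact: measurable_itv.
apply/integrableP; split; first exact/measurable_EFinP.
apply: le_lt_trans (integral_indic_itv_fin A B).
apply: ge0_le_integral => //.
- by apply/measurable_EFinP; exact: measurableT_comp.
- by apply/measurable_EFinP; exact: measurable_indic.
- by move=> t _; rewrite /= lee_fin ger0_norm ?slab_ge0// slab_le.
Qed.

Lemma integrable_slab (F : 'rV[R]_4 * mR -> R) (A B M C : R) : A < B ->
  measurable_fun setT F -> (forall p, `|F p| <= C) ->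
  (forall z t, ~ cube M z -> F (z, t) = 0) ->
  (forall z t, t \notin `[A, B] -> F (z, t) = 0) ->
  (lam \x mu)%E.-integrable setT (EFin \o F).
Proof.
move=> AB mF FC FM FI.
have C0 : 0 <= C := le_trans (normr_ge0 _) (FC (0, 0)).
pose I := (`[A, B]%classic : set mR).
have mI : measurable I by exact: measurable_itv.
have mM : measurable (@cube R M) := measurable_cube M.
pose f1 z : \bar R := (C * \1_(cube M) z)%:E.
pose f2 (t : mR) : \bar R := (\1_I t)%:E.
have mf1 : measurable_fun setT f1.
  by apply/measurable_EFinP; apply: measurable_funM => //; exact: measurable_indic.
have mf2 : measurable_fun setT f2.
  by apply/measurable_EFinP; exact: measurable_indic.
have f10 z : (0 <= f1 z)%E by rewrite lee_fin mulr_ge0.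
have f20 t : (0 <= f2 t)%E by rewrite lee_fin.
apply/integrableP; split; first exact/measurable_EFinP.
apply: (@le_lt_trans _ _ (\int[lam \x mu]_p (f1 p.1 * f2 p.2))%E).
  apply: ge0_le_integral => //.
  - by apply/measurable_EFinP; exact: measurableT_comp.
  - by apply: emeasurable_funM; apply: measurableT_comp.
  - move=> [z t] _; rewrite /f1 /f2 /= -EFinM lee_fin !indicE.
    have [zM|] := boolP (z \in cube M); last first.
      by rewrite notin_setE => /FM ->; rewrite normr0 mulr0 mul0r.
    have [tI|tI] := boolP (t \in I); first by rewrite !mulr1.
    have -> : F (z, t) = 0.
      by apply: FI; apply/negP => h; move/negP: tI; apply; rewrite inE; exact: h.
    by rewrite normr0 !mulr_ge0.
rewrite ge0_integral_prod// lte_mul_pinfty//.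
- exact: integral_ge0.
- rewrite ge0_fin_numE; last exact: integral_ge0.
  rewrite /f1; under eq_integral do rewrite EFinM.
  rewrite ge0_integralZl//; last by apply/measurable_EFinP; exact: measurable_indic.
  by rewrite integral_indic// setIT lte_mul_pinfty ?lee_fin// cube_fin.
- exact: integral_indic_itv_fin.
Qed.

(* [t] is the inverse of four times the usual time variable. *)
Definition heat_kernel (t : R) z := t ^+ 2 / pi ^+ 2 * gauss t z.
Definition heat t u x := \int[lam]_z (heat_kernel t z * u (x + z)).

Lemma pi_neq0 : pi != 0 :> R. Proof. by rewrite gt_eqF// pi_gt0. Qed.

Lemma heat_kernel_ge0 t z : 0 <= heat_kernel t z.
Proof. by rewrite mulr_ge0 ?gauss_ge0// divr_ge0 ?sqr_ge0. Qed.

Lemma smooth_heat_kernel t : smooth (heat_kernel t).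
Proof. by move=> k; apply: CkZ; exact: smooth_gauss. Qed.

Lemma integral_heat_kernel t : 0 < t -> (\int[lam]_z (heat_kernel t z)%:E = 1)%E.
Proof.
move=> t0; rewrite /heat_kernel; under eq_integral do rewrite EFinM.
rewrite ge0_integralZl//; last 3 first.
- by apply/measurable_EFinP; exact: measurable_gauss.
- by move=> z _; rewrite lee_fin gauss_ge0.
- by rewrite lee_fin divr_ge0 ?sqr_ge0.
rewrite integral_gauss// -EFinM; congr EFin.
have := pi_neq0; move: (pi : R) => p p0; field.
by rewrite gt_eqF// p0.
Qed.

Lemma translate_left u x : (fun z => u (x + z)) = (fun z => u (z + x)).
Proof. by apply/funext => z; rewrite addrC. Qed.

Lemma smooth_translate u x : smooth u -> smooth (fun z => u (x + z)).
Proof. by move=> su k; rewrite translate_left; have [] := Ck_translate x (su k). Qed.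

Lemma bounded_support_translate_left u x :
  bounded_support u -> bounded_support (fun z => u (x + z)).
Proof. by move=> bu; rewrite translate_left; exact: bounded_support_translate. Qed.

Lemma partial_translate u x i : Ck 1 u ->
  partial i (fun z => u (x + z)) = fun z => partial i u (x + z).
Proof.
move=> Cu; rewrite translate_left; have [_ ->//] := Ck_translate x Cu.
by apply/funext => z; rewrite addrC.
Qed.

Lemma lap_translate u x z : smooth u -> lap (fun z => u (x + z)) z = lap u (x + z).
Proof.
move=> su; rewrite /lap; apply: eq_bigr => i _.
have E1 := partial_translate x i (su 1%N).
have E2 := partial_translate x i (smooth_partial i su 1%N).
exact: (congr1 (fun f => f z) (etrans (congr1 (partial i) E1) E2)).
Qed.

(* [t^2 gauss t] solves the heat equation in the inverse time variable [t]. *)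
Lemma is_derive_heat z (t : R) :
  is_derive t 1 (fun r : R => r ^+ 2 * gauss r z) (- 4^-1 * lap (gauss t) z).
Proof.
have d1 := is_derive_exprn 1 t.
have d2 : is_derive t 1 (fun r : R => gauss r z) (- sqnorm z * gauss t z).
  have E : (fun r : R => gauss r z) = expR \o (fun r => - sqnorm z * r).
    by apply/funext => r; rewrite /gauss /= mulNr mulrC mulNr.
  rewrite E; apply: (is_derive_eq (is_derive1_comp (is_derive_expR _) (is_derive_mull (- sqnorm z) t))).
  by rewrite mulrC /gauss; congr (_ * expR _); ring.
apply: (is_derive_eq (is_deriveM d1 d2)).
rewrite lap_gauss /GRing.scale/= expr1; by field.
Qed.

Lemma continuous_lap_gauss z t : {for t, continuous (fun r : R => - 4^-1 * lap (gauss r) z)}.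
Proof.
have E : (fun r : R => - 4^-1 * lap (gauss r) z) =
   (fun r : R => - 4^-1 * ((4 * sqnorm z * r ^+ 2 - 8 * r) * expR (- sqnorm z * r))).
  by apply/funext => r; rewrite lap_gauss /gauss; congr (_ * (_ * expR _)); ring.
rewrite E.
have d0 := is_derive_expR (- sqnorm z * t).
have d1 := is_derive1_comp d0 (is_derive_mull (- sqnorm z) t).
have c1 : {for t, continuous (fun r : R => expR (- sqnorm z * r))}.
  apply: differentiable_continuous; apply/derivable1_diffP; by case: d1.
apply: (@continuousM _ _ (cst (- 4^-1)) _ t); first exact: cst_continuous.
apply: (@continuousM _ _ (fun r : R => 4 * sqnorm z * r ^+ 2 - 8 * r) _ t) => //.
apply: (@continuousB _ _ _ (fun r : R => 4 * sqnorm z * r ^+ 2) (fun r : R => 8 * r) t).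
  apply: (@continuousM _ _ (cst (4 * sqnorm z)) (fun r : R => r ^+ 2) t); first exact: cst_continuous.
  exact: exprn_continuous.
by apply: (@continuousM _ _ (cst (8 : R)) id t) => //; exact: cst_continuous.
Qed.

(** The integral over [z] and [t] is computed in two orders. At fixed [t], Green's formula moves the
    Laplacian from [u] to the Gaussian; at fixed [z], the heat equation makes the integrand a
    derivative in [t]. *)
Lemma heat_difference u x A B : smooth u -> bounded_support u -> 0 < A -> A < B ->
  (\int[lam]_z ((\int[mu]_t (slab A B z t)%:E) * (lap u (x + z))%:E))%E =
  (- 4 * pi ^+ 2 * (heat B u x - heat A u x))%:E.
Proof.
move=> su bu A0 AB.
have B0 : 0 < B := lt_trans A0 AB.
have sv := smooth_translate x su.
have bv := bounded_support_translate_left x bu.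
pose v z := u (x + z).
pose f z := lap v z.
have sf : smooth f := smooth_lap sv.
have bf : bounded_support f.
  by apply: bounded_support_sum => i; do 2 apply: bounded_support_partial.
have [Cv Cv0 vC] := bounded_support_bounded (Ck_continuous (sv 0%N)) bv.
have [Cf Cf0 fC] := bounded_support_bounded (Ck_continuous (sf 0%N)) bf.
have mv : measurable_fun setT v := continuous_measurable_rV4 (Ck_continuous (sv 0%N)).
have mf : measurable_fun setT f := continuous_measurable_rV4 (Ck_continuous (sf 0%N)).
have [M M0 vM] := bv; have [N N0 fN] := bf.
pose I := (`[A, B]%classic : set mR).
have mI : measurable I by exact: measurable_itv.
have mslab := measurable_slab A B.
pose Phi (p : 'rV[R]_4 * mR) := lap (gauss p.2) p.1 * \1_I p.2 * v p.1.
pose Psi (p : 'rV[R]_4 * mR) := slab A B p.1 p.2 * f p.1.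
have slab1 p : `|slab A B p.1 p.2| <= 1.
  rewrite ger0_norm ?slab_ge0//; apply: (le_trans (slab_le _ _ _ A0)).
  by rewrite indicE; case: (_ \in _).
have iPsi : (lam \x mu)%E.-integrable setT (EFin \o Psi).
  apply: (@integrable_slab Psi A B N Cf) => //.
  - by apply: measurable_funM => //; exact: measurableT_comp.
  - move=> p; rewrite normrM -[leRHS]mul1r; apply: ler_pM => //; exact: slab1.
  - by move=> z t /notin_cube/fN; rewrite /Psi /= => ->; rewrite mulr0.
  - move=> z t tI; rewrite /Psi /slab indicE (_ : t \in _ = false) ?mulr0 ?mul0r//.
    by apply/negbTE; apply: contra tI; rewrite inE.
(* A crude bound of [Phi] for [t <= B] and [z] in the cube, where [|z|^2 <= 4 M^2]; it only serves
   integrability. *)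
pose D := (4 * B ^+ 2 * (4 * M ^+ 2) + 8 * B) * Cv.
have iPhi : (lam \x mu)%E.-integrable setT (EFin \o Phi).
  apply: (@integrable_slab Phi A B M D) => //.
  - have mg := @measurable_gauss2 R.
    rewrite (_ : Phi = fun p => (4 * p.2 ^+ 2 * sqnorm p.1 - 8 * p.2) * gauss p.2 p.1 * \1_I p.2 * v p.1); last first.
      by apply/funext => p; rewrite /Phi lap_gauss.
    have m2 : measurable_fun setT (fun p : 'rV[R]_4 * mR => (p.2 : R)) by exact: measurable_snd.
    have m1 : measurable_fun setT (fun p : 'rV[R]_4 * mR => sqnorm p.1).
      by apply: measurableT_comp => //; exact: measurable_sqnorm.
    have mi : measurable_fun [set: mR] (\1_I : mR -> R) by exact: measurable_indic.
    apply: measurable_funM; last exact: measurableT_comp.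
    apply: measurable_funM; last first.
      by apply: (measurableT_comp mi); exact: measurable_snd.
    apply: measurable_funM => //.
    apply: measurable_funB; last exact: measurable_funM.
    apply: measurable_funM => //; apply: measurable_funM => //.
    exact: measurable_funX.
  - move=> [z t]; rewrite /Phi /=.
    have [zM|/notin_cube/vM zM] := pselect (cube M z); last first.
      by rewrite /v zM mulr0 normr0 /D !mulr_ge0// addr_ge0// !mulr_ge0 ?sqr_ge0// ltW.
    have [tI|tI] := boolP (t \in I); last first.
      by rewrite indicE (negbTE tI) mulr0 mul0r normr0 /D !mulr_ge0// addr_ge0// !mulr_ge0 ?sqr_ge0// ltW.
    move: (tI); rewrite inE /I /= in_itv/= => /andP[tA tB].
    have t0 : 0 <= t := ltW (lt_le_trans A0 tA).
    have sM : sqnorm z <= 4 * M ^+ 2.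
      rewrite /sqnorm (@le_trans _ _ (\sum_(i < 4) M ^+ 2))//; last first.
        by rewrite sumr_const card_ord mulr_natl.
      apply: ler_sum => i _; have := zM i; rewrite in_itv/= -ler_norml => zi.
      by rewrite -(real_normK (num_real _)) ler_sqr ?nnegrE// ltW.
    have s0 := sqnorm_ge0 z.
    rewrite indicE tI mulr1 normrM; apply: ler_pM => //; last exact: vC.
    rewrite lap_gauss normrM -[leRHS]mulr1; apply: ler_pM => //; last first.
      rewrite ger0_norm ?gauss_ge0// /gauss -expR0 ler_expR mulNr oppr_le0 mulr_ge0//.
    rewrite (le_trans (ler_normB _ _))// lerD//.
      rewrite ger0_norm ?mulr_ge0 ?sqr_ge0//.
      apply: ler_pM => //; first by rewrite mulr_ge0 ?sqr_ge0.
      by rewrite ler_wpM2l// ler_sqr ?nnegrE// ltW.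
    by rewrite ger0_norm ?mulr_ge0// ler_wpM2l.
  - by move=> z t /notin_cube/vM; rewrite /Phi /= /v => ->; rewrite mulr0.
  - move=> z t tI; rewrite /Phi /= indicE (_ : t \in I = false) ?mulr0 ?mul0r//.
    by apply/negbTE; apply: contra tI; rewrite inE.
have E1 z : (\int[mu]_t (Psi (z, t))%:E = (\int[mu]_t (slab A B z t)%:E) * (f z)%:E)%E.
  have iz := integrable_slab1 B z A0.
  under eq_integral do rewrite /Psi /= EFinM.
  by rewrite integralZr.
have E2 t : (\int[lam]_z (Psi (z, t))%:E = (\1_I t)%:E * \int[lam]_z (gauss t z * f z)%:E)%E.
  have ig : lam.-integrable setT (EFin \o (fun z => f z * gauss t z)).
    apply: integrable_mul_support => //; first exact: (Ck_continuous (sf 0%N)).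
    exact: (Ck_continuous (@smooth_gauss R t 0%N)).
  have ig' : lam.-integrable setT (fun z => (gauss t z * f z)%:E).
    by rewrite (_ : (fun _ => _) = EFin \o (fun z => f z * gauss t z))//; apply/funext => z; rewrite /= mulrC.
  rewrite -(integralZl measurableT ig').
  apply: eq_integral => z _; rewrite /Psi /slab /= -EFinM.
  by apply: congr1; move: (gauss t z) (f z) (\1_I t) => a b c; ring.
have E3 z : (\int[mu]_t (Phi (z, t))%:E = (- 4 * pi ^+ 2 * (heat_kernel B z - heat_kernel A z) * v z)%:E)%E.
  pose F (r : R) := r ^+ 2 * gauss r z * (- 4 * v z).
  pose F' (r : R) := - 4^-1 * lap (gauss r) z * (- 4 * v z).
  transitivity (\int[mu]_t ((F' t)%:E * (\1_I t)%:E))%E.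
    apply: eq_integral => t _; rewrite /Phi /F' /= -EFinM; apply: congr1.
    by move: (lap (gauss t) z) (v z) (\1_I t) => a b c; field.
  rewrite integral_mul_indic.
  have -> : (\int[mu]_(t in I) (F' t)%:E)%E = (F B - F A)%:E.
    apply: (@FTC2 R F F') => // t _.
      apply: (is_derive_eq (is_deriveM (is_derive_heat z t) (is_derive_cst (- 4 * v z) t 1))).
      by rewrite /GRing.scale/= mulr0 add0r mulrC.
    apply: (@continuousM _ _ (fun r : R => - 4^-1 * lap (gauss r) z) (cst (- 4 * v z)) t).
      exact: continuous_lap_gauss.
    exact: cst_continuous.
  apply: congr1; rewrite /F /heat_kernel; have := pi_neq0; move: (pi : R) => p p0.
  by move: (gauss A z) (gauss B z) (v z) => a b c; field.
have E4 t : (\int[lam]_z (Phi (z, t))%:E = \int[lam]_z (Psi (z, t))%:E)%E.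
  have G := Green (sv 2%N) (@smooth_gauss R t 2%N) bv.
  have ig : lam.-integrable setT (EFin \o (fun z => f z * gauss t z)).
    apply: integrable_mul_support => //; first exact: (Ck_continuous (sf 0%N)).
    exact: (Ck_continuous (@smooth_gauss R t 0%N)).
  have ig2 : lam.-integrable setT (EFin \o (fun z => v z * lap (gauss t) z)).
    apply: integrable_mul_support => //; first exact: (Ck_continuous (sv 0%N)).
    exact: (Ck_continuous (smooth_lap (@smooth_gauss R t) 0%N)).
  have e : (\int[lam]_z (gauss t z * f z)%:E = \int[lam]_z (v z * lap (gauss t) z)%:E)%E.
    transitivity ((\int[lam]_z (f z * gauss t z))%:E).
      rewrite /Rintegral fineK; first by apply: eq_integral => z _; rewrite mulrC.
      exact: integrable_fin_num.
    rewrite G /Rintegral fineK//; exact: integrable_fin_num.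
  rewrite E2 e -(integralZl measurableT ig2).
  apply: eq_integral => z _; rewrite /Phi /= -EFinM.
  by apply: congr1; move: (lap (gauss t) z) (v z) (\1_I t) => a b c; ring.
transitivity (\int[lam]_z \int[mu]_t (Psi (z, t))%:E)%E.
  by apply: eq_integral => z _; rewrite E1 /f /v lap_translate.
(* [Psi] is integrated in [z] first, where it can be exchanged for [Phi], and then [Phi] in [t]
   first. *)
rewrite (Fubini iPsi) /=.
have -> : (\int[mu]_t \int[lam]_z (Psi (z, t))%:E = \int[mu]_t \int[lam]_z (Phi (z, t))%:E)%E.
  by apply: eq_integral => t _; rewrite E4.
rewrite -(Fubini iPhi)/=.
under eq_integral do rewrite E3.
have iheat C : lam.-integrable setT (EFin \o (fun z => heat_kernel C z * v z)).
  have := integrable_mul_support (Ck_continuous (sv 0%N)) (Ck_continuous (@smooth_heat_kernel C 0%N)) bv.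
  by congr (_.-integrable _ _); apply/funext => z /=; rewrite mulrC.
have iBA := integrableB measurableT (iheat B) (iheat A).
transitivity (\int[lam]_z ((- 4 * pi ^+ 2)%:E * (heat_kernel B z * v z - heat_kernel A z * v z)%:E))%E.
  apply: eq_integral => z _; rewrite -EFinM; apply: congr1.
  by move: (heat_kernel A z) (heat_kernel B z) (v z) (pi : R) => a b c d; ring.
rewrite (integralZl measurableT iBA) [in RHS]EFinM; apply: congr1.
rewrite (integralB measurableT (iheat B) (iheat A)) EFinB /heat /Rintegral !fineK//.
- exact: (integrable_fin_num measurableT (iheat A)).
- exact: (integrable_fin_num measurableT (iheat B)).
Qed.

Lemma integral_translate_left (f : 'rV[R]_4 -> \bar R) x : measurable_fun setT f ->
  (\int[lam]_z f (x + z)%R = \int[lam]_z f z)%E.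
Proof.
move=> mf; rewrite -(preserves_integral (preserves_translate x) mf).
by apply: eq_integral => z _; rewrite (addrC x z).
Qed.

Lemma sqrt_rescale (p l : R) : 0 < p -> 0 < l ->
  (4 * p ^+ 2)^-1 * Num.sqrt (p ^+ 2 * l) = Num.sqrt (l / (16 * p ^+ 2)).
Proof.
move=> p0 l0; have c0 : 0 <= (4 * p ^+ 2)^-1 by rewrite invr_ge0 mulr_ge0 ?sqr_ge0.
rewrite -[X in X * _](ger0_norm c0) -sqrtr_sqr -sqrtrM ?sqr_ge0//.
by congr Num.sqrt; field; rewrite gt_eqF.
Qed.

(** Cauchy-Schwarz against the energy: the square integral [pi^2 ln (B / A)] divided by [(4 pi^2)^2]
    gives the denominator [16 pi^2], half the critical exponent. *)
Lemma heat_difference_le u x A B : smooth u -> bounded_support u ->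
  \int[lam]_z (lap u z ^+ 2) <= 1 -> 0 < A -> A < B ->
  `|heat B u x - heat A u x| <= Num.sqrt (ln (B / A) / (16 * pi ^+ 2)).
Proof.
move=> su bu E1 A0 AB.
have l0 : 0 < ln (B / A) by rewrite ln_gt0// ltr_pdivlMr// mul1r.
have p2 : 0 < pi ^+ 2 :> R by rewrite exprn_gt0// pi_gt0.
have sl := smooth_lap su.
have bl : bounded_support (lap u).
  by apply: bounded_support_sum => i; do 2 apply: bounded_support_partial.
have cl := Ck_continuous (sl 0%N).
pose K z := (\int[mu]_t (slab A B z t)%:E)%E.
have K0 z : (0 <= K z)%E by apply: integral_ge0 => t _; rewrite lee_fin slab_ge0.
have Kfin z : K z \is a fin_num by apply: integrable_fin_num => //; exact: integrable_slab1.
have mK' : measurable_fun setT K.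
  apply: (measurable_fun_fubini_tonelli_F (fun p : 'rV[R]_4 * mR => (slab A B p.1 p.2)%:E)).
  + by apply/measurable_EFinP; exact: measurable_slab.
  + by move=> p; rewrite lee_fin slab_ge0.
have mK : measurable_fun setT (fine \o K).
  by apply: measurableT_comp.
have mlt : measurable_fun setT (fun z => lap u (x + z)).
  exact: (continuous_measurable_rV4 (Ck_continuous (smooth_translate x sl 0%N))).
have h1 : (\int[lam]_z (fine (K z) ^+ 2)%:E <= (pi ^+ 2 * ln (B / A))%:E)%E.
  apply: le_trans (integral_slab_sqr A0 AB).
  apply: ge0_le_integral => //.
  - by move=> z _; rewrite lee_fin sqr_ge0.
  - by apply/measurable_EFinP; exact: measurable_funX.
  - exact: emeasurable_funM.
  - by move=> z _; rewrite expr2 EFinM fineK.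
have h2 : (\int[lam]_z (lap u (x + z) ^+ 2)%:E <= 1%:E)%E.
  have m2 : measurable_fun setT (fun z => (lap u z ^+ 2)%:E).
    by apply/measurable_EFinP; apply: measurable_funX; exact: continuous_measurable_rV4.
  rewrite (integral_translate_left x m2).
  move: E1; rewrite -lee_fin /Rintegral fineK//.
  apply: integrable_fin_num => //.
  by have := integrable_mul_support cl cl bl; under eq_fun do rewrite -expr2.
have h3 := integral_Cauchy_Schwarz mK mlt (mulr_gt0 p2 l0) ltr01 h1 h2.
have h4 := heat_difference x su bu A0 AB.
have : (`| (- 4 * pi ^+ 2 * (heat B u x - heat A u x))%:E | <=
   (Num.sqrt (pi ^+ 2 * ln (B / A) * 1))%:E)%E.
  rewrite -h4; apply: le_trans h3.
  apply: (le_trans (le_abse_integral _ _ _)) => //.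
    by apply: emeasurable_funM => //; exact/measurable_EFinP.
  apply: ge0_le_integral => //.
  - by apply: measurableT_comp => //; apply: emeasurable_funM => //; exact/measurable_EFinP.
  - by apply/measurable_EFinP; apply: measurableT_comp => //; exact: measurable_funM.
  - by move=> z _; rewrite -/(K z) -{1}(fineK (Kfin z)) -EFinM /= lee_fin.
rewrite /= lee_fin mulr1 normrM => h5.
have n4 : `|- 4 * pi ^+ 2 : R| = 4 * pi ^+ 2 by rewrite mulNr normrN ger0_norm// mulr_ge0// ltW.
have c4 : 0 < 4 * pi ^+ 2 :> R by apply: mulr_gt0.
move: h5; rewrite n4 mulrC -ler_pdivlMr// => /le_trans; apply.
by rewrite mulrC sqrt_rescale// pi_gt0.
Qed.

End heat.

Section monotone.
Import HBNNSimple.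
Context d (T : measurableType d) (R : realType).
Variable m : {measure set T -> \bar R}.
Local Open Scope ereal_scope.

(* The library's [ge0_le_integral] also asks for measurability. *)
Lemma ge0_le_integral_any (f g : T -> \bar R) : (forall x, 0 <= f x) ->
  (forall x, f x <= g x) -> \int[m]_x f x <= \int[m]_x g x.
Proof.
move=> f0 fg; have g0 x : 0 <= g x := le_trans (f0 x) (fg x).
rewrite !ge0_integralTE//; apply: ereal_sup_le => /= _ [h hf <-].
by exists h => // x; exact: le_trans (hf x) (fg x).
Qed.

(** Jensen's inequality for a density of mass at most 1: integrate [2 c |f| <= f^2 + c^2] against
    [p] and take for [c] the integral itself, which the case [c = 1] shows to be finite. *)
Lemma sqr_integral_le (p f : T -> R) : measurable_fun setT p -> measurable_fun setT f ->
  (forall x, 0 <= p x)%R -> \int[m]_x (p x)%:E <= 1 ->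
  (\int[m]_x (p x * `|f x|)%:E) * (\int[m]_x (p x * `|f x|)%:E) <=
  \int[m]_x (p x * f x ^+ 2)%:E.
Proof.
move=> mp mf p0 p1.
have mf' : measurable_fun setT (fun x => `|f x|)%R by exact: measurableT_comp.
have mpf : measurable_fun setT (fun x => (p x * `|f x|)%:E).
  by apply/measurable_EFinP; exact: measurable_funM.
have mpf2 : measurable_fun setT (fun x => (p x * f x ^+ 2)%:E).
  by apply/measurable_EFinP; apply: measurable_funM => //; exact: measurable_funX.
have mpE : measurable_fun setT (fun x => (p x)%:E) by exact/measurable_EFinP.
set I := \int[m]_x (p x * `|f x|)%:E; set J := \int[m]_x _.
have I0 : 0 <= I by apply: integral_ge0 => x _; rewrite lee_fin mulr_ge0.
have J0 : 0 <= J by apply: integral_ge0 => x _; rewrite lee_fin mulr_ge0 ?sqr_ge0.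
have key (c : R) : (0 <= c)%R -> (2 * c)%:E * I <= J + (c ^+ 2)%:E.
  move=> c0.
  have -> : (2 * c)%:E * I = \int[m]_x ((2 * c)%:E * (p x * `|f x|)%:E).
    rewrite ge0_integralZl//; last by rewrite lee_fin mulr_ge0.
    by move=> x _; rewrite lee_fin mulr_ge0.
  apply: (@le_trans _ _ (\int[m]_x ((p x * f x ^+ 2)%:E + (c ^+ 2)%:E * (p x)%:E))).
    apply: ge0_le_integral_any => x; first by rewrite -EFinM lee_fin !mulr_ge0.
    rewrite -!EFinM -EFinD lee_fin -(real_normK (num_real (f x))).
    move: (`|f x|)%R (p0 x) => a; move: (p x) => b b0.
    rewrite -subr_ge0 [X in (0 <= X)%R](_ : _ = b * (a - c) ^+ 2)%R; last by ring.
    by rewrite mulr_ge0 ?sqr_ge0.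
  rewrite ge0_integralD//; last 3 first.
  - by move=> x _; rewrite lee_fin mulr_ge0 ?sqr_ge0.
  - by move=> x _; rewrite -EFinM lee_fin mulr_ge0 ?sqr_ge0.
  - by apply: emeasurable_funM => //; exact: measurable_cst.
  apply: leeD => //; rewrite ge0_integralZl// ?lee_fin ?sqr_ge0//; last by move=> x _; rewrite lee_fin.
  by rewrite -[leRHS]mule1; apply: lee_wpmul2l => //; rewrite lee_fin sqr_ge0.
have [->|Jfin] := eqVneq J +oo; first exact: leey.
have Jf : J \is a fin_num by rewrite ge0_fin_numE// ltey.
have If : I \is a fin_num.
  rewrite ge0_fin_numE//; apply: (@le_lt_trans _ _ (J + 1)).
    apply: le_trans (_ : (2 * 1)%:E * I <= _); last first.
      by have := key 1%R ler01; rewrite expr1n.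
    by rewrite mulr1 -[leLHS]mul1e; apply: lee_wpmul2r => //; rewrite lee_fin ler1n.
  by rewrite -(fineK Jf) -EFinD ltry.
have := key (fine I) (fine_ge0 I0).
rewrite -(fineK If) -(fineK Jf) -!EFinM -EFinD !lee_fin /=.
by move: (fine I) (fine J) => a b; lra.
Qed.

End monotone.

(** * Weighted convolution estimates *)

Section kernel_estimates.
Variable R : realType.
Implicit Types (u k : 'rV[R]_4 -> R) (x z : 'rV[R]_4).
Local Notation lam := (@lebesgue_rV4 R).

Definition dotp x z := \sum_(i < 4) x ord0 i * z ord0 i.

Lemma sqnormD x z : sqnorm (x + z) = sqnorm x + 2 * dotp x z + sqnorm z.
Proof.
rewrite /sqnorm /dotp mulr_sumr -!big_split/=; apply: eq_bigr => i _.
by rewrite mxE; ring.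
Qed.

(** Lagrange's identity: the difference is the sum of the squared 2 by 2 minors. *)
Lemma dotp_sqr_le x z : dotp x z ^+ 2 <= sqnorm x * sqnorm z.
Proof.
rewrite /dotp /sqnorm !sum_ord4 -subr_ge0.
set a := x _ _; set b := x _ _; set c := x _ _; set e := x _ _.
set a' := z _ _; set b' := z _ _; set c' := z _ _; set e' := z _ _.
rewrite [X in 0 <= X](_ : _ = (a * b' - b * a') ^+ 2 + (a * c' - c * a') ^+ 2 +
  (a * e' - e * a') ^+ 2 + (b * c' - c * b') ^+ 2 + (b * e' - e * b') ^+ 2 +
  (c * e' - e * c') ^+ 2); last by ring.
by rewrite !addr_ge0 ?sqr_ge0.
Qed.

Lemma dotp_ball x z : B4 x -> dotp x z ^+ 2 <= sqnorm z.
Proof.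
move=> Bx; apply: (le_trans (dotp_sqr_le x z)).
by rewrite -[leRHS]mul1r ler_wpM2r ?sqnorm_ge0// ltW.
Qed.

Lemma WD x z : W (x + z) = W x - 2 * dotp x z - sqnorm z.
Proof. by rewrite /W sqnormD; ring. Qed.

Lemma quartic_sum (a b : R) : (a + b) ^+ 4 <= 8 * a ^+ 4 + 8 * b ^+ 4.
Proof.
rewrite -subr_ge0 [X in 0 <= X](_ : _ = (a - b) ^+ 2 * (7 * a ^+ 2 + 10 * a * b + 7 * b ^+ 2)); last by ring.
rewrite mulr_ge0 ?sqr_ge0//.
rewrite [X in 0 <= X](_ : _ = 5 * (a + b) ^+ 2 + 2 * a ^+ 2 + 2 * b ^+ 2); last by ring.
have := (sqr_ge0 (a + b), sqr_ge0 a, sqr_ge0 b); case=> -[h1 h2] h3; lra.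
Qed.

(** On the ball, [W (x + z) <= W x + 2 |z|]. The maximum with 0 is needed because far from the ball
    [W] is negative with a large fourth power. *)
Lemma W_translate_quartic x z : B4 x ->
  Num.max 0 (W (x + z)) ^+ 4 <= 8 * W x ^+ 4 + 128 * sqnorm z ^+ 2.
Proof.
move=> Bx; have d2 := dotp_ball z Bx; have s0 := sqnorm_ge0 z.
have Wx : 0 < W x by rewrite -W_gt0.
have h : Num.max 0 (W (x + z)) <= W x + 2 * `|dotp x z|.
  have := ler_norm (- dotp x z); rewrite normrN => hn.
  rewrite ge_max; apply/andP; split; first by rewrite addr_ge0 ?mulr_ge0// ltW.
  by rewrite WD; lra.
apply: (@le_trans _ _ ((W x + 2 * `|dotp x z|) ^+ 4)).
  have n0 : 0 <= W x + 2 * `|dotp x z| by rewrite addr_ge0 ?mulr_ge0// ltW.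
  have m0 : 0 <= Num.max 0 (W (x + z)) by rewrite le_max lexx.
  by rewrite ler_pXn2r.
apply: (le_trans (quartic_sum _ _)); rewrite lerD2l.
rewrite (_ : 8 * _ = 128 * (`|dotp x z| ^+ 2) ^+ 2); last by ring.
rewrite real_normK ?num_real// ler_wpM2l// ler_sqr ?nnegrE//; exact: sqr_ge0.
Qed.

Lemma hyp_sqrE u : Cinf_c u ->
  (\int[lam]_z ((u z / W z ^+ 2) ^+ 2)%:E = (hyp_sqr u / 16)%:E)%E.
Proof.
move=> cu; have cu0 := Ck_continuous (Cinf_c_smooth cu 0%N).
have iw : lam.-integrable setT (EFin \o (fun x => u x ^+ 2 * (W x ^+ 4)^-1)).
  apply: (integrable_weight 4 cu).
    by move=> x; apply: (@continuousM _ _ u u x); exact: cu0.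
  by move=> x ->; rewrite expr0n.
have E : hyp_sqr u = 16 * \int[lam]_x (u x ^+ 2 * (W x ^+ 4)^-1).
  rewrite -RintegralZl//; apply: eq_Rintegral => x _.
  by rewrite expr_div_n; ring.
rewrite E mulrC mulKf//; rewrite /Rintegral fineK; last exact: integrable_fin_num.
by apply: eq_integral => x _; rewrite expr_div_n -exprM.
Qed.

(** Cauchy-Schwarz after inserting [W (x + z)^2] and its inverse: the factor [u / W^2] has squared
    norm [hyp_sqr u / 16], and the weight left on [k] is estimated from [W x] and [|z|]. *)
Lemma convolution_bound u k x M Q : Cinf_c u -> measurable_fun setT k -> B4 x ->
  0 < M -> 0 < Q -> hyp_sqr u <= Q ->
  (\int[lam]_z (k z ^+ 2 * (8 * W x ^+ 4 + 128 * sqnorm z ^+ 2))%:E <= M%:E)%E ->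
  (\int[lam]_z (`|k z * u (x + z)|)%:E <= (Num.sqrt (M * (Q / 16)))%:E)%E.
Proof.
move=> cu mk Bx M0 Q0 uQ kM.
have mu0 := continuous_measurable_rV4 (Ck_continuous (Cinf_c_smooth cu 0%N)).
have mW : measurable_fun setT (@W R) by apply: measurable_funB => //; exact: measurable_sqnorm.
have [mt _] := preserves_translate x.
have mt' : measurable_fun setT (fun z => x + z).
  by rewrite (_ : (fun z => x + z) = (fun z => z + x))//; apply/funext => z; rewrite addrC.
pose a z := k z * Num.max 0 (W (x + z)) ^+ 2.
pose b z := u (x + z) / W (x + z) ^+ 2.
have mWx : measurable_fun setT (fun z => W (x + z)) by exact: (measurableT_comp mW mt').
have mux : measurable_fun setT (fun z => u (x + z)) by exact: (measurableT_comp mu0 mt').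
have ma : measurable_fun setT a.
  apply: measurable_funM => //; apply: measurable_funX; exact: measurable_maxr.
have mb : measurable_fun setT b.
  apply: measurable_funM => //.
  by apply: (measurableT_comp (@measurable_invr R)); exact: measurable_funX.
rewrite (_ : (fun z => (`|k z * u (x + z)|)%:E) = (fun z => (`|a z * b z|)%:E)); last first.
  apply/funext => z; congr (`|_|)%:E; rewrite /a /b.
  have [Bz|nBz] := pselect (B4 (x + z)); last first.
    by rewrite (Cinf_c_out cu nBz) mul0r !mulr0.
  move: Bz; rewrite W_gt0 => Wz; rewrite max_r ?ltW//.
  by field; rewrite gt_eqF.
apply: integral_Cauchy_Schwarz => //; first by rewrite divr_gt0.
- apply: le_trans kM; apply: ge0_le_integral_any => z; rewrite lee_fin ?sqr_ge0//.
  by rewrite /a exprMn -exprM ler_wpM2l ?sqr_ge0// W_translate_quartic.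
- rewrite (integral_translate_left (f := fun z => ((u z / W z ^+ 2) ^+ 2)%:E) x).
    by rewrite hyp_sqrE// lee_fin ler_wpM2r// invr_ge0.
  apply/measurable_EFinP; apply: measurable_funX; apply: measurable_funM => //.
  by apply: (measurableT_comp (@measurable_invr R)); exact: measurable_funX.
Qed.

Lemma measurable_heat_kernel t : measurable_fun setT (@heat_kernel R t).
Proof. by apply: measurable_funM => //; exact: measurable_gauss. Qed.

Lemma integralZ_gauss (c t : R) : 0 <= c -> 0 < t ->
  (\int[lam]_z (c * gauss t z)%:E = (c * (pi ^+ 2 / t ^+ 2))%:E)%E.
Proof.
move=> c0 t0; under eq_integral do rewrite EFinM.
rewrite ge0_integralZl//; last 2 first.
- by apply/measurable_EFinP; exact: measurable_gauss.
- by move=> z _; rewrite lee_fin gauss_ge0.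
by rewrite integral_gauss.
Qed.

Lemma heat_kernel_sqr t z : heat_kernel t z ^+ 2 = t ^+ 4 / pi ^+ 4 * gauss (2 * t) z.
Proof.
rewrite /heat_kernel /gauss (_ : - (2 * t) * sqnorm z = - t * sqnorm z + - t * sqnorm z); last by ring.
by rewrite expRD -expr2 exprMn expr_div_n -!exprM.
Qed.

Lemma integral_heat_kernel_sqr t : 0 < t ->
  (\int[lam]_z (heat_kernel t z ^+ 2)%:E = (t ^+ 2 / (4 * pi ^+ 2))%:E)%E.
Proof.
move=> t0; under eq_integral do rewrite heat_kernel_sqr.
rewrite integralZ_gauss ?mulr_gt0//; last first.
  by rewrite divr_ge0// exprn_even_ge0.
congr EFin; have := @pi_neq0 R; move: (pi : R) => p p0; field.
by rewrite p0 gt_eqF.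
Qed.

(** The bound does not depend on [t]: in dimension 4 the square of the kernel times [|z|^4] is scale
    invariant. Contributions of this moment are therefore constants at every scale. *)
Lemma heat_kernel_sqr_moment t : 0 < t ->
  (\int[lam]_z (heat_kernel t z ^+ 2 * sqnorm z ^+ 2)%:E <= (4 / pi ^+ 2)%:E)%E.
Proof.
move=> t0; have p0 := @pi_neq0 R.
apply: (@le_trans _ _ (\int[lam]_z (t ^+ 4 / pi ^+ 4 * (16 / (2 * t) ^+ 2) * gauss t z)%:E)%E).
  apply: ge0_le_integral_any => z; first by rewrite lee_fin mulr_ge0 ?sqr_ge0.
  have := gauss_moment2 z (mulr_gt0 (ltr0n R 2 : 0 < 2) t0).
  rewrite (_ : 2 * t / 2 = t); last by field.
  move=> h; rewrite lee_fin heat_kernel_sqr.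
  rewrite [leLHS](_ : _ = t ^+ 4 / pi ^+ 4 * (sqnorm z ^+ 2 * gauss (2 * t) z)); last by ring.
  by rewrite -[leRHS]mulrA ler_wpM2l// divr_ge0// exprn_even_ge0.
rewrite integralZ_gauss//; last first.
  by rewrite mulr_ge0// divr_ge0// ?exprn_even_ge0.
rewrite lee_fin le_eqVlt; apply/orP; left; apply/eqP.
move: (pi : R) p0 => p p0; field.
by rewrite p0 gt_eqF.
Qed.

Lemma heat_kernel_moment t : 0 < t ->
  (\int[lam]_z (heat_kernel t z * sqnorm z)%:E <= (8 / t)%:E)%E.
Proof.
move=> t0; have p0 := @pi_neq0 R.
apply: (@le_trans _ _ (\int[lam]_z (t ^+ 2 / pi ^+ 2 * (2 / t) * gauss (t / 2) z)%:E)%E).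
  apply: ge0_le_integral_any => z.
    by rewrite lee_fin mulr_ge0 ?heat_kernel_ge0 ?sqnorm_ge0.
  rewrite lee_fin /heat_kernel -[leLHS]mulrA -[leRHS]mulrA ler_wpM2l//.
    by rewrite divr_ge0 ?sqr_ge0.
  by rewrite mulrC gauss_moment1.
rewrite integralZ_gauss ?divr_gt0//; last first.
  by rewrite mulr_ge0// divr_ge0 ?sqr_ge0// ltW.
rewrite lee_fin le_eqVlt; apply/orP; left; apply/eqP.
move: (pi : R) p0 => p p0; field.
by rewrite p0 gt_eqF.
Qed.

End kernel_estimates.

(** * Local oscillation *)

Section local_average.
Variable R : realType.
Implicit Types (u f : 'rV[R]_4 -> R) (x z : 'rV[R]_4).
Local Notation lam := (@lebesgue_rV4 R).

(** Cut-off to [|z| <= W x / 4], the Euclidean size of a hyperbolic ball about [x]. There [W] at the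
    translated points is comparable with [W x], and the condition is even in each coordinate of
    [z]. *)
Definition near_center x z : R := (16 * sqnorm z <= W x ^+ 2)%R%:R.

Lemma near_center_ge0 x z : 0 <= near_center x z.
Proof. exact: ler0n. Qed.

Lemma near_center_le1 x z : near_center x z <= 1.
Proof. by rewrite /near_center lern1 leq_b1. Qed.

Lemma near_center_normr x z : `|near_center x z| <= 1.
Proof. by rewrite ger0_norm ?near_center_ge0// near_center_le1. Qed.

Lemma far_center_ge0 x z : 0 <= 1 - near_center x z.
Proof. by rewrite subr_ge0 near_center_le1. Qed.

Lemma near_centerP x z : near_center x z = 0 \/
  (near_center x z = 1 /\ 16 * sqnorm z <= W x ^+ 2).
Proof. by rewrite /near_center; case: (boolP (_ <= _)); [right|left]. Qed.

Lemma measurable_near_center x : measurable_fun setT (near_center x).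
Proof.
have mA : measurable [set z : 'rV[R]_4 | 16 * sqnorm z <= W x ^+ 2].
  rewrite [X in measurable X](_ : _ = [set: 'rV[R]_4] `&` (fun z => 16 * sqnorm z) @^-1` `]-oo, W x ^+ 2]).
    have mf : measurable_fun setT (fun z : 'rV[R]_4 => 16 * sqnorm z).
      by apply: measurable_funM => //; exact: measurable_sqnorm.
    exact: mf.
  by apply/seteqP; split=> z /=; rewrite in_itv/= => // -[].
rewrite (_ : near_center x = \1_[set z : 'rV[R]_4 | 16 * sqnorm z <= W x ^+ 2]).
  exact: measurable_indic.
by apply/funext => z; rewrite /near_center indicE mem_setE.
Qed.

Lemma far_center_le x z : B4 x -> 1 - near_center x z <= 16 * sqnorm z / W x ^+ 2.
Proof.
rewrite W_gt0 => Wx; have s0 := sqnorm_ge0 z.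
rewrite /near_center; case: (leP (16 * sqnorm z) (W x ^+ 2)) => h.
  by rewrite subrr divr_ge0 ?sqr_ge0// mulr_ge0.
by rewrite (_ : 1 - _ = 1) ?subr0// ler_pdivlMr ?exprn_gt0// mul1r ltW.
Qed.

Lemma integrable_heat_kernelM t f C : 0 < t -> measurable_fun setT f ->
  (forall z, `|f z| <= C) -> lam.-integrable setT (EFin \o (fun z => heat_kernel t z * f z)).
Proof.
move=> t0 mf fC; have mk := @measurable_heat_kernel R t.
have C0 : 0 <= C := le_trans (normr_ge0 _) (fC 0).
apply/integrableP; split.
  by apply/measurable_EFinP; exact: measurable_funM.
apply: (@le_lt_trans _ _ (\int[lam]_z (C%:E * (heat_kernel t z)%:E))%E).
  apply: ge0_le_integral_any => z //.
  rewrite /= -EFinM lee_fin normrM ger0_norm ?heat_kernel_ge0// mulrC.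
  by rewrite ler_wpM2r ?heat_kernel_ge0.
rewrite ge0_integralZl//; last 2 first.
- by apply/measurable_EFinP.
- by move=> z _; rewrite lee_fin heat_kernel_ge0.
by rewrite integral_heat_kernel// mule1 ltry.
Qed.

Lemma normr_Rintegral_le f C : lam.-integrable setT (EFin \o f) ->
  (\int[lam]_z (`|f z|)%:E <= C%:E)%E -> `|\int[lam]_z f z| <= C.
Proof.
move=> intf fC; rewrite -lee_fin; apply: le_trans fC.
have := le_normr_Rintegral measurableT intf.
rewrite -lee_fin /Rintegral [in X in (_ <= X)%E -> _]fineK//.
exact: (integrable_fin_num measurableT (integrable_norm intf)).
Qed.

Lemma far_mass x t : B4 x -> 0 < t ->
  \int[lam]_z (heat_kernel t z * (1 - near_center x z)) <= 128 / (t * W x ^+ 2).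
Proof.
move=> Bx t0; have Wx : 0 < W x by rewrite -W_gt0.
have mn := measurable_near_center x.
have ms := @measurable_sqnorm R.
have mk := @measurable_heat_kernel R t.
have ik : lam.-integrable setT (EFin \o (fun z => heat_kernel t z * (1 - near_center x z))).
  apply: (@integrable_heat_kernelM _ _ 1) => //; first exact: measurable_funB.
  by move=> z; rewrite ger0_norm ?far_center_ge0// gerBl near_center_ge0.
rewrite -lee_fin /Rintegral fineK; last exact: integrable_fin_num.
apply: (@le_trans _ _ (\int[lam]_z ((16 / W x ^+ 2)%:E * (heat_kernel t z * sqnorm z)%:E))%E).
  apply: ge0_le_integral_any => z.
    by rewrite lee_fin mulr_ge0 ?heat_kernel_ge0 ?far_center_ge0.
  rewrite -EFinM lee_fin mulrCA ler_wpM2l ?heat_kernel_ge0//.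
  by apply: (le_trans (far_center_le z Bx)); rewrite mulrAC.
rewrite ge0_integralZl//; last 3 first.
- by apply/measurable_EFinP; exact: measurable_funM.
- by move=> z _; rewrite lee_fin mulr_ge0 ?heat_kernel_ge0 ?sqnorm_ge0.
- by rewrite lee_fin divr_ge0 ?sqr_ge0.
apply: (@le_trans _ _ ((16 / W x ^+ 2)%:E * (8 / t)%:E)%E).
  by apply: lee_wpmul2l; [rewrite lee_fin divr_ge0 ?sqr_ge0|exact: heat_kernel_moment].
rewrite -EFinM lee_fin le_eqVlt; apply/orP; left; apply/eqP; field.
by rewrite !gt_eqF.
Qed.

Lemma far_convolution u x t Q : Cinf_c u -> B4 x -> 0 < t -> 0 < Q -> hyp_sqr u <= Q ->
  (\int[lam]_z (`|heat_kernel t z * (1 - near_center x z) * u (x + z)|)%:E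
    <= (Num.sqrt (2 ^+ 14 / pi ^+ 2 * (Q / 16)))%:E)%E.
Proof.
move=> cu Bx t0 Q0 uQ.
have mn := measurable_near_center x.
have ms := @measurable_sqnorm R.
have mk := @measurable_heat_kernel R t.
have Wx : 0 < W x by rewrite -W_gt0.
have p0 : 0 < pi ^+ 2 :> R by rewrite exprn_gt0// pi_gt0.
have mk1 : measurable_fun setT (fun z => heat_kernel t z * (1 - near_center x z)).
  by apply: measurable_funM => //; exact: measurable_funB.
have M0 : 0 < 2 ^+ 14 / pi ^+ 2 :> R by apply: divr_gt0 => //; exact: exprn_gt0.
apply: (convolution_bound cu mk1 Bx M0 Q0 uQ).
(* Away from the centre [W^4 < 256 |z|^4], so the weight is at most [(8 * 256 + 128) |z|^4], below
   [2^12 |z|^4]. *)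
apply: (@le_trans _ _ (\int[lam]_z ((2 ^+ 12)%:E * (heat_kernel t z ^+ 2 * sqnorm z ^+ 2)%:E))%E).
  apply: ge0_le_integral_any => z.
    by rewrite lee_fin mulr_ge0 ?sqr_ge0// addr_ge0// mulr_ge0// ?sqr_ge0// exprn_even_ge0.
  rewrite -EFinM lee_fin exprMn -[leLHS]mulrA [leRHS]mulrCA ler_wpM2l ?sqr_ge0//.
  have s2 : 0 <= sqnorm z ^+ 2 by rewrite sqr_ge0.
  have s0 := sqnorm_ge0 z.
  rewrite /near_center; case: (leP (16 * sqnorm z) (W x ^+ 2)) => h.
    by rewrite (_ : 1 - _ = 0) ?subrr// expr0n mul0r mulr_ge0// exprn_ge0.
  rewrite (_ : 1 - _ = 1) ?subr0// expr1n mul1r.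
  have : W x ^+ 4 <= (16 * sqnorm z) ^+ 2.
    rewrite (_ : W x ^+ 4 = (W x ^+ 2) ^+ 2); last by rewrite -exprM.
    by rewrite ler_sqr ?nnegrE ?sqr_ge0 ?mulr_ge0// ltW.
  rewrite exprMn (_ : 16 ^+ 2 = 256); last by ring.
  rewrite (_ : 2 ^+ 12 = 4096); last by ring.
  by move: (W x ^+ 4) (sqnorm z ^+ 2) s2 => a b b0; lra.
rewrite ge0_integralZl//; last 2 first.
- by apply/measurable_EFinP; apply: measurable_funM; exact: measurable_funX.
- by move=> z _; rewrite lee_fin mulr_ge0 ?sqr_ge0.
apply: (@le_trans _ _ ((2 ^+ 12)%:E * (4 / pi ^+ 2)%:E)%E).
  by apply: lee_wpmul2l; [rewrite lee_fin exprn_ge0|exact: heat_kernel_sqr_moment].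
by rewrite -EFinM lee_fin mulrA (_ : 2 ^+ 12 * 4 = 2 ^+ 14)//; ring.
Qed.

Lemma heat_bound_gt0 (a p : R) : 0 < p -> 0 < (2 * a ^+ 2 + 2 ^+ 9) / p.
Proof.
move=> p0; apply: divr_gt0 (p0); apply: ltr_wpDl; last by apply: exprn_gt0; rewrite ltr0n.
by apply: mulr_ge0; [rewrite ler0n|exact: sqr_ge0].
Qed.

(** The term in [W x ^+ 2 * t] comes from the mass of the squared kernel and the constant [2^9] from
    its scale invariant moment. At times proportional to [W^-2] the bound is thus uniform in [x]. *)
Lemma heat_bound u x t Q : Cinf_c u -> B4 x -> 0 < t -> 0 < Q -> hyp_sqr u <= Q ->
  `|heat t u x| <= Num.sqrt ((2 * (W x ^+ 2 * t) ^+ 2 + 2 ^+ 9) / pi ^+ 2 * (Q / 16)).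
Proof.
move=> cu Bx t0 Q0 uQ.
have mk := @measurable_heat_kernel R t.
have ms := @measurable_sqnorm R.
have su := Cinf_c_smooth cu; have bu := Cinf_c_bounded_support cu.
have p0 : 0 < pi ^+ 2 :> R by rewrite exprn_gt0// pi_gt0.
have W4 : 0 <= W x ^+ 4 by rewrite exprn_even_ge0.
have ik : lam.-integrable setT (EFin \o (fun z => heat_kernel t z * u (x + z))).
  have cv := Ck_continuous (smooth_translate x su 0%N).
  have := integrable_mul_support cv (Ck_continuous (@smooth_heat_kernel R t 0%N)) (bounded_support_translate_left x bu).
  by rewrite (_ : (fun z => u (x + z) * _) = (fun z => heat_kernel t z * u (x + z)))//; apply/funext => z; rewrite mulrC.
have M0 : 0 < (2 * (W x ^+ 2 * t) ^+ 2 + 2 ^+ 9) / pi ^+ 2.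
  exact: heat_bound_gt0.
apply: (normr_Rintegral_le ik).
apply: (convolution_bound cu mk Bx M0 Q0 uQ).
under eq_integral do rewrite mulrDr EFinD.
rewrite ge0_integralD//; last 4 first.
- by move=> z _; rewrite lee_fin mulr_ge0 ?sqr_ge0// mulr_ge0.
- by apply/measurable_EFinP; apply: measurable_funM => //; exact: measurable_funX.
- by move=> z _; rewrite lee_fin mulr_ge0 ?sqr_ge0// mulr_ge0 ?sqr_ge0.
- by apply/measurable_EFinP; apply: measurable_funM; [exact: measurable_funX|apply: measurable_funM => //; exact: measurable_funX].
have E1 : (\int[lam]_z (heat_kernel t z ^+ 2 * (8 * W x ^+ 4))%:E = (t ^+ 2 / (4 * pi ^+ 2) * (8 * W x ^+ 4))%:E)%E.
  under eq_integral do rewrite mulrC EFinM.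
  rewrite ge0_integralZl//; last 3 first.
  - by apply/measurable_EFinP; exact: measurable_funX.
  - by move=> z _; rewrite lee_fin sqr_ge0.
  - by rewrite lee_fin mulr_ge0.
  by rewrite integral_heat_kernel_sqr// muleC EFinM.
have E2 : (\int[lam]_z (heat_kernel t z ^+ 2 * (128 * sqnorm z ^+ 2))%:E <= (128 * (4 / pi ^+ 2))%:E)%E.
  under eq_integral do rewrite mulrCA EFinM.
  rewrite ge0_integralZl//; last 2 first.
  - by apply/measurable_EFinP; apply: measurable_funM; exact: measurable_funX.
  - by move=> z _; rewrite lee_fin mulr_ge0 ?sqr_ge0.
  by rewrite EFinM lee_wpmul2l//; exact: heat_kernel_sqr_moment.
rewrite E1; apply: (le_trans (leeD2l _ E2)).
rewrite -EFinD lee_fin le_eqVlt; apply/orP; left; apply/eqP.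
by move: (pi : R) (@pi_neq0 R) => p pn0; field.
Qed.

Definition local_oscillation t u x :=
  \int[lam]_z (heat_kernel t z * (near_center x z * (u (x + z) - u x))).

Lemma cancel_average (r a b p : R) : r = a + b - (a - r * p) - b + r * (1 - p).
Proof. by ring. Qed.

(** The kernel has mass 1, so [u x] is the average, minus the oscillation near [x], minus the
    average of the far values, plus [u x] times the far mass. The last two are bounded by
    [far_convolution] and [far_mass]. *)
Lemma heat_decomposition u x t Q : Cinf_c u -> B4 x -> 0 < t -> 0 < Q -> hyp_sqr u <= Q ->
  `|u x| <= `|heat t u x| + `|local_oscillation t u x| +
    Num.sqrt (2 ^+ 14 / pi ^+ 2 * (Q / 16)) + `|u x| * (128 / (t * W x ^+ 2)).
Proof.
move=> cu Bx t0 Q0 uQ.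
have mn := measurable_near_center x.
have su := Cinf_c_smooth cu; have bu := Cinf_c_bounded_support cu.
have [C C0 uC] := bounded_support_bounded (Ck_continuous (su 0%N)) bu.
have mv : measurable_fun setT (fun z => u (x + z)).
  exact: (continuous_measurable_rV4 (Ck_continuous (smooth_translate x su 0%N))).
have i1 : lam.-integrable setT (EFin \o (fun z => heat_kernel t z * (near_center x z * u (x + z)))).
  apply: (@integrable_heat_kernelM _ _ C) => //; first exact: measurable_funM.
  by move=> z; rewrite normrM -[leRHS]mul1r ler_pM// near_center_normr.
have i2 : lam.-integrable setT (EFin \o (fun z => heat_kernel t z * ((1 - near_center x z) * u (x + z)))).
  apply: (@integrable_heat_kernelM _ _ C) => //.
    by apply: measurable_funM => //; exact: measurable_funB.
  move=> z; rewrite normrM -[leRHS]mul1r ler_pM//.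
  by rewrite ger0_norm ?far_center_ge0// gerBl near_center_ge0.
have i3 : lam.-integrable setT (EFin \o (fun z => heat_kernel t z * near_center x z)).
  by apply: (@integrable_heat_kernelM _ _ 1) => // z; exact: near_center_normr.
have i4 : lam.-integrable setT (EFin \o (fun z => heat_kernel t z * (1 - near_center x z))).
  apply: (@integrable_heat_kernelM _ _ 1) => //; first exact: measurable_funB.
  by move=> z; rewrite ger0_norm ?far_center_ge0// gerBl near_center_ge0.
have i5 : lam.-integrable setT (EFin \o (fun z => u x * (heat_kernel t z * near_center x z))).
  exact: (@integrableZl _ _ _ _ _ measurableT (u x) _ i3).
pose a := \int[lam]_z (heat_kernel t z * (near_center x z * u (x + z))).
pose b := \int[lam]_z (heat_kernel t z * ((1 - near_center x z) * u (x + z))).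
pose p := \int[lam]_z (heat_kernel t z * near_center x z).
pose q := \int[lam]_z (heat_kernel t z * (1 - near_center x z)).
have Eh : heat t u x = a + b.
  rewrite /a /b -RintegralD//; apply: eq_Rintegral => z _.
  by move: (near_center x z) (heat_kernel t z) (u (x + z)) => r s w; ring.
have Eg : local_oscillation t u x = a - u x * p.
  rewrite /p /a -RintegralZl// -RintegralB//; apply: eq_Rintegral => z _.
  by move: (near_center x z) (heat_kernel t z) (u (x + z)) (u x) => r s w w'; ring.
have E1 : p + q = 1.
  rewrite /p /q -RintegralD// /Rintegral.
  rewrite (_ : (\int[lam]_z _)%E = 1%E)// -[RHS](integral_heat_kernel t0).
  apply: eq_integral => z _; congr EFin.
  by move: (near_center x z) (heat_kernel t z) => r s; ring.
have q0 : 0 <= q.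
  by apply: Rintegral_ge0 => z _; rewrite mulr_ge0 ?heat_kernel_ge0 ?far_center_ge0.
have qle : q <= 128 / (t * W x ^+ 2) := far_mass Bx t0.
have ble : `|b| <= Num.sqrt (2 ^+ 14 / pi ^+ 2 * (Q / 16)).
  apply: (normr_Rintegral_le i2).
  apply: le_trans (far_convolution cu Bx t0 Q0 uQ).
  by under eq_integral do rewrite mulrA.
have E : u x = heat t u x - local_oscillation t u x - b + u x * q.
  rewrite Eh Eg; rewrite (_ : q = 1 - p); last by rewrite -E1; ring.
  exact: cancel_average.
rewrite {1}E (le_trans (ler_normD _ _))//; apply: lerD; last first.
  by rewrite normrM (ger0_norm q0) ler_wpM2l.
by rewrite (le_trans (ler_normB _ _))// lerD// (le_trans (ler_normB _ _)).
Qed.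

End local_average.

Lemma mul_integral_le d (T : measurableType d) (R : realType)
    (m : {measure set T -> \bar R}) (c : R) (g k : T -> R) :
  0 <= c -> measurable_fun setT g -> (forall s, 0 <= g s) -> (forall s, c * g s <= k s) ->
  (c%:E * \int[m]_s (g s)%:E <= \int[m]_s (k s)%:E)%E.
Proof.
move=> c0 mg g0 gk; rewrite -ge0_integralZl//; last 2 first.
- exact/measurable_EFinP.
- by move=> s _; rewrite lee_fin.
by apply: ge0_le_integral_any => s; rewrite -EFinM lee_fin// mulr_ge0.
Qed.

(** * Second order estimate of the oscillation *)

Section second_order.
Variable R : realType.
Implicit Types (u f : 'rV[R]_4 -> R) (x y z : 'rV[R]_4) (j : 'I_4).
Local Notation lam := (@lebesgue_rV4 R).
Local Notation mu := (@lebesgue_measure R).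
Local Notation mR := (measurableTypeR R).
Local Notation e_ i := (delta_mx ord0 i : 'rV[R]_4).

Lemma integrable_sqr_support f : continuous f -> bounded_support f ->
  lam.-integrable setT (EFin \o (fun x => f x ^+ 2)).
Proof. by move=> cf bf; exact: (integrable_mul_support cf cf bf). Qed.

Definition unit_indic : mR -> R := \1_(`[0, 1]%classic : set R).

Lemma unit_indic_ge0 s : 0 <= unit_indic s. Proof. by rewrite /unit_indic. Qed.

Lemma measurable_unit_indic : measurable_fun setT unit_indic.
Proof.
have mI : measurable (`[0, 1]%classic : set mR) by exact: measurable_itv.
exact: measurable_indic.
Qed.

Lemma integral_unit_indic : (\int[mu]_s (unit_indic s)%:E = 1)%E.
Proof.
have mI : measurable (`[0, 1]%classic : set mR) by exact: measurable_itv.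
rewrite integral_indic// setIT; have := @lebesgue_measure_itv R `[0, 1].
by rewrite /= lte_fin ltr01 oppr0 adde0.
Qed.

Lemma is_derive_segment f j y h (s : R) : Ck 1 f ->
  is_derive s 1 (fun s : R => f (y + (s * h) *: e_ j)) (h * partial j f (y + (s * h) *: e_ j)).
Proof.
move=> Cf.
have d1 := is_derive_line (is_partial j (y + (s * h) *: e_ j) Cf).
have d2 : is_derive s 1 (fun s : R => s * h) h.
  rewrite (_ : (fun s : R => s * h) = (fun s => h * s)); first exact: is_derive_mull.
  by apply/funext => r; rewrite mulrC.
have d3 := @is_derive1_comp _ (fun t : R => f (y + t *: e_ j)) (fun s : R => s * h) s _ _ (is_derive_line (is_partial j (y + (s * h) *: e_ j) Cf)) d2.
by apply: (is_derive_eq d3); rewrite mulrC.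
Qed.

Lemma continuous_segment f j y h : continuous f ->
  continuous (fun s : R => f (y + (s * h) *: e_ j)).
Proof.
move=> cf s; apply: (@continuous_comp _ _ _ (fun s : R => y + (s * h) *: e_ j) f); last exact: cf.
apply: (@continuousD _ _ _ (cst y) (fun s : R => (s * h) *: e_ j) s); first exact: cst_continuous.
apply: (@continuousZl _ _ _ (fun s : R => s * h) (e_ j) s).
by apply: (@continuousM _ _ id (cst h) s) => //; exact: cst_continuous.
Qed.

Lemma continuous_Taylor f j y h : continuous f ->
  continuous (fun s : R => h ^+ 2 * ((1 - s) * f (y + (s * h) *: e_ j))).
Proof.
move=> cf s; apply: (@continuousM _ _ (cst (h ^+ 2)) _ s); first exact: cst_continuous.
apply: (@continuousM _ _ (fun s : R => 1 - s) _ s); last exact: (continuous_segment cf).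
by apply: (@continuousB _ _ _ (fun _ : R => 1 : R) (fun r : R => r) s) => //; exact: cst_continuous.
Qed.

Lemma is_derive_affineM (a : R -> R) (s h b : R) : is_derive s 1 a (h * b) ->
  is_derive s 1 (fun r => (1 - r) * (h * a r)) (h ^+ 2 * ((1 - s) * b) - h * a s).
Proof.
move=> da.
have d1 : is_derive s 1 (fun s : R => 1 - s) (-1).
  apply: (is_derive_eq (is_deriveB (is_derive_cst (1 : R) s 1) (is_derive_id s (1 : R)))).
  by rewrite sub0r.
have d3 := is_deriveM (is_derive_cst h s 1) da.
apply: (is_derive_eq (is_deriveM d1 d3)); rewrite /GRing.scale/= mulr0 addr0.
have -> : (cst h * a) s = h * a s by [].
by ring.
Qed.

Lemma Taylor_remainder u j y (h : R) : Ck 2 u ->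
  (\int[mu]_(s in `[0%R, 1%R]) (h ^+ 2 * ((1 - s) * partial j (partial j u) (y + (s * h) *: e_ j)))%:E
   = (u (y + h *: e_ j) - u y - h * partial j u y)%:E)%E.
Proof.
move=> Cu.
have Cu1 := CkW Cu; have Cp := Ck_partial j Cu.
have cpp : continuous (partial j (partial j u)) := Ck_partial j Cp.
pose F (s : R) := (1 - s) * (h * partial j u (y + (s * h) *: e_ j)) + u (y + (s * h) *: e_ j).
pose F' (s : R) := h ^+ 2 * ((1 - s) * partial j (partial j u) (y + (s * h) *: e_ j)).
transitivity ((F 1 - F 0)%:E); last first.
  rewrite /F !mul0r scale0r addr0 mul1r subr0 mul1r subrr mul0r add0r.
  by apply: congr1; move: (partial j u y) (u _) (u y) => a b c; ring.
apply: (@FTC2 R F F') => //.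
- move=> s _.
  have d2 := is_derive_affineM (is_derive_segment j y h s Cp).
  have d4 := is_deriveD d2 (is_derive_segment j y h s Cu1).
  by apply: (is_derive_eq d4); rewrite subrK.
- by move=> s _; exact: (continuous_Taylor cpp).
Qed.

(** Jensen's inequality on [[0, 1]], after bounding the factor [1 - s] by 1. *)
Lemma Taylor_remainder_sqr u j y (h : R) : Ck 2 u ->
  (((u (y + h *: e_ j) - u y - h * partial j u y) ^+ 2)%:E <=
   \int[mu]_s (h ^+ 4 * (unit_indic s * partial j (partial j u) (y + (s * h) *: e_ j) ^+ 2))%:E)%E.
Proof.
move=> Cu; have cpp : continuous (partial j (partial j u)) := Ck_partial j (Ck_partial j Cu).
pose q (s : mR) : R := h ^+ 2 * partial j (partial j u) (y + (s * h) *: e_ j).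
have mq : measurable_fun setT q.
  apply: (@measurable_funM _ mR) => //.
  by apply: continuous_measurable_fun; exact: continuous_segment.
have T := Taylor_remainder j y h Cu.
have mI : measurable (`[0, 1]%classic : set mR) by exact: measurable_itv.
move: (u _ - u y - _) T => D T.
have le1 : (`|D%:E| <= \int[mu]_s (unit_indic s * `|q s|)%:E)%E.
  rewrite -T; apply: le_trans (le_abse_integral _ _ _) _ => //.
    apply/measurable_EFinP; apply: measurable_funTS.
    by apply: continuous_measurable_fun; exact: continuous_Taylor.
  rewrite integral_mkcond; apply: ge0_le_integral_any => s.
    by rewrite patchE; case: ifPn.
  rewrite patchE /unit_indic indicE; case: ifPn => sI; last by rewrite mul0r.
  move: sI; rewrite inE /= in_itv/= => /andP[s0 s1].
  rewrite /= mul1r lee_fin /q !normrM ler_wpM2l// ler_piMl//.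
  by rewrite ger0_norm ?subr_ge0// gerBl.
have -> : (\int[mu]_s (h ^+ 4 * (unit_indic s * partial j (partial j u) (y + (s * h) *: e_ j) ^+ 2))%:E
    = \int[mu]_s (unit_indic s * q s ^+ 2)%:E)%E.
  apply: eq_integral => s _; apply: congr1; rewrite /q.
  by move: (partial j _ _) (unit_indic s) => a b; ring.
apply: le_trans (sqr_integral_le measurable_unit_indic mq unit_indic_ge0 _); last first.
  by rewrite integral_unit_indic.
by rewrite -real_normK ?num_real// expr2 EFinM; apply: lee_pmul.
Qed.

(* [u (x + z) - u x] is telescoped along the points [x + trunc j z], so that only the
   pure second derivatives of [u] occur; the first order term of each step is odd in
   [z ord0 j] and averages to 0. *)
Definition trunc n z : 'rV[R]_4 := \row_i (if (i < n)%N then z ord0 i else 0).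

Lemma trunc0 z : trunc 0 z = 0.
Proof. by apply/rowP => i; rewrite !mxE. Qed.

Lemma trunc4 z : trunc 4 z = z.
Proof. by apply/rowP => i; rewrite mxE ltn_ord. Qed.

Lemma truncS j z : trunc j.+1 z = trunc j z + z ord0 j *: e_ j.
Proof.
apply/rowP => i; rewrite !mxE eqxx /= ltnS leq_eqVlt.
have [->|ij] := eqVneq i j; first by rewrite eqxx ltnn /= mulr1 add0r.
by rewrite mulr0 addr0 (negbTE (_ : (i != j :> nat))).
Qed.

Definition path_to j z (s : R) := trunc j z + (s * z ord0 j) *: e_ j.

Lemma sqnorm_path_to j z s : 0 <= s <= 1 -> sqnorm (path_to j z s) <= sqnorm z.
Proof.
move=> /andP[s0 s1]; rewrite /sqnorm /path_to; apply: ler_sum => i _.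
rewrite !mxE eqxx /=; have [->|ij] := eqVneq i j.
  rewrite ltnn add0r mulr1 exprMn ler_piMl ?sqr_ge0// expr_le1//.
rewrite mulr0 addr0; case: ifPn => // _; first by rewrite expr0n sqr_ge0.
Qed.

Lemma measurable_path_to j : measurable_fun setT (fun p : 'rV[R]_4 * mR => path_to j p.1 p.2).
Proof.
apply: measurable_fun_rV => i.
rewrite (_ : _ \o _ = fun p : 'rV[R]_4 * mR =>
   (i < j)%N%:R * rV_coord i p.1 + (i == j)%:R * (p.2 * rV_coord j p.1)); last first.
  apply/funext => p; rewrite /= /path_to /rV_coord !mxE eqxx /=.
  by rewrite mulrC; case: (i < j)%N; rewrite ?mul1r ?mul0r.
have mc l : measurable_fun setT (fun p : 'rV[R]_4 * mR => rV_coord l p.1).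
  by apply: (measurableT_comp (measurable_rV_coord l)); exact: measurable_fst.
have m2 : measurable_fun setT (fun p : 'rV[R]_4 * mR => p.2 : R) by exact: measurable_snd.
apply: (@measurable_funD _ _ R setT (fun p : 'rV[R]_4 * mR => (i < j)%N%:R * rV_coord i p.1)
  (fun p : 'rV[R]_4 * mR => (i == j)%:R * (p.2 * rV_coord j p.1))).
  by apply: measurable_funM => //; exact: mc.
by apply: measurable_funM => //; apply: measurable_funM => //; exact: mc.
Qed.

Lemma measurable_add_rV4 d (T : measurableType d) (f g : T -> 'rV[R]_4) :
  measurable_fun setT f -> measurable_fun setT g -> measurable_fun setT (fun t => f t + g t).
Proof.
move=> mf mg; apply: measurable_fun_rV => i.
rewrite (_ : _ \o _ = fun t => (rV_coord i (f t) : R) + rV_coord i (g t)); last first.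
  by apply/funext => t; rewrite /= /rV_coord mxE.
apply: (@measurable_funD _ _ R setT (fun t => rV_coord i (f t)) (fun t => rV_coord i (g t))).
- exact: (measurableT_comp (measurable_rV_coord i) mf).
- exact: (measurableT_comp (measurable_rV_coord i) mg).
Qed.

Lemma measurable_trunc n : measurable_fun setT (trunc n).
Proof.
apply: measurable_fun_rV => i.
rewrite (_ : _ \o _ = fun z : 'rV[R]_4 => (i < n)%N%:R * (rV_coord i z : R)); last first.
  by apply/funext => z; rewrite /= /rV_coord mxE; case: (i < n)%N; rewrite ?mul1r ?mul0r.
apply: (@measurable_funM _ _ R setT (fun=> (i < n)%N%:R) (rV_coord i)) => //.
exact: measurable_rV_coord.
Qed.

Definition flip j z : 'rV[R]_4 := \row_i (if i == j then - z ord0 i else z ord0 i).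

Lemma sqnorm_flip j z : sqnorm (flip j z) = sqnorm z.
Proof.
by apply: eq_bigr => i _; rewrite mxE; case: ifP => // _; rewrite sqrrN.
Qed.

Lemma trunc_flip j z : trunc j (flip j z) = trunc j z.
Proof.
apply/rowP => i; rewrite !mxE; case: ifPn => // ij.
by rewrite (_ : i == j = false)//; apply/negbTE; apply: contraTN ij => /eqP ->; rewrite ltnn.
Qed.

Lemma Rintegral_odd j f : lam.-integrable setT (EFin \o f) ->
  (forall z, f (flip j z) = - f z) -> \int[lam]_z f z = 0.
Proof.
move=> intf fodd.
have mf : measurable_fun setT f by apply/measurable_EFinP; case/integrableP: intf.
have := Rintegral_preserves (@preserves_flip R j) mf.
rewrite (@eq_Rintegral _ _ _ _ _ (fun z => -1 * f z)); last by move=> z _; rewrite mulN1r -fodd.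
by rewrite RintegralZl//; move: (\int[lam]_z f z) => a; lra.
Qed.


Lemma normr_integral_sqr_le (p f : 'rV[R]_4 -> R) (J : \bar R) : measurable_fun setT p ->
  measurable_fun setT f -> (forall x, 0 <= p x) -> (\int[lam]_x (p x)%:E <= 1)%E ->
  lam.-integrable setT (EFin \o (fun z => p z * f z)) ->
  (\int[lam]_x (p x * f x ^+ 2)%:E <= J)%E ->
  (((\int[lam]_x (p x * f x)) ^+ 2)%:E <= J)%E.
Proof.
move=> mp mf p0 p1 ipf fJ; apply: le_trans fJ.
apply: le_trans (sqr_integral_le mp mf p0 p1).
rewrite -real_normK ?num_real// expr2 EFinM.
have h : ((`|\int[lam]_x (p x * f x)|)%:E <= \int[lam]_x (p x * `|f x|)%:E)%E.
  have := le_normr_Rintegral measurableT ipf.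
  rewrite -lee_fin /Rintegral [in X in (_ <= X)%E -> _]fineK; last first.
    exact: (integrable_fin_num measurableT (integrable_norm ipf)).
  move=> /le_trans; apply; rewrite le_eqVlt; apply/orP; left; apply/eqP.
  by apply: eq_integral => z _; rewrite normrM (ger0_norm (p0 z)).
by apply: lee_pmul.
Qed.

Variable L : R.
Hypothesis L0 : 0 < L.

(* The scale [hyp_time x ^ (-1/2)] of the average at [x] is proportional to the
   Euclidean distance of [x] to the boundary. *)
Definition hyp_time x := (4 * L * W x ^+ 2)^-1.

Definition local_part j u x z := u (x + trunc j z + z ord0 j *: e_ j) - u (x + trunc j z) -
  z ord0 j * partial j u (x + trunc j z).

Lemma hyp_time_gt0 x : B4 x -> 0 < hyp_time x.
Proof. by rewrite W_gt0 => Wx; rewrite invr_gt0 !mulr_gt0// exprn_gt0. Qed.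

Lemma measurable_local_part j u x : Cinf_c u -> measurable_fun setT (local_part j u x).
Proof.
move=> cu; have su := Cinf_c_smooth cu.
have mu0 := continuous_measurable_rV4 (Ck_continuous (su 0%N)).
have mp := continuous_measurable_rV4 (Ck_continuous (smooth_partial j su 0%N)).
have mt n : measurable_fun setT (fun z => x + trunc n z).
  by apply: measurable_add_rV4; [exact: measurable_cst|exact: measurable_trunc].
rewrite (_ : local_part j u x = fun z => u (x + trunc j.+1 z) - u (x + trunc j z) -
  z ord0 j * partial j u (x + trunc j z)); last first.
  by apply/funext => z; rewrite /local_part truncS addrA.
apply: measurable_funB; last first.
  apply: measurable_funM; first exact: measurable_rV_coord.
  exact: (measurableT_comp mp (mt j)).
by apply: measurable_funB; apply: (measurableT_comp mu0).
Qed.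

Lemma near_center_coord j x z : B4 x -> `|near_center x z * z ord0 j| <= 1.
Proof.
rewrite W_gt0 => Wx.
have [->|[-> zW]] := near_centerP x z; first by rewrite mul0r normr0.
rewrite mul1r -ler_sqr ?nnegrE// real_normK ?num_real// expr1n.
apply: (le_trans (sqr_coord_le j z)).
have : W x ^+ 2 <= 1 by rewrite expr_le1 ?(W_le1 x)// ltW.
by have := sqnorm_ge0 z; lra.
Qed.

Lemma near_center_partial_bounded j u x : Cinf_c u -> B4 x ->
  exists D, forall z, `|near_center x z * (z ord0 j * partial j u (x + trunc j z))| <= D.
Proof.
move=> cu Bx; have su := Cinf_c_smooth cu.
have [D D0 uD] := bounded_support_bounded (Ck_continuous (smooth_partial j su 0%N))
  (bounded_support_partial j (Cinf_c_bounded_support cu)).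
exists D => z; rewrite mulrA normrM -[leRHS]mul1r ler_pM//.
exact: near_center_coord.
Qed.

Lemma integrable_local_part j u x : Cinf_c u -> B4 x ->
  lam.-integrable setT (EFin \o (fun z => heat_kernel (hyp_time x) z * near_center x z * local_part j u x z)).
Proof.
move=> cu Bx; have [D BD] := near_center_partial_bounded j cu Bx.
have [C C0 uC] := bounded_support_bounded (Ck_continuous (Cinf_c_smooth cu 0%N)) (Cinf_c_bounded_support cu).
have mA : measurable_fun setT (fun z => near_center x z * local_part j u x z).
  by apply: measurable_funM; [exact: measurable_near_center|exact: measurable_local_part].
have := @integrable_heat_kernelM _ _ _ (C + C + D) (hyp_time_gt0 Bx) mA.
rewrite (_ : (fun z => heat_kernel (hyp_time x) z * (_ * _)) =
  (fun z => heat_kernel (hyp_time x) z * near_center x z * local_part j u x z)); last first.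
  by apply/funext => z; rewrite mulrA.
apply => z; rewrite /local_part mulrBr (le_trans (ler_normB _ _))// lerD//.
rewrite normrM -[leRHS]mul1r ler_pM ?near_center_normr//.
by rewrite (le_trans (ler_normB _ _))// lerD.
Qed.

Lemma local_oscillationE u x : Cinf_c u -> B4 x ->
  local_oscillation (hyp_time x) u x =
  \sum_(j < 4) \int[lam]_z (heat_kernel (hyp_time x) z * near_center x z * local_part j u x z).
Proof.
move=> cu Bx; have Wx : 0 < W x by rewrite -W_gt0.
have su := Cinf_c_smooth cu; have bu := Cinf_c_bounded_support cu.
pose t := hyp_time x.
have t0 : 0 < t by rewrite invr_gt0 !mulr_gt0// exprn_gt0.
have mn := measurable_near_center x.
have mp j : measurable_fun setT (partial j u).
  exact: (continuous_measurable_rV4 (Ck_continuous (smooth_partial j su 0%N))).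
have mt n : measurable_fun setT (fun z => x + trunc n z).
  by apply: measurable_add_rV4; [exact: measurable_cst|exact: measurable_trunc].
have mz j : measurable_fun setT (fun z : 'rV[R]_4 => z ord0 j) by exact: measurable_rV_coord.
pose B j z := near_center x z * (z ord0 j * partial j u (x + trunc j z)).
have mB j : measurable_fun setT (B j).
  apply: measurable_funM => //; apply: measurable_funM => //.
  exact: (measurableT_comp (mp j) (mt j)).
have iB j : lam.-integrable setT (EFin \o (fun z => heat_kernel t z * B j z)).
  by have [D BD] := near_center_partial_bounded j cu Bx; exact: (integrable_heat_kernelM t0 (mB j) BD).
pose A j z := heat_kernel t z * near_center x z * local_part j u x z.
have iA j : lam.-integrable setT (EFin \o A j) := integrable_local_part j cu Bx.
(* Kernel and cut-off are even in [z ord0 j], and the base point [x + trunc j z] does not involve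
   this coordinate. *)
have B0 j : \int[lam]_z (heat_kernel t z * B j z) = 0.
  apply: (Rintegral_odd (j := j) (iB j)) => z.
  rewrite /B /heat_kernel /gauss /near_center sqnorm_flip trunc_flip mxE eqxx.
  by rewrite (mulNr (z ord0 j)) !mulrN.
transitivity (\int[lam]_z (\sum_(j < 4) (A j z + heat_kernel t z * B j z))).
  apply: eq_Rintegral => z _.
  have -> : u (x + z) - u x = \sum_(j < 4) (u (x + trunc j.+1 z) - u (x + trunc j z)).
    have := @telescope_sumr R 0 4 (fun n => u (x + trunc n z)) isT.
    by rewrite big_mkord trunc4 trunc0 addr0 => ->.
  rewrite !mulr_sumr; apply: eq_bigr => j _.
  by rewrite /A /B /local_part truncS addrA -mulrA -mulrDr -mulrDr subrK.
rewrite Rintegral_sum; last by move=> j; exact: (integrableD measurableT (iA j) (iB j)).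
by apply: eq_bigr => j _; rewrite RintegralD// B0 addr0.
Qed.

(* A bound for the kernel in terms of the intermediate point [y = x + path_to j z s]
   instead of [x], which allows integrating in [x] first. *)
Definition majorant y z := 16 / (L ^+ 2 * pi ^+ 2) * sqnorm z ^+ 2 * (W y ^+ 8)^-1 *
  gauss (36 * L * W y ^+ 2)^-1 z.

(** Independent of [y]: the Gaussian has width proportional to [W y], so its moment of order 4
    scales like [W y ^+ 8] and cancels the weight. *)
Lemma integral_majorant y : 0 < W y ->
  (\int[lam]_z (majorant y z)%:E <= (2 ^+ 10 * 36 ^+ 4 * L ^+ 2)%:E)%E.
Proof.
move=> Wy; pose t := (36 * L * W y ^+ 2)^-1.
have t0 : 0 < t by rewrite invr_gt0 !mulr_gt0// exprn_gt0.
have c0 : 0 <= 16 / (L ^+ 2 * pi ^+ 2) * (W y ^+ 8)^-1.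
  by rewrite mulr_ge0// ?invr_ge0 ?exprn_even_ge0// mulr_ge0// invr_ge0 mulr_ge0 ?sqr_ge0.
pose c := 16 / (L ^+ 2 * pi ^+ 2) * (W y ^+ 8)^-1 * (16 / t ^+ 2).
apply: (@le_trans _ _ (\int[lam]_z (c * gauss (t / 2) z)%:E)%E).
  apply: ge0_le_integral_any => z.
    rewrite lee_fin /majorant mulr_ge0 ?gauss_ge0// mulr_ge0 ?invr_ge0 ?exprn_even_ge0//.
    by rewrite mulr_ge0 ?sqr_ge0// divr_ge0// mulr_ge0 ?sqr_ge0.
  rewrite lee_fin /majorant -/t.
  rewrite [leLHS](_ : _ = 16 / (L ^+ 2 * pi ^+ 2) * (W y ^+ 8)^-1 * (sqnorm z ^+ 2 * gauss t z)); last by ring.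
  by rewrite /c -[leRHS]mulrA ler_wpM2l// gauss_moment2.
rewrite integralZ_gauss ?divr_gt0//; last by rewrite mulr_ge0// divr_ge0 ?sqr_ge0.
rewrite lee_fin le_eqVlt; apply/orP; left; apply/eqP; rewrite /c /t.
move: (pi : R) (@pi_neq0 R) => p p0; field.
by rewrite p0 !gt_eqF.
Qed.

(** On the support of the cut-off, [W] at the intermediate point and [W x] are comparable, so one
    may be exchanged for the other in both the weight and the width of the Gaussian. *)
Lemma kernel_le_majorant j x z s : B4 x -> 0 <= s <= 1 ->
  (W x ^+ 4)^-1 * (heat_kernel (hyp_time x) z * near_center x z * z ord0 j ^+ 4) <=
  majorant (x + path_to j z s) z.
Proof.
move=> Bx s01; have Wx : 0 < W x by rewrite -W_gt0.
have sz0 := sqnorm_ge0 z.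
have maj0 : 0 <= majorant (x + path_to j z s) z.
  rewrite /majorant mulr_ge0 ?gauss_ge0// mulr_ge0 ?invr_ge0 ?exprn_even_ge0//.
  by rewrite mulr_ge0 ?sqr_ge0// divr_ge0// mulr_ge0 ?sqr_ge0.
have [->|[-> zW]] := near_centerP x z; first by rewrite mulr0 mul0r mulr0.
rewrite mulr1.
have sw := sqnorm_path_to j z s01; set w := path_to j z s.
have sw0 := sqnorm_ge0 w.
have d2 := dotp_ball w Bx.
have W1 := W_le1 x.
have dW : `|dotp x w| <= W x / 4.
  have W4 : 0 <= W x / 4 by rewrite divr_ge0// ltW.
  rewrite -ler_sqr ?nnegrE// real_normK ?num_real//.
  apply: (le_trans d2); apply: (le_trans sw).
  by rewrite expr_div_n ler_pdivlMr ?exprn_gt0// mulrC (_ : 4 ^+ 2 = 16)//; ring.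
have sW : sqnorm w <= W x / 16.
  apply: (le_trans sw); rewrite ler_pdivlMr// mulrC; apply: (le_trans zW).
  by rewrite expr2 ger_pMr.
move: dW; rewrite ler_norml => /andP[dW1 dW2].
(* The two comparisons behind the constants of [majorant]: [36 = 4 * 3^2] comes from the lower one,
   and [16 = 2^8 / 16] from the upper one together with the square of [hyp_time]. *)
have Wy1 : W x / 3 <= W (x + w) by rewrite WD; lra.
have Wy2 : W (x + w) <= 2 * W x by rewrite WD; lra.
have Wy : 0 < W (x + w) by apply: lt_le_trans Wy1; rewrite divr_gt0.
have zj : z ord0 j ^+ 4 <= sqnorm z ^+ 2.
  rewrite (_ : z ord0 j ^+ 4 = (z ord0 j ^+ 2) ^+ 2); last by rewrite -exprM.
  by rewrite ler_sqr ?nnegrE ?sqr_ge0// sqr_coord_le.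
have g0 := gauss_ge0 (hyp_time x) z.
rewrite /majorant /heat_kernel; move: (W (x + w)) Wy Wy1 Wy2 => V V0 V1 V2.
have gle : gauss (hyp_time x) z <= gauss (36 * L * V ^+ 2)^-1 z.
  rewrite /gauss ler_expR !mulNr lerN2 ler_wpM2r// /hyp_time.
  rewrite lef_pV2 ?posrE ?mulr_gt0 ?exprn_gt0//.
  rewrite (_ : 36 * L * V ^+ 2 = 4 * L * (3 * V) ^+ 2); last by ring.
  apply: ler_wpM2l; first by rewrite mulr_ge0// ltW.
  have V30 : 0 <= 3 * V by rewrite mulr_ge0// ltW.
  by rewrite ler_sqr ?nnegrE// ?(ltW Wx)//; lra.
have c0 : 0 <= (16 * L ^+ 2 * pi ^+ 2)^-1 by rewrite invr_ge0 mulr_ge0 ?sqr_ge0// mulr_ge0 ?sqr_ge0.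
have p0 := @pi_neq0 R.
rewrite [leLHS](_ : _ = (16 * L ^+ 2 * pi ^+ 2)^-1 * ((W x ^+ 8)^-1 * (z ord0 j ^+ 4 * gauss (hyp_time x) z))); last first.
  rewrite {1}/hyp_time; move: (gauss _ _) (pi : R) p0 => g p p0; field.
  by rewrite p0 !gt_eqF.
rewrite [leRHS](_ : _ = (16 * L ^+ 2 * pi ^+ 2)^-1 * ((256 * (V ^+ 8)^-1) * (sqnorm z ^+ 2 * gauss (36 * L * V ^+ 2)^-1 z))); last first.
  move: (gauss _ _) (pi : R) p0 => g p p0; field.
  by rewrite p0 !gt_eqF.
apply: ler_wpM2l => //; apply: ler_pM.
- by rewrite invr_ge0 exprn_even_ge0.
- by rewrite mulr_ge0// exprn_even_ge0.
- rewrite -[leLHS]mul1r ler_pdivrMr ?exprn_gt0// mulrAC ler_pdivlMr ?exprn_gt0// mul1r.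
  rewrite (_ : 256 * W x ^+ 8 = (2 * W x) ^+ 8); last by ring.
  by rewrite lerXn2r ?nnegrE ?mulr_ge0// ltW.
- by apply: ler_pM => //; exact: exprn_even_ge0.
Qed.

Lemma majorant_ge0 y z : 0 <= majorant y z.
Proof.
rewrite /majorant mulr_ge0 ?gauss_ge0// mulr_ge0 ?invr_ge0 ?exprn_even_ge0//.
by rewrite mulr_ge0 ?sqr_ge0// divr_ge0// mulr_ge0 ?sqr_ge0.
Qed.

Lemma measurable_W : measurable_fun setT (@W R).
Proof. by apply: measurable_funB => //; exact: measurable_sqnorm. Qed.

Lemma measurable_majorant : measurable_fun setT (fun p : 'rV[R]_4 * 'rV[R]_4 => majorant p.1 p.2).
Proof.
have ms : measurable_fun setT (fun p : 'rV[R]_4 * 'rV[R]_4 => sqnorm p.2).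
  by apply: measurableT_comp => //; exact: measurable_sqnorm.
have mW : measurable_fun setT (fun p : 'rV[R]_4 * 'rV[R]_4 => W p.1).
  by apply: measurableT_comp => //; exact: measurable_W.
have mi (f : 'rV[R]_4 * 'rV[R]_4 -> R) : measurable_fun setT f -> measurable_fun setT (fun p => (f p)^-1).
  by move=> mf; exact: (measurableT_comp (@measurable_invr R) mf).
apply: measurable_funM; last first.
  apply: measurableT_comp => //; apply: measurable_funM => //.
  apply: measurableT_comp => //; apply: mi; apply: measurable_funM => //.
  exact: measurable_funX.
apply: measurable_funM; last by apply: mi; exact: measurable_funX.
by apply: measurable_funM => //; exact: measurable_funX.
Qed.

(** The variable [x] enters only through [x + path_to j z s], so a translation in [x] removes the
    path. *)
Definition path_density j u x z s :=
  unit_indic s * (majorant (x + path_to j z s) z * partial j (partial j u) (x + path_to j z s) ^+ 2).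

Lemma path_density_ge0 j u x z s : 0 <= path_density j u x z s.
Proof. by rewrite mulr_ge0 ?unit_indic_ge0// mulr_ge0 ?majorant_ge0// sqr_ge0. Qed.

Lemma measurable_path_density j u : smooth u ->
  measurable_fun setT (fun p : ('rV[R]_4 * 'rV[R]_4) * mR => path_density j u p.1.1 p.1.2 p.2).
Proof.
move=> su; have mf : measurable_fun setT (partial j (partial j u)).
  exact: (continuous_measurable_rV4 (Ck_continuous (smooth_partial j (smooth_partial j su) 0%N))).
have m1 : measurable_fun setT (fun p : ('rV[R]_4 * 'rV[R]_4) * mR => p.1.1).
  by apply: measurableT_comp; [exact: measurable_fst|exact: measurable_fst].
have m2 : measurable_fun setT (fun p : ('rV[R]_4 * 'rV[R]_4) * mR => p.1.2).
  by apply: measurableT_comp; [exact: measurable_snd|exact: measurable_fst].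
have m3 : measurable_fun setT (fun p : ('rV[R]_4 * 'rV[R]_4) * mR => p.2) by exact: measurable_snd.
have my : measurable_fun setT (fun p : ('rV[R]_4 * 'rV[R]_4) * mR => p.1.1 + path_to j p.1.2 p.2).
  apply: measurable_add_rV4 => //.
  exact: (measurableT_comp (measurable_path_to j) (measurable_fun_pair m2 m3)).
apply: measurable_funM; first exact: (measurableT_comp measurable_unit_indic m3).
apply: measurable_funM; first exact: (measurableT_comp measurable_majorant (measurable_fun_pair my m2)).
by apply: measurable_funX; exact: (measurableT_comp mf my).
Qed.

(** Jensen's inequality twice, in [z] against the truncated kernel, whose mass is at most 1, and in
    [s] inside the Taylor remainder. [kernel_le_majorant] then moves the weight to the intermediate
    point. *)
Lemma local_part_sqr_le j u x : Cinf_c u -> B4 x ->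
  (((W x ^+ 4)^-1 * (\int[lam]_z (heat_kernel (hyp_time x) z * near_center x z * local_part j u x z)) ^+ 2)%:E
  <= \int[lam]_z \int[mu]_s (path_density j u x z s)%:E)%E.
Proof.
move=> cu Bx; have Wx : 0 < W x by rewrite -W_gt0.
have su := Cinf_c_smooth cu; have bu := Cinf_c_bounded_support cu.
have w0 : 0 <= (W x ^+ 4)^-1 by rewrite invr_ge0 exprn_even_ge0.
pose t := hyp_time x.
have t0 : 0 < t by rewrite invr_gt0 !mulr_gt0// exprn_gt0.
pose p z := heat_kernel t z * near_center x z.
have p0 z : 0 <= p z by rewrite mulr_ge0 ?heat_kernel_ge0 ?near_center_ge0.
have mp : measurable_fun setT p.
  by apply: measurable_funM; [exact: measurable_heat_kernel|exact: measurable_near_center].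
have mD := measurable_local_part j x cu.
have ip := integrable_local_part j cu Bx.
have p1 : (\int[lam]_z (p z)%:E <= 1)%E.
  rewrite -(integral_heat_kernel t0); apply: ge0_le_integral_any => z; rewrite lee_fin//.
  by rewrite /p -[leRHS]mulr1 ler_wpM2l ?heat_kernel_ge0// near_center_le1.
have := normr_integral_sqr_le mp mD p0 p1 ip (lexx _).
rewrite -/t -/p => h.
rewrite EFinM; apply: (le_trans (lee_wpmul2l _ h)); first by rewrite lee_fin.
rewrite -ge0_integralZl//; last 2 first.
- by apply/measurable_EFinP; apply: measurable_funM => //; exact: measurable_funX.
- by move=> z _; rewrite lee_fin mulr_ge0 ?sqr_ge0.
apply: ge0_le_integral_any => z.
  by rewrite -EFinM lee_fin mulr_ge0// mulr_ge0 ?sqr_ge0.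
have T := Taylor_remainder_sqr j (x + trunc j z) (z ord0 j) (su 2%N).
rewrite -EFinM mulrA EFinM; apply: (le_trans (lee_wpmul2l _ T)).
  by rewrite lee_fin mulr_ge0.
apply: mul_integral_le.
- by rewrite mulr_ge0.
- apply: measurable_funM; first exact: measurable_cst.
  apply: measurable_funM; first exact: measurable_unit_indic.
  apply: measurable_funX; apply: continuous_measurable_fun.
  by apply: continuous_segment; exact: (Ck_continuous (smooth_partial j (smooth_partial j su) 0%N)).
- move=> s; apply: mulr_ge0; first exact: exprn_even_ge0.
  by rewrite mulr_ge0 ?unit_indic_ge0// sqr_ge0.
move=> s; rewrite /path_density /path_to addrA.
move: (partial j (partial j u) _) => b.
have [sI|sI] := boolP (s \in (`[0, 1]%classic : set R)); last first.
  by rewrite /unit_indic indicE (negbTE sI) !mul0r !mulr0.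
rewrite [leLHS]mulrA [leRHS]mulrCA; apply: ler_wpM2r; first by rewrite mulr_ge0 ?unit_indic_ge0// sqr_ge0.
have s01 : 0 <= s <= 1 by move: sI; rewrite inE /= in_itv.
by have := kernel_le_majorant j z Bx s01; rewrite /path_to !addrA mulrA.
Qed.

Lemma integral_unit_indicM (c : \bar R) : (0 <= c)%E ->
  (\int[mu]_s ((unit_indic s)%:E * c) = c)%E.
Proof.
move=> c0; have mi : measurable_fun setT (fun s => (unit_indic s)%:E).
  by apply/measurable_EFinP; exact: measurable_unit_indic.
rewrite ge0_integralZr//; last by move=> s _; rewrite lee_fin unit_indic_ge0.
by rewrite integral_unit_indic mul1e.
Qed.

Lemma integralZ_translate (c : R) (a : 'rV[R]_4) (g : 'rV[R]_4 -> R) : 0 <= c ->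
  measurable_fun setT g -> (forall y, 0 <= g y) ->
  (\int[lam]_x (c * g (x + a))%:E = c%:E * \int[lam]_y (g y)%:E)%E.
Proof.
move=> c0 mg g0; have mE : measurable_fun setT (EFin \o g) by exact/measurable_EFinP.
rewrite -(preserves_integral (preserves_translate a) mE).
have [mt _] := preserves_translate a.
transitivity (\int[lam]_x (c%:E * (g (x + a))%:E))%E; first by [].
rewrite ge0_integralZl//.
- exact: (measurableT_comp mE mt).
- by move=> x _; rewrite lee_fin.
Qed.

(** Tonelli brings the integral in [x] inside, where translation invariance erases the path; the
    integral in [s] is then that of the indicator of [[0, 1]]. *)
Lemma integral_path j (h : 'rV[R]_4 -> 'rV[R]_4 -> R) :
  measurable_fun setT (fun p : 'rV[R]_4 * 'rV[R]_4 => h p.1 p.2) -> (forall y z, 0 <= h y z) ->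
  measurable_fun setT (fun p : ('rV[R]_4 * 'rV[R]_4) * mR =>
    unit_indic p.2 * h (p.1.1 + path_to j p.1.2 p.2) p.1.2) ->
  (\int[lam]_x \int[lam]_z \int[mu]_s (unit_indic s * h (x + path_to j z s) z)%:E =
   \int[lam]_y \int[lam]_z (h y z)%:E)%E.
Proof.
move=> mh h0 mK.
pose K x z s := (unit_indic s * h (x + path_to j z s) z)%:E.
have K0 x z s : (0 <= K x z s)%E by rewrite lee_fin mulr_ge0 ?unit_indic_ge0.
have mKE : measurable_fun setT (fun p : ('rV[R]_4 * 'rV[R]_4) * mR => K p.1.1 p.1.2 p.2).
  exact/measurable_EFinP.
have mK1 : measurable_fun setT (fun p : 'rV[R]_4 * 'rV[R]_4 => \int[mu]_s K p.1 p.2 s)%E.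
  exact: (measurable_fun_fubini_tonelli_F (fun p : ('rV[R]_4 * 'rV[R]_4) * mR => K p.1.1 p.1.2 p.2)).
have swap1 : (\int[lam]_x \int[lam]_z \int[mu]_s K x z s = \int[lam]_z \int[lam]_x \int[mu]_s K x z s)%E.
  apply: (fubini_tonelli (fun p : 'rV[R]_4 * 'rV[R]_4 => \int[mu]_s K p.1 p.2 s)%E) => //.
  by move=> p; exact: integral_ge0.
have mKz z : measurable_fun setT (fun p : 'rV[R]_4 * mR => K p.1 z p.2).
  have mp : measurable_fun setT (fun p : 'rV[R]_4 * mR => ((p.1, z), p.2)).
    exact: (measurable_fun_pair (measurable_fun_pair measurable_fst (measurable_cst z)) measurable_snd).
  exact: (measurableT_comp mKE mp).
have swap2 z : (\int[lam]_x \int[mu]_s K x z s = \int[mu]_s \int[lam]_x K x z s)%E.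
  exact: (fubini_tonelli (fun p : 'rV[R]_4 * mR => K p.1 z p.2)%E).
have mhz z : measurable_fun setT (h ^~ z) := measurableT_comp mh (pair2_measurable z).
have inner z s : (\int[lam]_x K x z s = (unit_indic s)%:E * \int[lam]_y (h y z)%:E)%E.
  exact: (integralZ_translate (path_to j z s) (unit_indic_ge0 s) (mhz z) (h0 ^~ z)).
have inner2 z : (\int[lam]_x \int[mu]_s K x z s = \int[lam]_y (h y z)%:E)%E.
  rewrite swap2; under eq_integral do rewrite inner.
  have I0 : (0 <= \int[lam]_y (h y z)%:E)%E by apply: integral_ge0 => y _; rewrite lee_fin.
  exact: integral_unit_indicM.
rewrite swap1; under eq_integral do rewrite inner2.
apply/esym; apply: (fubini_tonelli (fun p : 'rV[R]_4 * 'rV[R]_4 => (h p.1 p.2)%:E)).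
- exact/measurable_EFinP.
- by move=> p; rewrite lee_fin.
Qed.

Lemma integral_majorantM (f : 'rV[R]_4 -> R) : measurable_fun setT f ->
  (forall y, 0 <= f y) -> (forall y, ~ B4 y -> f y = 0) ->
  (\int[lam]_y \int[lam]_z (majorant y z * f y)%:E <=
   (2 ^+ 10 * 36 ^+ 4 * L ^+ 2)%:E * \int[lam]_y (f y)%:E)%E.
Proof.
move=> mf f0 fB.
have H0 y z : (0 <= (majorant y z * f y)%:E)%E by rewrite lee_fin mulr_ge0 ?majorant_ge0.
rewrite -ge0_integralZl//; last 3 first.
- exact/measurable_EFinP.
- by move=> y _; rewrite lee_fin.
- by rewrite lee_fin mulr_ge0 ?sqr_ge0// mulr_ge0// exprn_ge0.
apply: ge0_le_integral_any => y; first exact: integral_ge0.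
have [By|nBy] := pselect (B4 y); last first.
  rewrite fB// mule0; under eq_integral do rewrite mulr0.
  by rewrite integral0.
move: By; rewrite W_gt0 => Wy.
under eq_integral do rewrite EFinM.
rewrite ge0_integralZr//; last 3 first.
- apply/measurable_EFinP; exact: (measurableT_comp measurable_majorant (pair1_measurable y)).
- by move=> z _; rewrite lee_fin majorant_ge0.
- by rewrite lee_fin.
by apply: lee_wpmul2r; [rewrite lee_fin|exact: integral_majorant].
Qed.

Lemma integral_path_density j u : Cinf_c u ->
  (\int[lam]_x \int[lam]_z \int[mu]_s (path_density j u x z s)%:E <=
   (2 ^+ 10 * 36 ^+ 4 * L ^+ 2)%:E * \int[lam]_y (partial j (partial j u) y ^+ 2)%:E)%E.
Proof.
move=> cu; have su := Cinf_c_smooth cu.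
have mK := measurable_path_density j su.
have mf : measurable_fun setT (fun y => partial j (partial j u) y ^+ 2).
  apply: measurable_funX.
  exact: (continuous_measurable_rV4 (Ck_continuous (smooth_partial j (smooth_partial j su) 0%N))).
have f0 y : 0 <= partial j (partial j u) y ^+ 2 by rewrite sqr_ge0.
have fB y : ~ B4 y -> partial j (partial j u) y ^+ 2 = 0.
  move=> nBy; rewrite (Cinf_c_out _ nBy) ?expr0n//.
  by do 2 apply: Cinf_c_partial.
move: mK f0 fB mf; rewrite /path_density; move: (partial j (partial j u)) => g mK f0 fB mf.
apply: le_trans (integral_majorantM mf f0 fB).
rewrite (integral_path (h := fun y z => majorant y z * g y ^+ 2) _ _ mK)//.
- apply: measurable_funM; first exact: measurable_majorant.
  by apply: (measurableT_comp mf); exact: measurable_fst.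
- by move=> y z; rewrite mulr_ge0 ?majorant_ge0.
Qed.

Lemma sqr_sum4 (a : 'I_4 -> R) : (\sum_(j < 4) a j) ^+ 2 <= 4 * \sum_(j < 4) a j ^+ 2.
Proof.
rewrite !sum_ord4; move: (a _) (a _) (a _) (a _) => p q r s.
rewrite -subr_ge0 [X in 0 <= X](_ : _ = (p - q) ^+ 2 + (p - r) ^+ 2 + (p - s) ^+ 2 +
  (q - r) ^+ 2 + (q - s) ^+ 2 + (r - s) ^+ 2); last by ring.
by rewrite !addr_ge0 ?sqr_ge0.
Qed.

(** A measurable majorant is produced rather than an integral of the oscillation itself, which
    spares its measurability in [x]. The factor [L ^+ 2] is the gain from averaging at small scales;
    the 4 in [2^12 = 4 * 2^10] comes from squaring a sum of four terms. *)
Lemma local_oscillation_bound u : Cinf_c u -> \int[lam]_x (lap u x ^+ 2) <= 1 ->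
  exists Phi : 'rV[R]_4 -> \bar R, [/\ measurable_fun setT Phi, (forall x, 0 <= Phi x)%E,
    (forall x, B4 x -> (((W x ^+ 4)^-1 * local_oscillation (hyp_time x) u x ^+ 2)%:E <= Phi x)%E) &
    (\int[lam]_x Phi x <= (2 ^+ 12 * 36 ^+ 4 * L ^+ 2)%:E)%E].
Proof.
move=> cu E1; have su := Cinf_c_smooth cu; have bu := Cinf_c_bounded_support cu.
pose J j x := (\int[lam]_z \int[mu]_s (path_density j u x z s)%:E)%E.
have J0 j x : (0 <= J j x)%E.
  by apply: integral_ge0 => z _; apply: integral_ge0 => s _; rewrite lee_fin path_density_ge0.
have mJ j : measurable_fun setT (J j).
  have mK := measurable_path_density j su.
  have mK1 : measurable_fun setT (fun p : 'rV[R]_4 * 'rV[R]_4 => \int[mu]_s (path_density j u p.1 p.2 s)%:E)%E.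
    apply: (measurable_fun_fubini_tonelli_F (fun p : ('rV[R]_4 * 'rV[R]_4) * mR => (path_density j u p.1.1 p.1.2 p.2)%:E)).
      exact/measurable_EFinP.
    by move=> p; rewrite lee_fin path_density_ge0.
  apply: (measurable_fun_fubini_tonelli_F (fun p : 'rV[R]_4 * 'rV[R]_4 => \int[mu]_s (path_density j u p.1 p.2 s)%:E)%E) => //.
  by move=> p; apply: integral_ge0 => s _; rewrite lee_fin path_density_ge0.
exists (fun x => 4%:E * \sum_(j < 4) J j x)%E; split.
- apply: emeasurable_funM; first exact: measurable_cst.
  exact: emeasurable_sum.
- by move=> x; rewrite mule_ge0// sume_ge0.
- move=> x Bx; rewrite local_oscillationE//.
  have w0 : 0 <= (W x ^+ 4)^-1 by rewrite invr_ge0 exprn_even_ge0.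
  set a := fun j => \int[lam]_z (heat_kernel (hyp_time x) z * near_center x z * local_part j u x z).
  apply: (@le_trans _ _ (4%:E * \sum_(j < 4) ((W x ^+ 4)^-1 * a j ^+ 2)%:E)%E).
    rewrite sumEFin -EFinM lee_fin -mulr_sumr [leRHS]mulrCA ler_wpM2l//; exact: sqr_sum4.
  apply: lee_wpmul2l => //; apply: lee_sum => j _; exact: local_part_sqr_le.
rewrite ge0_integralZl//; last 2 first.
- exact: emeasurable_sum.
- by move=> x _; rewrite sume_ge0.
rewrite ge0_integral_sum//.
pose D j := \int[lam]_y (partial j (partial j u) y ^+ 2).
have DE j : (\int[lam]_y (partial j (partial j u) y ^+ 2)%:E = (D j)%:E)%E.
  have cpp := Ck_continuous (smooth_partial j (smooth_partial j su) 0%N).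
  have ipp := integrable_sqr_support cpp (bounded_support_partial j (bounded_support_partial j bu)).
  rewrite /D /Rintegral fineK//; exact: (integrable_fin_num measurableT ipp).
(* The pure second derivatives are part of the Hessian, whose squared norm is the energy. *)
have D1 : \sum_(j < 4) D j <= 1.
  apply: le_trans E1; rewrite (Rintegral_lap_sqr su bu); apply: ler_sum => j _.
  rewrite (bigD1 j)//= lerDl sumr_ge0// => i _.
  by apply: Rintegral_ge0 => y _; exact: sqr_ge0.
have c0 : 0 <= 2 ^+ 10 * 36 ^+ 4 * L ^+ 2 by rewrite mulr_ge0 ?sqr_ge0// mulr_ge0// exprn_ge0.
apply: (@le_trans _ _ (4%:E * \sum_(j < 4) ((2 ^+ 10 * 36 ^+ 4 * L ^+ 2) * D j)%:E)%E).
  apply: lee_wpmul2l => //; apply: lee_sum => j _.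
  by rewrite EFinM -DE; exact: integral_path_density.
rewrite sumEFin -EFinM lee_fin -mulr_sumr.
rewrite [leRHS](_ : _ = 4 * (2 ^+ 10 * 36 ^+ 4 * L ^+ 2 * 1)); last by move: (36 ^+ 4) (L ^+ 2) => a b; ring.
by rewrite ler_wpM2l// ler_wpM2l.
Qed.

End second_order.

(** * Subcritical exponents *)

Section level_sets.
Variable R : realType.
Implicit Types (u : 'rV[R]_4 -> R) (x : 'rV[R]_4).
Local Notation lam := (@lebesgue_rV4 R).

(** The first root bounds the average at the coarse scale and the second one the far convolution,
    both for [q <= 8]. *)
Definition level_cst : R := Num.sqrt ((1 + 2 ^+ 12) / (16 * pi ^+ 2)) + Num.sqrt (2 ^+ 13 / pi ^+ 2).

Lemma rescaled_heat_bound (q : R) : 0 < q -> q <= 8 ->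
  ((8 * (q / 8))^-1 + 2 ^+ 9) / pi ^+ 2 * (q / 16) <= (1 + 2 ^+ 12) / (16 * pi ^+ 2) :> R.
Proof.
move=> q0 q8; have p0 := @pi_gt0 R; move: (pi : R) p0 => p p0.
rewrite [leLHS](_ : _ = (1 + 2 ^+ 9 * q) / (16 * p ^+ 2)); last by field; rewrite !gt_eqF.
rewrite ler_wpM2r//; first by rewrite invr_ge0 mulr_ge0// sqr_ge0.
by rewrite lerD2l (_ : 2 ^+ 12 = 2 ^+ 9 * 8); [rewrite ler_wpM2l// exprn_ge0|ring].
Qed.

(** [r] is proportional to [sqrt q], so that the growth of [heat_bound] in time is exactly
    compensated by its factor [q]: the product is [1 / 16] over [pi^2], plus a term linear in
    [q]. *)
Lemma heat_at_scale u x (r q : R) : Cinf_c u -> B4 x -> 0 < q -> q <= 8 -> hyp_sqr u <= q ->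
  0 < r -> r ^+ 2 = q / 8 ->
  `|heat (hyp_time r x) u x| <= Num.sqrt ((1 + 2 ^+ 12) / (16 * pi ^+ 2)).
Proof.
move=> cu Bx q0 q8 uq r0 rq; have Wx : 0 < W x by rewrite -W_gt0.
apply: (le_trans (heat_bound cu Bx (hyp_time_gt0 r0 Bx) q0 uq)).
rewrite (_ : 2 * (W x ^+ 2 * hyp_time r x) ^+ 2 = (8 * (q / 8))^-1); last first.
  by rewrite /hyp_time -rq; field; rewrite !gt_eqF.
apply: ler_wsqrtr; exact: rescaled_heat_bound.
Qed.

(** [d] is the ratio of the two scales for which [heat_difference_le] gives [(1 - 3 e) t]. Of the
    remaining [3 e t], one [e t] pays for the far mass, one for [level_cst], and the last one is
    left to the oscillation. *)
Lemma level_oscillation u x (e t r q d : R) : Cinf_c u -> \int[lam]_x (lap u x ^+ 2) <= 1 ->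
  B4 x -> 0 < q -> q <= 8 -> hyp_sqr u <= q -> 0 < r -> r ^+ 2 = q / 8 ->
  0 < e -> 3 * e < 1 -> 0 < t -> level_cst <= e * t ->
  d = expR (- (16 * pi ^+ 2 * ((1 - 3 * e) * t) ^+ 2)) -> 2 ^+ 9 * d <= e ->
  t <= `|u x| -> (e * t) ^+ 2 <= local_oscillation (hyp_time (d * r) x) u x ^+ 2.
Proof.
move=> cu E1 Bx q0 q8 uq r0 rq e0 e3 t0 Ct dE de tu.
have Wx : 0 < W x by rewrite -W_gt0.
have su := Cinf_c_smooth cu; have bu := Cinf_c_bounded_support cu.
have d0 : 0 < d by rewrite dE expR_gt0.
have pp : 0 < pi :> R := pi_gt0 R.
have et0 : 0 < (1 - 3 * e) * t by rewrite mulr_gt0// subr_gt0.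
have d1 : d < 1.
  rewrite dE expR_lt1 oppr_lt0; apply: mulr_gt0; last exact: exprn_gt0.
  by apply: mulr_gt0; [rewrite ltr0n|exact: exprn_gt0].
have dr0 : 0 < d * r by rewrite mulr_gt0.
have A0 := hyp_time_gt0 r0 Bx; have B0 := hyp_time_gt0 dr0 Bx.
have BA : hyp_time (d * r) x / hyp_time r x = d^-1.
  by rewrite /hyp_time; field; rewrite !gt_eqF.
have AB : hyp_time r x < hyp_time (d * r) x.
  by rewrite -[ltLHS]mul1r -ltr_pdivlMr// BA invf_gt1.
have h1 := heat_at_scale cu Bx q0 q8 uq r0 rq.
have h2 := heat_difference_le x su bu E1 A0 AB.
have l : ln (hyp_time (d * r) x / hyp_time r x) / (16 * pi ^+ 2) = ((1 - 3 * e) * t) ^+ 2.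
  rewrite BA dE -expRN opprK expRK; move: ((1 - 3 * e) * t) => a.
  by move: (pi : R) pp => p p0; field; rewrite gt_eqF.
rewrite l sqrtr_sqr (ger0_norm (ltW et0)) in h2.
have h3 := heat_decomposition cu Bx B0 q0 uq.
have h4 : Num.sqrt (2 ^+ 14 / pi ^+ 2 * (q / 16)) <= Num.sqrt (2 ^+ 13 / pi ^+ 2) :> R.
  apply: ler_wsqrtr; rewrite (_ : 2 ^+ 13 / pi ^+ 2 = 2 ^+ 14 / pi ^+ 2 * (8 / 16) :> R); last first.
    by move: (pi : R) pp => p p0; field; rewrite gt_eqF.
  apply: ler_wpM2l; first by apply: divr_ge0; [exact: exprn_ge0|exact: sqr_ge0].
  by rewrite ler_wpM2r// invr_ge0.
(* The quotient is [2^9 d r], and [r <= 1] because [q <= 8]. *)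
have h5 : 128 / (hyp_time (d * r) x * W x ^+ 2) <= e.
  rewrite (_ : _ / _ = 2 ^+ 9 * d * r); last by rewrite /hyp_time; field; rewrite !gt_eqF.
  apply: le_trans de; rewrite -[leRHS]mulr1 ler_wpM2l//.
    by apply: mulr_ge0; [exact: exprn_ge0|exact: ltW].
  rewrite -(@ler_pXn2r _ 2)// ?nnegrE ?(ltW r0)//.
  by rewrite rq expr1n ler_pdivrMr// mul1r.
have h6 : `|u x| * (128 / (hyp_time (d * r) x * W x ^+ 2)) <= `|u x| * e by rewrite ler_wpM2l.
have h7 : `|heat (hyp_time (d * r) x) u x| <=
    Num.sqrt ((1 + 2 ^+ 12) / (16 * pi ^+ 2)) + (1 - 3 * e) * t.
  rewrite -[heat _ u x](subrK (heat (hyp_time r x) u x)) addrC.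
  exact: (le_trans (ler_normD _ _) (lerD h1 h2)).
rewrite -[leRHS]real_normK ?num_real//.
rewrite ler_sqr ?nnegrE ?(ltW (mulr_gt0 e0 t0))//.
move: Ct; rewrite /level_cst; move: h3 h4 h6 h7 tu.
set G := `|local_oscillation _ _ _|; set H := `|heat _ u x|; set s1 := Num.sqrt (_ / (16 * _)).
set s2 := Num.sqrt (2 ^+ 13 / _); set s3 := Num.sqrt (_ * _); set v := `|u x|; set z := 128 / _.
move=> h3 h4 h6 h7 tu Ct.
have : (1 - e) * t <= (1 - e) * v by rewrite ler_wpM2l// subr_ge0; lra.
rewrite !mulrBl !mul1r (mulrC e v) in h7 *; move: h3 h4 h6 h7 Ct.
rewrite -mulrA; move: (e * t) (v * e) (v * z) => et ve vz; lra.
Qed.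

(** The oscillation bound is quadratic in [L = d * r]: [d ^+ 2] doubles the exponent [16 pi^2] to
    the critical [32 pi^2], and [r ^+ 2 = q / 8] supplies the factor [q]. *)
Lemma level_majorant u (e t q : R) : Cinf_c u -> \int[lam]_x (lap u x ^+ 2) <= 1 ->
  0 < q -> q <= 8 -> hyp_sqr u <= q -> 0 < e -> 3 * e < 1 -> 0 < t -> level_cst <= e * t ->
  2 ^+ 9 * expR (- (16 * pi ^+ 2 * ((1 - 3 * e) * t) ^+ 2)) <= e ->
  exists Phi : 'rV[R]_4 -> \bar R, [/\ measurable_fun setT Phi, (forall x, 0 <= Phi x)%E,
    (forall x, B4 x -> t <= `|u x| -> (((e * t) ^+ 2 * (W x ^+ 4)^-1)%:E <= Phi x)%E) &
    (\int[lam]_x Phi x <= (2 ^+ 9 * 36 ^+ 4 * q *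
      expR (- (32 * pi ^+ 2 * ((1 - 3 * e) * t) ^+ 2)))%:E)%E].
Proof.
move=> cu E1 q0 q8 uq e0 e3 t0 Ct de.
pose d := expR (- (16 * pi ^+ 2 * ((1 - 3 * e) * t) ^+ 2)).
pose r := Num.sqrt (q / 8).
have r0 : 0 < r by rewrite sqrtr_gt0 divr_gt0.
have rq : r ^+ 2 = q / 8 by rewrite sqr_sqrtr// divr_ge0// ltW.
have d0 : 0 < d by rewrite expR_gt0.
have [Phi [mP P0 PB PI]] := local_oscillation_bound (mulr_gt0 d0 r0) cu E1.
exists Phi; split=> //.
- move=> x Bx tu; apply: le_trans (PB x Bx).
  rewrite lee_fin mulrC ler_wpM2l ?invr_ge0 ?exprn_even_ge0//.
  exact: (level_oscillation cu E1 Bx q0 q8 uq r0 rq e0 e3 t0 Ct).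
apply: (le_trans PI); rewrite lee_fin exprMn rq.
rewrite (_ : d ^+ 2 = expR (- (32 * pi ^+ 2 * ((1 - 3 * e) * t) ^+ 2))); last first.
  rewrite expr2 -expRD; congr expR; move: (_ ^+ 2) (pi ^+ 2) => a b.
  by ring.
rewrite le_eqVlt; apply/orP; left; apply/eqP.
by move: (expR _) (36 ^+ 4) => a b; field.
Qed.

End level_sets.

(** * Summation over the levels *)

Section subcritical.
Variable R : realType.
Implicit Types (u : 'rV[R]_4 -> R) (x : 'rV[R]_4).
Local Notation lam := (@lebesgue_rV4 R).

Lemma geometric_sum_le (r : R) n m : 0 <= r -> r < 1 ->
  \sum_(n <= k < m) r ^+ k <= (1 - r)^-1.
Proof.
move=> r0 r1.
have h k : \sum_(0 <= i < k) r ^+ i <= (1 - r)^-1.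
  rewrite -[leRHS]mul1r ler_pdivlMr ?subr_gt0//.
  have -> : (\sum_(0 <= i < k) r ^+ i) * (1 - r) = 1 - r ^+ k.
    elim: k => [|k IH]; first by rewrite big_geq// mul0r expr0 subrr.
    by rewrite big_nat_recr//= mulrDl IH exprS; ring.
  by rewrite gerBl exprn_ge0.
apply: le_trans (h m).
have [nm|mn] := leqP n m; last by rewrite big_geq ?(ltnW mn)//; apply: sumr_ge0 => i _; exact: exprn_ge0.
by rewrite (big_cat_nat (leq0n n) nm)/= lerDr; apply: sumr_ge0 => i _; exact: exprn_ge0.
Qed.

Lemma expRM1_le (y : R) : 0 <= y -> expR y - 1 <= y * expR y.
Proof.
move=> y0; have := expR_ge1Dx (- y); rewrite expRN => h.
have e0 := expR_gt0 y.
rewrite -ler_pdivrMr// mulrBl divff ?gt_eqF// mul1r.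
by move: (expR y)^-1 h => a; lra.
Qed.

(** Below [n0], [e^y - 1 <= y e^y] pays with a multiple of [v], which will integrate to the squared
    norm. Above it, [v] lies in some [[n, n + 1)] and the single term [P n] is enough. *)
Lemma level_split (a c : R) (n0 N : nat) v (P : nat -> \bar R) : 0 < a -> 0 <= v -> 0 <= c ->
  v < N%:R -> (forall n, 0 <= P n)%E ->
  (forall n, (n0 <= n)%N -> n%:R <= v -> ((expR (a * n.+1%:R) * c)%:E <= P n)%E) ->
  (((expR (a * v) - 1) * c)%:E <= (a * expR (a * n0%:R) * (v * c))%:E + \sum_(n0 <= n < N) P n)%E.
Proof.
move=> a0 v0 c0 vN P0 PB.
have S0 : (0 <= \sum_(n0 <= n < N) P n)%E by exact: sume_ge0.
have av : 0 <= a * v by rewrite mulr_ge0// ltW.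
have [vn|nv] := ltP v n0%:R.
  apply: (@le_trans _ _ (a * expR (a * n0%:R) * (v * c))%:E); last by rewrite leeDl.
  rewrite lee_fin mulrA ler_wpM2r//; apply: (le_trans (expRM1_le av)).
  rewrite [leRHS]mulrAC; apply: ler_wpM2l => //.
  by rewrite ler_expR; apply: ler_wpM2l; exact: ltW.
have /andP[nv1 nv2] := truncn_itv v0.
set n := Num.truncn v in nv1 nv2.
have nn0 : (n0 <= n)%N by rewrite -ltnS -(ltr_nat R); exact: le_lt_trans nv nv2.
have nN : (n < N)%N by rewrite -(ltr_nat R); exact: le_lt_trans nv1 vN.
apply: (@le_trans _ _ (\sum_(n0 <= n < N) P n)%E); last first.
  by rewrite leeDr// lee_fin mulr_ge0// mulr_ge0 ?expR_ge0// ltW.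
apply: (@le_trans _ _ (P n)).
  apply: le_trans (PB n nn0 nv1); rewrite lee_fin ler_wpM2r//.
  have : expR (a * v) <= expR (a * n.+1%:R) by rewrite ler_expR ler_wpM2l// ltW// ltW.
  by move: (expR _) (expR _) => p q; lra.
rewrite (big_cat_nat nn0 (ltnW nN))/= (big_ltn nN)/=.
apply: (@le_trans _ _ (P n + \sum_(n.+1 <= i < N) P i)%E); first by rewrite leeDl// sume_ge0.
by rewrite leeDr// sume_ge0.
Qed.

(** [u] is bounded, so finitely many levels occur; their number [N] depends on [u], the later bound
    of the sum does not. [c n] turns the majorant of level [n] into the weight [W^-4], and 16 comes
    from the density [(2 / W)^4]. *)
Lemma hyp_integral_le u (a : R) (n0 : nat) (c I : nat -> R) : Cinf_c u -> 0 < a ->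
  (forall n, 0 <= c n) ->
  (forall n, (n0 <= n)%N -> exists Phi : 'rV[R]_4 -> \bar R, [/\ measurable_fun setT Phi,
    (forall x, 0 <= Phi x)%E,
    (forall x, B4 x -> n%:R <= u x ^+ 2 -> (((W x ^+ 4)^-1)%:E <= (c n)%:E * Phi x)%E) &
    (\int[lam]_x Phi x <= (I n)%:E)%E]) ->
  exists N, (\int[@hyp_vol R]_x (expR (a * u x ^+ 2) - 1)%:E <=
    (a * expR (a * n0%:R) * hyp_sqr u +
     \sum_(n0 <= n < N) 16 * expR (a * n.+1%:R) * c n * I n)%:E)%E.
Proof.
move=> cu a0 c0 H; have su := Cinf_c_smooth cu; have bu := Cinf_c_bounded_support cu.
(* Levels below [n0] receive the zero function, so that a majorant can be chosen for every [n]. *)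
have H' n : exists Phi : 'rV[R]_4 -> \bar R, [/\ measurable_fun setT Phi, (forall x, 0 <= Phi x)%E,
    ((n0 <= n)%N -> forall x, B4 x -> n%:R <= u x ^+ 2 -> (((W x ^+ 4)^-1)%:E <= (c n)%:E * Phi x)%E) &
    ((n0 <= n)%N -> (\int[lam]_x Phi x <= (I n)%:E)%E)].
  have [nn|nn] := boolP (n0 <= n)%N; last by exists (fun=> 0%E); split.
  by have [P [p1 p2 p3 p4]] := H n nn; exists P; split.
have [Phi PH] := choice H'.
have mP n : measurable_fun setT (Phi n) by have [] := PH n.
have P0 n x : (0 <= Phi n x)%E by have [_ + _ _] := PH n; exact.
have [C C0 uC] := bounded_support_bounded (Ck_continuous (su 0%N)) bu.
have uu0 : 0 <= C ^+ 2 by rewrite sqr_ge0.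
pose N := Num.bound (C ^+ 2).
have uN x : u x ^+ 2 < N%:R.
  apply: le_lt_trans (archi_boundP uu0).
  by rewrite -[leLHS]real_normK ?num_real// ler_sqr ?nnegrE.
exists N.
have mu0 := continuous_measurable_rV4 (Ck_continuous (su 0%N)).
have mu2 : measurable_fun setT (fun x => u x ^+ 2) by exact: measurable_funX.
have me : measurable_fun setT (fun x => (expR (a * u x ^+ 2) - 1)%:E).
  apply/measurable_EFinP; apply: measurable_funB => //.
  by apply: measurableT_comp => //; exact: measurable_funM.
have e0 x : (0 <= (expR (a * u x ^+ 2) - 1)%:E)%E.
  rewrite lee_fin subr_ge0 -expR0 ler_expR mulr_ge0 ?sqr_ge0// ltW//.
rewrite ge0_integral_hyp_vol// integral_mkcond.
pose k n := 16 * expR (a * n.+1%:R) * c n.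
have k0 n : 0 <= k n by rewrite mulr_ge0// mulr_ge0 ?expR_ge0.
pose h x := (u x / W x ^+ 2) ^+ 2.
have mh : measurable_fun setT h.
  apply: measurable_funX; apply: measurable_funM => //.
  apply: (measurableT_comp (@measurable_invr R)); apply: measurable_funX.
  by apply: measurable_funB => //; exact: measurable_sqnorm.
have ae0 : 0 <= a * expR (a * n0%:R) * 16 by rewrite !mulr_ge0 ?expR_ge0// ltW.
apply: (@le_trans _ _ (\int[lam]_x ((a * expR (a * n0%:R) * 16)%:E * (h x)%:E +
    \sum_(n0 <= n < N) (k n)%:E * Phi n x))%E).
  have S0 x : (0 <= \sum_(n0 <= n < N) (k n)%:E * Phi n x)%E.
    by apply: sume_ge0 => n _; rewrite mule_ge0// lee_fin.
  apply: ge0_le_integral_any => x; rewrite patchE; case: ifPn => // Bx.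
  - by rewrite mule_ge0// lee_fin conf4_ge0.
  - rewrite -EFinM conf_W.
    move: Bx; rewrite inE => Bx; have Wx : 0 < W x by rewrite -W_gt0.
    have cW : 0 <= (2 / W x) ^+ 4 by rewrite exprn_even_ge0.
    have := @level_split a ((2 / W x) ^+ 4) n0 N (u x ^+ 2) (fun n => (k n)%:E * Phi n x)%E a0 (sqr_ge0 _) cW (uN x).
    move=> h0; apply: le_trans (h0 _ _) _.
    + by move=> n; rewrite mule_ge0// lee_fin.
    + move=> n nn nu; have [_ _ + _] := PH n => /(_ nn x Bx nu) h1.
      rewrite /k (EFinM _ (c n)) -muleA.
      apply: le_trans (lee_wpmul2l _ h1); last by rewrite lee_fin mulr_ge0 ?expR_ge0.
      rewrite -EFinM lee_fin le_eqVlt; apply/orP; left; apply/eqP.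
      by move: (expR _) => b; field; rewrite gt_eqF.
    apply: leeD2r; rewrite -EFinM lee_fin le_eqVlt; apply/orP; left; apply/eqP; rewrite /h.
    by move: (expR _) => b; field; rewrite gt_eqF.
  - by rewrite adde_ge0// -EFinM lee_fin mulr_ge0 ?sqr_ge0.
rewrite ge0_integralD//; last 4 first.
- by move=> x _; rewrite -EFinM lee_fin mulr_ge0 ?sqr_ge0.
- by apply: emeasurable_funM; [exact: measurable_cst|exact/measurable_EFinP].
- by move=> x _; apply: sume_ge0 => n _; rewrite mule_ge0// lee_fin.
- by apply: emeasurable_sum => n; apply: emeasurable_funM => //; exact: measurable_cst.
rewrite EFinD; apply: leeD.
  rewrite ge0_integralZl//; last 2 first.
  - exact/measurable_EFinP.
  - by move=> x _; rewrite lee_fin sqr_ge0.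
  rewrite hyp_sqrE// -EFinM lee_fin le_eqVlt; apply/orP; left; apply/eqP.
  by move: (expR _) => b; field.
rewrite ge0_integral_sum//; last 2 first.
- by move=> n; apply: emeasurable_funM => //; exact: measurable_cst.
- by move=> n x _; rewrite mule_ge0// lee_fin.
rewrite -sumEFin !big_nat; apply: lee_sum => n /andP[nn _].
apply: (@le_trans _ _ ((k n)%:E * (I n)%:E)%E); last by rewrite -EFinM.
rewrite ge0_integralZl//; last by rewrite lee_fin.
apply: lee_wpmul2l; first by rewrite lee_fin.
by have [_ _ _] := PH n; exact.
Qed.

Lemma exists_gap (al : R) : 0 < al -> al < 32 * pi ^+ 2 ->
  exists2 e : R, 0 < e & 3 * e < 1 /\ al < 32 * pi ^+ 2 * (1 - 3 * e) ^+ 2.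
Proof.
have p0 := @pi_gt0 R; move: (pi : R) p0 => p p0 a0 ap.
have P0 : 0 < 32 * p ^+ 2 by rewrite mulr_gt0// exprn_gt0.
pose s := Num.sqrt (al / (32 * p ^+ 2)).
have s0 : 0 < s by rewrite sqrtr_gt0 divr_gt0.
have s2 : s ^+ 2 = al / (32 * p ^+ 2) by rewrite sqr_sqrtr// divr_ge0// ltW.
have s1 : s < 1.
  rewrite -(@ltr_pXn2r _ 2)// ?nnegrE ?(ltW s0)// s2 expr1n ltr_pdivrMr// mul1r //.
(* Then [1 - 3 e] is the midpoint of [s] and 1, where [s] is the square root of [al / (32 pi^2)]. *)
exists ((1 - s) / 6); first by rewrite divr_gt0// subr_gt0.
split; first by lra.
rewrite (_ : 1 - 3 * _ = (1 + s) / 2); last by field.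
rewrite -ltr_pdivrMl// mulrC -s2 ltr_pXn2r// ?nnegrE ?(ltW s0)//; lra.
Qed.

Lemma level_condition (e : R) : 0 < e -> 3 * e < 1 -> exists2 n0 : nat, (0 < n0)%N &
  forall n, (n0 <= n)%N -> level_cst R <= e * Num.sqrt n%:R /\
   2 ^+ 9 * expR (- (16 * pi ^+ 2 * ((1 - 3 * e) * Num.sqrt n%:R) ^+ 2)) <= e.
Proof.
move=> e0 e3; have p0 := @pi_gt0 R.
pose g := 16 * pi ^+ 2 * (1 - 3 * e) ^+ 2.
have g0 : 0 < g.
  rewrite /g; apply: mulr_gt0; last by apply: exprn_gt0; rewrite subr_gt0.
  by apply: mulr_gt0; [rewrite ltr0n|exact: exprn_gt0].
(* The sum of the thresholds of the two conditions; for the second one [g n <= e^(g n)] suffices. *)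
pose X := (level_cst R / e) ^+ 2 + 2 ^+ 9 / (e * g).
have X0 : 0 <= X.
  apply: addr_ge0; first exact: sqr_ge0.
  by apply: divr_ge0; [exact: exprn_ge0|rewrite mulr_ge0// ltW].
exists (Num.bound X).+1 => // n nX.
have Xn : X <= n%:R.
  apply: (le_trans (ltW (archi_boundP X0))); rewrite ler_nat; exact: ltnW.
have n0 : 0 < n%:R :> R by rewrite ltr0n (leq_trans _ nX).
have sq : Num.sqrt n%:R ^+ 2 = n%:R :> R by rewrite sqr_sqrtr// ltW.
have b0 : 0 <= 2 ^+ 9 / (e * g).
  by apply: divr_ge0; [exact: exprn_ge0|rewrite mulr_ge0// ltW].
split.
  have l0 : 0 <= level_cst R by rewrite addr_ge0 ?sqrtr_ge0.
  rewrite mulrC -ler_pdivrMr// -ler_sqr ?nnegrE ?sqrtr_ge0 ?(divr_ge0 l0 (ltW e0))//.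
  by rewrite sq; apply: le_trans Xn; rewrite /X lerDl.
rewrite exprMn sq mulrA -/g expRN.
have h : g * n%:R <= expR (g * n%:R) := expR_ge_id _.
have gn : 0 < g * n%:R := mulr_gt0 g0 n0.
apply: (@le_trans _ _ (2 ^+ 9 * (g * n%:R)^-1)).
  apply: ler_wpM2l; first exact: exprn_ge0.
  by rewrite lef_pV2 ?posrE ?expR_gt0.
rewrite ler_pdivrMr// mulrA mulrC -ler_pdivrMr; last exact: mulr_gt0.
by apply: le_trans Xn; rewrite /X lerDr sqr_ge0.
Qed.

Lemma adams_subcritical (al : R) : 0 < al -> al < 32 * pi ^+ 2 ->
  exists C : R, 0 < C /\ adams_ineq al C.
Proof.
move=> a0 /(exists_gap a0)[e e0 [e3 ae]].
have [n0 n00 Hn0] := level_condition e0 e3.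
pose be := 32 * pi ^+ 2 * (1 - 3 * e) ^+ 2.
(* The ratio of the series over levels: [e^(al n)] from the integrand against [e^(- be n)] from the
   level sets. *)
pose r := expR (- (be - al)).
have r1 : r < 1 by rewrite expR_lt1 oppr_lt0 subr_gt0.
have r0 : 0 <= r := expR_ge0 _.
(* [expR al] is the loss from [n] to [n + 1] in the exponential, [e^-2] the loss from the fraction
   [e t] of the level, and the last factor is that of [level_majorant]. *)
pose M := 16 * expR al * (e ^+ 2)^-1 * (2 ^+ 9 * 36 ^+ 4).
have M0 : 0 <= M.
  rewrite /M; apply: mulr_ge0; last by apply: mulr_ge0; exact: exprn_ge0.
  by rewrite mulr_ge0 ?invr_ge0 ?sqr_ge0// mulr_ge0 ?expR_ge0.
pose K := M * (1 - r)^-1.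
have K0 : 0 <= K by rewrite mulr_ge0// invr_ge0 subr_ge0 ltW.
pose A := al * expR (al * n0%:R).
have A0 : 0 < A by rewrite mulr_gt0 ?expR_gt0.
(* [q] is only an upper bound of the squared norm: the scale built from it has to be positive even
   when the norm is 0. *)
have key u q : Cinf_c u -> \int[lam]_x (lap u x ^+ 2) <= 1 -> 0 < q -> q <= 8 -> hyp_sqr u <= q ->
    (\int[@hyp_vol R]_x (expR (al * u x ^+ 2) - 1)%:E <= (A * hyp_sqr u + K * q)%:E)%E.
  move=> cu E1 q0 q8 uq.
  (* The inverse of [(e t)^2] at the level [t = sqrt n]. *)
  pose c (n : nat) := (e ^+ 2 * n%:R)^-1.
  pose I (n : nat) := 2 ^+ 9 * 36 ^+ 4 * q * expR (- (be * n%:R)).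
  have c0 n : 0 <= c n by rewrite invr_ge0 mulr_ge0// sqr_ge0.
  have [] := @hyp_integral_le u al n0 c I cu a0 c0.
    move=> n nn; have [h1 h2] := Hn0 n nn.
    have np : 0 < n%:R :> R by rewrite ltr0n (leq_trans n00 nn).
    have sn0 : 0 < Num.sqrt n%:R :> R by rewrite sqrtr_gt0.
    have sq : Num.sqrt n%:R ^+ 2 = n%:R :> R by rewrite sqr_sqrtr// ltW.
    have [Phi [p1 p2 p3 p4]] := level_majorant cu E1 q0 q8 uq e0 e3 sn0 h1 h2.
    exists Phi; split=> //; last first.
      by move: p4; rewrite !exprMn sq [X in expR (- X)]mulrA.
    move=> x Bx nu.
    have := p3 x Bx; rewrite exprMn sq => /(_ _)/(lee_wpmul2l (c0 n : (0 <= (c n)%:E)%E)) h.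
    apply: le_trans (h _).
      rewrite -EFinM lee_fin mulrA /c mulVf ?mul1r// gt_eqF// mulr_gt0// exprn_gt0//.
    rewrite -ler_sqr ?nnegrE ?(ltW sn0)// sq real_normK ?num_real//.
  move=> N /le_trans; apply; rewrite lee_fin -/A lerD2l.
  apply: (@le_trans _ _ (\sum_(n0 <= n < N) M * q * r ^+ n)).
    rewrite !big_nat; apply: ler_sum => n /andP[nn _].
    have n1 : 1 <= n%:R :> R by rewrite ler1n (leq_trans n00 nn).
    have rn : r ^+ n = expR (- (be * n%:R)) * expR (al * n%:R).
      by rewrite -expRM_natl -expRD; congr expR; ring.
    have an : expR (al * n.+1%:R) = expR al * expR (al * n%:R).
      by rewrite -expRD; congr expR; rewrite -natr1; ring.
    rewrite rn an /I /c /M invfM.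
    have E0 := expR_ge0 (al * n%:R); have E1' := expR_ge0 (- (be * n%:R)).
    have Ea := expR_ge0 al.
    have e20 : 0 <= (e ^+ 2)^-1 by rewrite invr_ge0 sqr_ge0.
    have nV : n%:R^-1 <= 1 :> R by rewrite invf_le1// (lt_le_trans ltr01).
    have D0 : 0 <= 2 ^+ 9 * 36 ^+ 4 :> R by apply: mulr_ge0; exact: exprn_ge0.
    move: (2 ^+ 9 * 36 ^+ 4) D0 (expR al) Ea (expR (al * n%:R)) E0 (expR (- (be * n%:R))) E1' ((e ^+ 2)^-1) e20.
    move=> D D0 b b0 f f0 g g0 k k0.
    rewrite [leLHS](_ : _ = 16 * b * k * D * q * (g * f) * n%:R^-1); last by ring.
    rewrite -[leRHS]mulr1 ler_wpM2l//.
    by rewrite !mulr_ge0// ltW.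
  rewrite -mulr_sumr /K [leRHS]mulrAC ler_wpM2l ?geometric_sum_le//.
  by rewrite mulr_ge0// ltW.
exists (A + K); split; first by rewrite ltr_pwDl.
move=> u cu; rewrite Paneitz_energy// lee_fin => E1.
rewrite Lnorm_hyp_sqr// -EFinM.
have N0 : 0 <= hyp_sqr u.
  by apply: Rintegral_ge0 => x _; rewrite mulr_ge0 ?sqr_ge0// exprn_even_ge0.
have N4 : hyp_sqr u <= 4.
  by apply: (le_trans (hyp_sqr_le cu)); rewrite -[leRHS]mulr1 ler_wpM2l.
have [N00|Np] := eqVneq (hyp_sqr u) 0; last first.
  rewrite mulrDl; apply: key => //; first by rewrite lt_def Np.
  by apply: le_trans N4 _; rewrite ler_nat.
(* For vanishing norm, [key] bounds the integral by [K q] for arbitrarily small positive [q], so it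
   is at most every [d > 0]. *)
rewrite N00 mulr0; apply/lee_addgt0Pr => d d0; rewrite add0e.
pose q := Num.min 8 (d / (K + 1)).
have K1 : 0 < K + 1 by rewrite ltr_wpDl.
have q0 : 0 < q by rewrite lt_min ltr0n divr_gt0.
apply: (le_trans (key u q cu E1 q0 _ _)); first by rewrite ge_min lexx.
  by rewrite N00 ltW.
rewrite lee_fin N00 mulr0 add0r.
apply: (@le_trans _ _ (K * (d / (K + 1)))); first by rewrite ler_wpM2l// ge_min lexx orbT.
by rewrite mulrA ler_pdivrMr// mulrC ler_wpM2l// ?ltW// ltrDl.
Qed.

End subcritical.

(** * Supercritical exponents *)

Section flat_functions.
Variable R : realType.
Implicit Types (f g : R -> R).

Lemma Ck1_intro k g dg : (forall t : R, is_derive t 1 g (dg t)) -> Ck1 k dg -> Ck1 k.+1 g.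
Proof.
move=> H Cdg; split.
  by move=> t; apply: differentiable_continuous; apply/derivable1_diffP; case: (H t).
split; first by move=> t; case: (H t).
rewrite (_ : derive1 g = dg)//; apply/funext => t.
by rewrite derive1E; apply: derive_val.
Qed.

Lemma derive1_eq g dg : (forall t : R, is_derive t 1 g (dg t)) -> derive1 g = dg.
Proof. by move=> H; apply/funext => t; rewrite derive1E; apply: derive_val. Qed.

Lemma Ck1_lin k f g (a b : R) : Ck1 k f -> Ck1 k g -> Ck1 k (fun t => a * f t + b * g t).
Proof.
elim: k f g => [|k IH] f g Cf Cg.
  move=> t; apply: (@continuousD _ _ _ (fun t => a * f t) (fun t => b * g t) t).
    by apply: (@continuousM _ _ (cst a) f t); [exact: cst_continuous|exact: Cf].
  by apply: (@continuousM _ _ (cst b) g t); [exact: cst_continuous|exact: Cg].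
move: Cf Cg => [_ [df Cf]] [_ [dg Cg]].
apply: (@Ck1_intro _ _ (fun t => a * derive1 f t + b * derive1 g t)); last exact: IH.
move=> t.
have f' : is_derive t 1 f (derive1 f t) by rewrite derive1E; split => //; exact: df.
have g' : is_derive t 1 g (derive1 g t) by rewrite derive1E; split => //; exact: dg.
have := is_deriveD (is_deriveM (is_derive_cst a t 1) f') (is_deriveM (is_derive_cst b t 1) g').
by move=> /is_derive_eq; apply; rewrite /GRing.scale/= !mulr0 !addr0.
Qed.

Lemma is_derive0_sqr f (C : R) : f 0 = 0 -> (forall h, `|f h| <= C * h ^+ 2) ->
  is_derive (0 : R) 1 f 0.
Proof.
move=> f0 fC.
have C0 : 0 <= C by have := fC 1; rewrite expr1n mulr1; apply: le_trans.
have E : (fun h : R => h^-1 *: ((f \o shift (0 : R)) (h *: 1) - f 0)) @ 0^' --> (0 : R).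
  apply/cvgrPdist_lt => e e0.
  have d0 : 0 < e / (C + 1) by rewrite divr_gt0// ltr_wpDl.
  near=> h.
  have hn0 : h != 0 by near: h; exact: nbhs_dnbhs_neq.
  rewrite /= sub0r normrN f0 subr0 /shift addr0 [h *: 1]mulr1 /GRing.scale/= normrM normfV.
  rewrite ltr_pdivrMl ?normr_gt0//; apply: (le_lt_trans (fC h)).
  rewrite -(real_normK (num_real h)) expr2 mulrCA ltr_pM2l ?normr_gt0//.
  apply: (@le_lt_trans _ _ ((C + 1) * `|h|)); first by rewrite ler_wpM2r// lerDl.
  rewrite mulrC -ltr_pdivlMr ?ltr_wpDl//.
  near: h; apply: dnbhs0_lt; exact: d0.
split; first by apply/cvg_ex; exists (0 : R).
by apply/cvg_lim.
Unshelve. all: by end_near. Qed.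

(* Up to linear combinations the family [flat n] is closed under derivation. *)
Definition flat (n : nat) (t : R) : R := if 0 < t then t^-1 ^+ n * expR (- 6 * t^-1) else 0.

Lemma flat_ge0 n t : 0 <= flat n t.
Proof.
rewrite /flat; case: ifPn => // t0.
by rewrite mulr_ge0 ?expR_ge0// exprn_ge0// invr_ge0 ltW.
Qed.

(** This quadratic bound yields the vanishing derivative of [flat n] at 0, through
    [is_derive0_sqr]. *)
Lemma flat_sqr n t : `|flat n t| <= n.+2%:R ^+ n.+2 * t ^+ 2.
Proof.
rewrite ger0_norm ?flat_ge0// /flat; case: ifPn => [t0|_]; last first.
  by rewrite mulr_ge0 ?sqr_ge0// exprn_ge0.
have y0 : 0 < t^-1 by rewrite invr_gt0.
(* The power [n + 2] leaves [t ^+ 2] after cancelling [t^-1 ^+ n]; the exponential dominates it by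
   [(y / m)^m <= e^y]. *)
set m := n.+2; have m0 : 0 < m%:R :> R by rewrite ltr0n.
have h : (t^-1 / m%:R) ^+ m <= expR (6 * t^-1).
  apply: (@le_trans _ _ (expR (t^-1 / m%:R) ^+ m)).
    by rewrite lerXn2r ?nnegrE ?expR_ge0 ?divr_ge0 ?(ltW y0)//; exact: expR_ge_id.
  rewrite -expRM_natl ler_expR mulrCA divff ?gt_eqF// mulr1.
  by rewrite -[leLHS]mul1r ler_wpM2r ?(ltW y0)// ler1n.
rewrite mulNr expRN ler_pdivrMr ?expR_gt0//.
apply: le_trans (ler_wpM2l _ h); last by rewrite mulr_ge0 ?sqr_ge0// exprn_ge0.
rewrite expr_div_n /m le_eqVlt; apply/orP; left; apply/eqP.
have -> : t^-1 ^+ n.+2 = t^-1 ^+ n * t^-1 ^+ 2 by rewrite -addn2 exprD.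
rewrite -/m.
have : (m%:R ^+ m : R) != 0 by rewrite expf_neq0// gt_eqF.
have tn0 : t != 0 by rewrite gt_eqF.
by move: (m%:R ^+ m) (t^-1 ^+ n) => a b an0; field; rewrite an0 tn0.
Qed.

Lemma is_derive_invexp n (y : R) : is_derive y 1 (fun y : R => y ^+ n * expR (- 6 * y))
  ((n%:R * y ^+ n.-1 - 6 * y ^+ n) * expR (- 6 * y)).
Proof.
have d2 := is_derive1_comp (is_derive_expR (- 6 * y)) (is_derive_mull (- 6) y).
case: n => [|n].
  have -> : (fun y : R => y ^+ 0 * expR (- 6 * y)) = expR \o (fun r => - 6 * r).
    by apply/funext => r; rewrite expr0 mul1r.
  by apply: (is_derive_eq d2); rewrite expr0; ring.
apply: (is_derive_eq (is_deriveM (is_derive_exprn n y) d2)).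
by rewrite /GRing.scale/= exprS; ring.
Qed.

Lemma is_derive_flat n (t : R) :
  is_derive t 1 (flat n) (6 * flat n.+2 t + - n%:R * flat n.+1 t).
Proof.
have [t0|t0|->] := ltgtP t 0; last first.
- have z k : flat k 0 = 0 by rewrite /flat ltxx.
  rewrite !z !mulr0 addr0; exact: (is_derive0_sqr (z n) (flat_sqr n)).
- have ny : {near t, (fun t => t^-1 ^+ n * expR (- 6 * t^-1)) =1 flat n}.
    have : nbhs t [set r | 0 < r] by apply: open_nbhs_nbhs; split=> //; exact: open_gt.
    by apply: filterS => r r0; rewrite /flat ifT.
  apply: (near_eq_is_derive ny).
  have tn0 : t != 0 by rewrite gt_eqF.
  have dV : is_derive t 1 (fun r : R => r^-1) (- (t^-1 ^+ 2)).
    apply: (is_derive_eq (is_deriveV tn0 (is_derive_id t (1 : R)))).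
    by rewrite /GRing.scale/= mulr1 exprVn.
  have := is_derive1_comp (is_derive_invexp n t^-1) dV.
  move=> /is_derive_eq; apply; rewrite /flat t0.
  by case: n {ny} => [|n]; rewrite /= ?exprS ?expr0; ring.
- have z k : flat k t = 0 by rewrite /flat ifF//; apply/negbTE; rewrite -leNgt ltW.
  have ny : {near t, (fun=> 0) =1 flat n}.
    have : nbhs t [set r | r < 0] by apply: open_nbhs_nbhs; split=> //; exact: open_lt.
    by apply: filterS => r r0; rewrite /flat ifF//; apply/negbTE; rewrite -leNgt ltW.
  apply: (near_eq_is_derive ny); rewrite !z !mulr0 addr0.
  exact: is_derive_cst.
Qed.

Lemma Ck1_flat k n : Ck1 k (flat n).
Proof.
elim: k n => [|k IH] n.
  move=> t; apply: differentiable_continuous; apply/derivable1_diffP.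
  by case: (is_derive_flat n t).
apply: (Ck1_intro (is_derive_flat n)); exact: Ck1_lin.
Qed.

(* A smooth version of the positive part: [0 <= softplus' <= 1] and [0 <= softplus'' <= 1]
   make the Laplacian of [softplus \o w] no larger than that of [w]. *)
Definition softplus (t : R) := t * flat 0 t.

Lemma is_derive_softplus (t : R) : is_derive t 1 softplus (1 * flat 0 t + 6 * flat 1 t).
Proof.
have := is_deriveM (is_derive_id t (1 : R)) (is_derive_flat 0 t).
move=> /is_derive_eq; apply; rewrite /GRing.scale/=.
have -> : flat 1 t = t * flat 2 t.
  rewrite /flat; case: ifPn => t0; last by rewrite mulr0.
  by field; rewrite gt_eqF.
by ring.
Qed.

Lemma is_derive_softplus1 (t : R) :
  is_derive t 1 (fun t => 1 * flat 0 t + 6 * flat 1 t) (36 * flat 3 t).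
Proof.
have := is_deriveD (is_deriveM (is_derive_cst (1 : R) t 1) (is_derive_flat 0 t)) (is_deriveM (is_derive_cst (6 : R) t 1) (is_derive_flat 1 t)).
move=> /is_derive_eq; apply; rewrite /GRing.scale/= !mulr0 !addr0; ring.
Qed.

Lemma Ck1_softplus k : Ck1 k softplus.
Proof.
apply: Ck1W; apply: (Ck1_intro is_derive_softplus).
by apply: Ck1_lin; exact: Ck1_flat.
Qed.

Lemma softplus1_ge0 t : 0 <= 1 * flat 0 t + 6 * flat 1 t.
Proof. by rewrite addr_ge0 ?mulr_ge0 ?flat_ge0. Qed.

Lemma softplus1_le1 t : 1 * flat 0 t + 6 * flat 1 t <= 1.
Proof.
rewrite /flat; case: ifPn => t0; last by rewrite !mulr0 addr0 ler01.
have y0 : 0 < t^-1 by rewrite invr_gt0.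
move: (t^-1) y0 => y y0; rewrite expr0 expr1 mulNr expRN.
have := expR_ge1Dx (6 * y); have e0 := expR_gt0 (6 * y) => h.
rewrite [leLHS](_ : _ = (1 + 6 * y) / expR (6 * y)); last by field; rewrite gt_eqF.
by rewrite ler_pdivrMr// mul1r.
Qed.

Lemma softplus2_ge0 t : 0 <= 36 * flat 3 t.
Proof. by rewrite mulr_ge0 ?flat_ge0. Qed.

(** Explains the 6 in [flat]: the cubic term [(6 y)^3 / 3!] of the exponential series is exactly
    [36 y^3]. *)
Lemma softplus2_le1 t : 36 * flat 3 t <= 1.
Proof.
rewrite /flat; case: ifPn => t0; last by rewrite mulr0 ler01.
have y0 : 0 < t^-1 by rewrite invr_gt0.
move: (t^-1) y0 => y y0; rewrite mulNr expRN mulrA ler_pdivrMr ?expR_gt0// mul1r.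
have y60 : 0 <= 6 * y by rewrite mulr_ge0// ltW.
have := expR_ge1Dxn 2 y60; rewrite (_ : 3`! = 6)// => h.
apply: le_trans h; rewrite (_ : (6 * y) ^+ 3 / 6%:R = 36 * y ^+ 3); last by field.
by rewrite lerDr.
Qed.

Lemma softplus_le0 t : t <= 0 -> softplus t = 0.
Proof. by move=> t0; rewrite /softplus /flat ifF ?mulr0//; apply/negbTE; rewrite -leNgt. Qed.

Lemma softplus_ge t : t - 6 <= softplus t.
Proof.
rewrite /softplus /flat; case: ifPn => t0; last by rewrite -leNgt in t0; lra.
rewrite expr0 mul1r; have := expR_ge1Dx (- 6 * t^-1) => h.
have := ler_wpM2l (ltW t0) h; apply: le_trans.
by rewrite mulrDr mulr1 mulrCA divff ?gt_eqF// mulr1.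
Qed.

Lemma softplus_ge0 t : 0 <= softplus t.
Proof.
have [t0|t0] := leP t 0; first by rewrite softplus_le0.
by rewrite mulr_ge0 ?flat_ge0// ltW.
Qed.

Lemma softplus_le t : 0 < t -> softplus t <= t.
Proof.
move=> t0; rewrite /softplus -[leRHS]mulr1 ler_wpM2l ?(ltW t0)// /flat t0 expr0 mul1r.
by rewrite -expR0 ler_expR mulNr oppr_le0 mulr_ge0// invr_ge0 ltW.
Qed.

End flat_functions.

(** * Smooth truncations of the logarithm *)

Section radial.
Variable R : realType.
Implicit Types (x : 'rV[R]_4) (i : 'I_4).

(** [P] is a family of profiles stable under derivation. Derivatives are only asked for [r >= 0],
    where [sqnorm] takes its values, because the logarithm and the negative powers used as profiles
    are singular at [r = - e]. *)
Lemma Ck_radial (P : (R -> R) -> Prop) :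
  (forall g, P g -> exists2 dg, P dg & forall r : R, 0 <= r -> is_derive r 1 g (dg r)) ->
  forall k g, P g -> Ck k (g \o @sqnorm R).
Proof.
move=> H; elim=> [|k IH] g Pg; have [dg Pdg D] := H g Pg.
  move=> x; apply: continuous_comp; first exact: (@Ck_sqnorm R 0%N).
  apply: differentiable_continuous; apply/derivable1_diffP.
  by case: (D _ (sqnorm_ge0 x)).
apply: (@Ck_intro _ _ _ (fun i x => dg (sqnorm x) * (2 * x ord0 i))).
- move=> x; apply: continuous_comp; first exact: (@Ck_sqnorm R 0%N).
  apply: differentiable_continuous; apply/derivable1_diffP.
  by case: (D _ (sqnorm_ge0 x)).
- move=> i x; apply: is_derive_comp1; first exact: D (sqnorm_ge0 x).
  by have := is_partial i x (@Ck_sqnorm R 1); rewrite partial_sqnorm.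
- move=> i; apply: (CkM (IH _ Pdg)); apply: CkZ; exact: Ck_coord.
Qed.

(* [softplus \o log_pole e] is a smooth truncation of the Green function of the squared
   Laplacian with pole at the origin. *)
Definition log_pole (e : R) x := ln (2 * (sqnorm x + e))^-1.

Lemma is_derive_shift (a r : R) : is_derive r 1 (fun r : R => r + a) 1.
Proof.
apply: (is_derive_eq (is_deriveD (is_derive_id r (1 : R)) (is_derive_cst a r 1))).
by rewrite addr0.
Qed.

Lemma is_derive_inv_pow (a c r : R) n : 0 < r + a ->
  is_derive r 1 (fun r => c * (r + a)^-1 ^+ n.+1) (- (n.+1%:R * c) * (r + a)^-1 ^+ n.+2).
Proof.
move=> ra; have ran : r + a != 0 by rewrite gt_eqF.
have dV := is_deriveV (f := fun r => r + a) ran (is_derive_shift a r).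
have d := @is_derive1_comp _ (fun y => y ^+ n.+1) (fun r => (r + a)^-1) r _ _ (is_derive_exprn n (r + a)^-1) dV.
have := is_deriveM (is_derive_cst c r 1) d.
move=> /is_derive_eq; apply; rewrite /GRing.scale/= !mulr0 !addr0 mulr1 -exprVn.
by rewrite (exprS _ n.+1) (exprS _ n); ring.
Qed.

Lemma is_derive_log_pole (e r : R) : 0 < r + e ->
  is_derive r 1 (fun r => ln (2 * (r + e))^-1) (-1 * (r + e)^-1 ^+ 1).
Proof.
move=> re; have i0 : 0 < (2 * (r + e))^-1 by rewrite invr_gt0 mulr_gt0.
have d1 : is_derive r 1 (fun r => 2 * (r + e)) 2.
  have := is_deriveM (is_derive_cst (2 : R) r 1) (is_derive_shift e r).
  by move=> /is_derive_eq; apply; rewrite /GRing.scale/= mulr0 addr0 mulr1.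
have n0 : 2 * (r + e) != 0 by rewrite gt_eqF// mulr_gt0.
have d2 := is_deriveV (f := fun r => 2 * (r + e)) n0 d1.
have := @is_derive1_comp _ (@ln R) (fun r => (2 * (r + e))^-1) r _ _ (is_derive1_ln i0) d2.
move=> /is_derive_eq; apply; rewrite /GRing.scale/= invrK expr1.
by field; rewrite gt_eqF.
Qed.

Lemma smooth_radial_pow (e c : R) n : 0 < e -> smooth (fun x => c * (sqnorm x + e)^-1 ^+ n.+1).
Proof.
move=> e0 k.
pose P g := exists c n, g = (fun r : R => c * (r + e)^-1 ^+ n.+1).
apply: (@Ck_radial P _ k (fun r : R => c * (r + e)^-1 ^+ n.+1)); last by exists c, n.
move=> _ [c' [n' ->]]; exists (fun r => - (n'.+1%:R * c') * (r + e)^-1 ^+ n'.+2).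
  by exists (- (n'.+1%:R * c')), n'.+1.
by move=> r r0; apply: is_derive_inv_pow; rewrite ltr_wpDl.
Qed.

Lemma smooth_log_pole (e : R) : 0 < e -> smooth (log_pole e).
Proof.
move=> e0 k.
pose P g := g = (fun r : R => ln (2 * (r + e))^-1) \/
  exists c n, g = (fun r : R => c * (r + e)^-1 ^+ n.+1).
apply: (@Ck_radial P _ k (fun r : R => ln (2 * (r + e))^-1)); last by left.
move=> _ [->|[c' [n' ->]]].
  exists (fun r => -1 * (r + e)^-1 ^+ 1); first by right; exists (-1), 0%N.
  by move=> r r0; apply: is_derive_log_pole; rewrite ltr_wpDl.
exists (fun r => - (n'.+1%:R * c') * (r + e)^-1 ^+ n'.+2).
  by right; exists (- (n'.+1%:R * c')), n'.+1.
by move=> r r0; apply: is_derive_inv_pow; rewrite ltr_wpDl.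
Qed.

Lemma partial_log_pole (e : R) i : 0 < e ->
  partial i (log_pole e) = fun x => (-1 * (sqnorm x + e)^-1 ^+ 1) * (2 * x ord0 i).
Proof.
move=> e0; apply: partialE => x.
apply: (is_derive_comp1 (g := fun r => ln (2 * (r + e))^-1)).
  by apply: is_derive_log_pole; rewrite ltr_wpDl// sqnorm_ge0.
by have := is_partial i x (@Ck_sqnorm R 1); rewrite partial_sqnorm.
Qed.

Lemma partial_radial_pow (e c : R) n i : 0 < e ->
  partial i (fun x => c * (sqnorm x + e)^-1 ^+ n.+1) =
  fun x => (- (n.+1%:R * c) * (sqnorm x + e)^-1 ^+ n.+2) * (2 * x ord0 i).
Proof.
move=> e0; apply: partialE => x.
apply: (is_derive_comp1 (g := fun r => c * (r + e)^-1 ^+ n.+1)).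
  by apply: is_derive_inv_pow; rewrite ltr_wpDl// sqnorm_ge0.
by have := is_partial i x (@Ck_sqnorm R 1); rewrite partial_sqnorm.
Qed.

Lemma lap_softplus_log_pole (e : R) x : 0 < e ->
  let y := sqnorm x + e in
  let w := log_pole e x in
  lap (@softplus R \o log_pole e) x =
   - (1 * flat 0 w + 6 * flat 1 w) * (4 * (sqnorm x + 2 * e) / y ^+ 2) +
   36 * flat 3 w * (4 * sqnorm x / y ^+ 2).
Proof.
move=> e0 y w; have sw := smooth_log_pole e0.
have y0 : 0 < y by rewrite ltr_wpDl// sqnorm_ge0.
have d1 : derive1 (@softplus R) = fun t => 1 * flat 0 t + 6 * flat 1 t.
  exact: derive1_eq (@is_derive_softplus R).
have C1 k : Ck1 k (fun t : R => 1 * flat 0 t + 6 * flat 1 t).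
  by apply: Ck1_lin; exact: Ck1_flat.
have d2 : derive1 (fun t : R => 1 * flat 0 t + 6 * flat 1 t) = fun t => 36 * flat 3 t.
  exact: derive1_eq (@is_derive_softplus1 R).
have sphi : smooth ((fun t : R => 1 * flat 0 t + 6 * flat 1 t) \o log_pole e).
  by move=> k; apply: Ck_comp; [exact: C1|exact: sw].
have E i : partial i (partial i (@softplus R \o log_pole e)) x =
    36 * flat 3 w * (4 * x ord0 i ^+ 2 / y ^+ 2) +
    (1 * flat 0 w + 6 * flat 1 w) * (4 * x ord0 i ^+ 2 / y ^+ 2 - 2 / y).
  have e1 : partial i (@softplus R \o log_pole e) = fun x =>
      ((fun t : R => 1 * flat 0 t + 6 * flat 1 t) \o log_pole e) x * partial i (log_pole e) x.
    by rewrite (partial_comp i (@Ck1_softplus R 1) (sw 1%N)) d1.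
  rewrite e1 (spartialM i sphi (smooth_partial i sw)).
  rewrite (partial_comp i (C1 1%N) (sw 1%N)) d2.
  rewrite (partial_log_pole i e0).
  rewrite (spartialM i (smooth_radial_pow (-1) 0 e0) (fun k => CkZ 2 (@Ck_coord R k i))).
  rewrite (partial_radial_pow _ _ _ e0) (partialZ 2 i (@Ck_coord R 1 i)) partial_coord eqxx.
  rewrite /= -/w -/y mulr1n; move: (flat 0 w) (flat 1 w) (flat 3 w) => a b c; field.
  by rewrite gt_eqF.
rewrite /lap (eq_bigr _ (fun i _ => E i)) big_split/= -!mulr_sumr.
rewrite big_split/= sumr_const card_ord -!mulr_suml -!mulr_sumr -/(sqnorm x).
move: (flat 0 w) (flat 1 w) (flat 3 w) => a b c.
have -> : sqnorm x = y - e by rewrite /y addrK.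
by field; rewrite gt_eqF.
Qed.

End radial.

(** * Integrals of regularised poles *)

Section pole_integrals.
Variable R : realType.
Implicit Types (x z : 'rV[R]_4) (i : 'I_4).
Local Notation lam := (@lebesgue_rV4 R).
Local Notation mu := (@lebesgue_measure R).
Local Notation mR := (measurableTypeR R).

Lemma FTC2y (F f : R -> R) : (forall t, 0 <= t -> 0 <= f t) ->
  (forall t : R, is_derive t 1 F (f t)) -> continuous f ->
  (exists C, forall t, 0 < t -> `|F t| <= C / t) ->
  (\int[mu]_(t in `[0%R, +oo[) (f t)%:E = (- F 0)%:E)%E.
Proof.
move=> f0 dF cf [C FC].
have cF : continuous F.
  by move=> t; apply: differentiable_continuous; apply/derivable1_diffP; case: (dF t).
have C0 : 0 <= C by have := FC 1 ltr01; rewrite divr1; apply: le_trans.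
have F0 : F t @[t --> +oo] --> (0 : R).
  apply/cvgrPdist_le => e e0.
  exists ((C + 1) / e); split; first by rewrite num_real.
  move=> t et; have t0 : 0 < t by apply: lt_trans et; rewrite divr_gt0// ltr_wpDl.
  rewrite sub0r normrN; apply: (le_trans (FC t t0)).
  rewrite ler_pdivrMr// mulrC -ler_pdivrMr//; apply: ltW; apply: le_lt_trans et.
  by rewrite ler_wpM2r ?invr_ge0 ?(ltW e0)// lerDl.
rewrite (ge0_continuous_FTC2y f0 (continuous_subspaceT cf) F0).
- by rewrite -EFinB sub0r.
- by move=> t _; case: (dF t).
- by apply: cvg_at_right_filter; exact: cF.
- by move=> t _; rewrite derive1E; have [_] := dF t.
Qed.

Lemma expR_pow_le (n : nat) (t : R) : 0 < t -> t ^+ n.+1 * expR (- t) <= n.+1`!%:R.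
Proof.
move=> t0; rewrite expRN ler_pdivrMr ?expR_gt0//.
have := expR_ge1Dxn n (ltW t0) => h.
have f0 : 0 < n.+1`!%:R :> R by rewrite ltr0n fact_gt0.
rewrite mulrC -ler_pdivrMr//; apply: le_trans h; rewrite lerDr; exact: ler01.
Qed.

Lemma is_derive_poly_exp (y a b c t : R) :
  is_derive t 1 (fun t => - (a * t ^+ 2 + b * t + c) * expR (- y * t))
   ((y * (a * t ^+ 2 + b * t + c) - (2 * a * t + b)) * expR (- y * t)).
Proof.
have d2 := is_derive1_comp (is_derive_expR (- y * t)) (is_derive_mull (- y) t).
have d1 : is_derive t 1 (fun t => - (a * t ^+ 2 + b * t + c)) (- (2 * a * t + b)).
  have q1 := is_deriveM (is_derive_cst a t 1) (is_derive_exprn 1 t).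
  have q := is_deriveN (is_deriveD (is_deriveD q1 (is_derive_mull b t)) (is_derive_cst c t 1)).
  apply: (is_derive_eq q); rewrite /GRing.scale/= mulr0 !addr0 expr1; ring.
by apply: (is_derive_eq (is_deriveM d1 d2)); rewrite /GRing.scale/=; ring.
Qed.

Lemma continuous_poly_exp (y a b c : R) :
  continuous (fun t : R => (a * t ^+ 2 + b * t + c) * expR (- y * t)).
Proof.
move=> t; apply: differentiable_continuous; apply/derivable1_diffP.
have := is_derive_poly_exp y (- a) (- b) (- c) t.
rewrite (_ : (fun t => - (- a * t ^+ 2 + - b * t + - c) * expR (- y * t)) =
  (fun t : R => (a * t ^+ 2 + b * t + c) * expR (- y * t))); first by case.
by apply/funext => r; congr (_ * _); ring.
Qed.

Lemma poly_exp_decay (y a b c : R) : 0 < y -> 0 <= a -> 0 <= b -> 0 <= c ->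
  exists C, forall t, 0 < t -> `|- (a * t ^+ 2 + b * t + c) * expR (- y * t)| <= C / t.
Proof.
move=> y0 a0 b0 c0; exists (a * (6 / y ^+ 3) + b * (2 / y ^+ 2) + c * (1 / y)) => t t0.
have yt : 0 < y * t by rewrite mulr_gt0.
have h3 := expR_pow_le 2 yt; have h2 := expR_pow_le 1 yt; have h1 := expR_pow_le 0 yt.
rewrite (_ : 3`! = 6)// in h3; rewrite (_ : 2`! = 2)// in h2; rewrite (_ : 1`! = 1)// in h1.
have p0 : 0 <= a * t ^+ 2 + b * t + c.
  by rewrite !addr_ge0// mulr_ge0 ?sqr_ge0// ltW.
rewrite normrM normrN (ger0_norm p0) ger0_norm ?expR_ge0// mulNr ler_pdivlMr//.
move: (expR (- (y * t))) (expR_ge0 (- (y * t))) h1 h2 h3 => E E0 h1 h2 h3.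
rewrite [leLHS](_ : _ = a * (t ^+ 3 * E) + b * (t ^+ 2 * E) + c * (t * E)); last by ring.
have k n f : (y * t) ^+ n * E <= f -> t ^+ n * E <= f / y ^+ n.
  by rewrite exprMn => h; rewrite ler_pdivlMr ?exprn_gt0// mulrC mulrA.
rewrite !lerD// ler_wpM2l//; [exact: k|exact: k|].
by have := k 1%N _ h1; rewrite expr1.
Qed.

Definition half_indic : mR -> R := \1_(`[0, +oo[%classic : set R).

Lemma half_indic_ge0 t : 0 <= half_indic t. Proof. by rewrite /half_indic. Qed.

Lemma measurable_half_indic : measurable_fun setT half_indic.
Proof.
have mI : measurable (`[0, +oo[%classic : set mR) by exact: measurable_itv.
exact: measurable_indic.
Qed.

Lemma half_indicE t : half_indic t = (0 <= t)%R%:R.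
Proof. by rewrite /half_indic indicE mem_setE in_itv/= andbT. Qed.

Lemma half_indic_lt0 (t : R) : t < 0 -> half_indic t = 0.
Proof. by move=> t0; rewrite half_indicE leNgt t0. Qed.

Lemma half_indic_ge (t : R) : 0 <= t -> half_indic t = 1.
Proof. by move=> t0; rewrite half_indicE t0. Qed.

Lemma integral_half_indic (f : R -> R) :
  (\int[mu]_t (half_indic t * f t)%:E = \int[mu]_(t in `[0%R, +oo[) (f t)%:E)%E.
Proof.
transitivity (\int[mu]_t ((f t)%:E * (half_indic t)%:E))%E; last exact: integral_mul_indic.
by apply: eq_integral => t _; rewrite mulrC EFinM.
Qed.

Lemma exp_moment0 y : 0 < y -> (\int[mu]_t (half_indic t * expR (- y * t))%:E = (y^-1)%:E)%E.
Proof.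
move=> y0; rewrite (integral_half_indic (fun t => expR (- y * t))).
have E (t : R) : expR (- y * t) = (0 * t ^+ 2 + 0 * t + 1) * expR (- y * t) by ring.
have I := @FTC2y (fun t => - (0 * t ^+ 2 + 0 * t + y^-1) * expR (- y * t)) (fun t => expR (- y * t)).
apply: (etrans (I _ _ _ _)); last by rewrite !mul0r !mulr0 !add0r expR0 mulr1 opprK.
- by move=> t _; exact: expR_ge0.
- move=> t; apply: (is_derive_eq (is_derive_poly_exp y 0 0 y^-1 t)).
  by field; rewrite gt_eqF.
- by rewrite (funext E); exact: continuous_poly_exp.
- by apply: poly_exp_decay => //; rewrite invr_ge0 ltW.
Qed.

Lemma exp_moment1 y : 0 < y ->
  (\int[mu]_t (half_indic t * (t * expR (- y * t)))%:E = ((y ^+ 2)^-1)%:E)%E.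
Proof.
move=> y0; rewrite (integral_half_indic (fun t => t * expR (- y * t))).
have E (t : R) : t * expR (- y * t) = (0 * t ^+ 2 + 1 * t + 0) * expR (- y * t) by ring.
have I := @FTC2y (fun t => - (0 * t ^+ 2 + y^-1 * t + (y ^+ 2)^-1) * expR (- y * t)) (fun t => t * expR (- y * t)).
apply: (etrans (I _ _ _ _)); last by rewrite !mul0r !mulr0 !add0r expR0 mulr1 opprK.
- by move=> t t0; rewrite mulr_ge0// expR_ge0.
- move=> t; apply: (is_derive_eq (is_derive_poly_exp y 0 y^-1 (y ^+ 2)^-1 t)).
  by field; rewrite gt_eqF.
- by rewrite (funext E); exact: continuous_poly_exp.
- by apply: poly_exp_decay => //; rewrite invr_ge0 ?sqr_ge0// ltW.
Qed.

Lemma exp_moment2 y : 0 < y ->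
  (\int[mu]_t (half_indic t * (t ^+ 2 / 2 * expR (- y * t)))%:E = ((y ^+ 3)^-1)%:E)%E.
Proof.
move=> y0; rewrite (integral_half_indic (fun t => t ^+ 2 / 2 * expR (- y * t))).
have E (t : R) : t ^+ 2 / 2 * expR (- y * t) = (2^-1 * t ^+ 2 + 0 * t + 0) * expR (- y * t) by ring.
have I := @FTC2y (fun t => - ((2 * y)^-1 * t ^+ 2 + (y ^+ 2)^-1 * t + (y ^+ 3)^-1) * expR (- y * t))
  (fun t => t ^+ 2 / 2 * expR (- y * t)).
apply: (etrans (I _ _ _ _)); last by rewrite expr0n !mulr0 !add0r expR0 mulr1 opprK.
- by move=> t t0; rewrite mulr_ge0 ?expR_ge0// divr_ge0 ?sqr_ge0.
- move=> t; apply: (is_derive_eq (is_derive_poly_exp y (2 * y)^-1 (y ^+ 2)^-1 (y ^+ 3)^-1 t)).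
  by field; rewrite gt_eqF.
- by rewrite (funext E); exact: continuous_poly_exp.
- apply: poly_exp_decay => //; rewrite invr_ge0 ?sqr_ge0//.
    by rewrite mulr_ge0// ltW.
  by rewrite exprn_ge0// ltW.
Qed.

(* Writing negative powers of [sqnorm z + e] as Laplace transforms reduces their
   integrals to Gaussian ones. *)
Lemma Laplace_swap (e : R) (h : mR -> R) (b : 'rV[R]_4 -> R) :
  measurable_fun setT h -> (forall t, 0 <= h t) -> measurable_fun setT b -> (forall z, 0 <= b z) ->
  (\int[lam]_z ((b z)%:E * \int[mu]_t (h t * expR (- (sqnorm z + e) * t))%:E) =
   \int[mu]_t ((h t * expR (- e * t))%:E * \int[lam]_z (b z * gauss t z)%:E))%E.
Proof.
move=> mh h0 mb b0.
pose K z t := (b z * (h t * expR (- (sqnorm z + e) * t)))%:E.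
have K0 z t : (0 <= K z t)%E by rewrite lee_fin mulr_ge0// mulr_ge0 ?expR_ge0.
have m1 : measurable_fun setT (fun p : 'rV[R]_4 * mR => sqnorm p.1).
  by apply: measurableT_comp => //; exact: measurable_sqnorm.
have m2 : measurable_fun setT (fun p : 'rV[R]_4 * mR => p.2 : R) by exact: measurable_snd.
have mK : measurable_fun setT (fun p : 'rV[R]_4 * mR => K p.1 p.2).
  apply/measurable_EFinP; apply: measurable_funM; first exact: (measurableT_comp mb measurable_fst).
  apply: measurable_funM; first exact: (measurableT_comp mh measurable_snd).
  apply: measurableT_comp => //; apply: measurable_funM => //.
  by apply: measurableT_comp => //; exact: measurable_funD.
have me (y : R) : measurable_fun setT (fun t : mR => expR (- y * t) : R).
  by apply: measurableT_comp => //; exact: measurable_funM.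
transitivity (\int[lam]_z \int[mu]_t K z t)%E.
  apply: eq_integral => z _; rewrite -ge0_integralZl//.
  - by apply/measurable_EFinP; exact: measurable_funM.
  - by move=> t _; rewrite lee_fin mulr_ge0// expR_ge0.
  - by rewrite lee_fin.
rewrite (fubini_tonelli (fun p : 'rV[R]_4 * mR => K p.1 p.2))//.
apply: eq_integral => t _; rewrite -ge0_integralZl//; last 3 first.
- by apply/measurable_EFinP; apply: measurable_funM => //; exact: measurable_gauss.
- by move=> z _; rewrite lee_fin mulr_ge0// gauss_ge0.
- by rewrite lee_fin mulr_ge0// expR_ge0.
apply: eq_integral => z _; rewrite /K -EFinM; apply: congr1; rewrite /gauss.
rewrite (_ : expR (- (sqnorm z + e) * t) = expR (- e * t) * expR (- t * sqnorm z)); first by ring.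
by rewrite -expRD; congr expR; ring.
Qed.

Lemma ball_volume_fin : exists2 V : R, 0 <= V & (\int[lam]_z (\1_(@B4 R) z)%:E <= V%:E)%E.
Proof.
have mB := @measurable_B4 R; have mc := @measurable_cube R 1.
have f : (lam (@cube R 1) < +oo)%E := cube_fin 1.
have n0 : (0 <= lam (@cube R 1))%E by exact: measure_ge0.
exists (fine (lam (@cube R 1))); first exact: fine_ge0.
rewrite fineK ?ge0_fin_numE// integral_indic// setIT.
apply: le_measure; rewrite ?inE// => x Bx i; rewrite in_itv/= -ler_norml.
rewrite -ler_sqr ?nnegrE// real_normK ?num_real// expr1n.
by apply: (le_trans (sqr_coord_le i x)); exact: ltW.
Qed.

Lemma measurable_ball_indic : measurable_fun setT (\1_(@B4 R) : 'rV[R]_4 -> R).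
Proof. by apply: measurable_indic; exact: measurable_B4. Qed.

Lemma integral_gaussM_le (b : 'rV[R]_4 -> R) t : 0 < t -> (forall z, 0 <= b z <= 1) ->
  (\int[lam]_z (b z * gauss t z)%:E <= (pi ^+ 2 / t ^+ 2)%:E)%E.
Proof.
move=> t0 b01; rewrite -integral_gauss//; apply: ge0_le_integral_any => z; have /andP[b0 b1] := b01 z.
  by rewrite lee_fin mulr_ge0 ?gauss_ge0.
by rewrite lee_fin -[leRHS]mul1r ler_wpM2r ?gauss_ge0.
Qed.

(** [y^-3] is the Laplace transform of [t^2 / 2]; the Gaussian mass [pi^2 / t^2] cancels [t^2] and
    leaves the integral of [(pi^2 / 2) e^(- e t)]. *)
Lemma integral_pole_cube (e : R) : 0 < e ->
  (\int[lam]_z ((sqnorm z + e)^-1 ^+ 3)%:E <= (pi ^+ 2 / (2 * e))%:E)%E.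
Proof.
move=> e0.
have y0 z : 0 < sqnorm z + e by rewrite ltr_wpDl// sqnorm_ge0.
pose h (t : mR) : R := half_indic t * (t ^+ 2 / 2).
have mh : measurable_fun setT h.
  apply: measurable_funM; first exact: measurable_half_indic.
  by apply: measurable_funM => //; exact: measurable_funX.
have h0 t : 0 <= h t by rewrite mulr_ge0 ?half_indic_ge0// divr_ge0 ?sqr_ge0.
have -> : (\int[lam]_z ((sqnorm z + e)^-1 ^+ 3)%:E =
   \int[lam]_z ((cst 1 z)%:E * \int[mu]_t (h t * expR (- (sqnorm z + e) * t))%:E))%E.
  apply: eq_integral => z _; rewrite mul1e exprVn -(exp_moment2 (y0 z)).
  by apply: eq_integral => t _; rewrite /h; apply: congr1; exact: mulrA.
rewrite Laplace_swap//.
have -> : (pi ^+ 2 / (2 * e))%:E = (\int[mu]_t ((pi ^+ 2 / 2)%:E * (half_indic t * expR (- e * t))%:E))%E :> \bar R.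
  rewrite ge0_integralZl//.
  - rewrite exp_moment0// -EFinM; congr EFin; move: (pi ^+ 2) => p; field.
    by rewrite gt_eqF.
  - apply/measurable_EFinP; apply: measurable_funM; first exact: measurable_half_indic.
    by apply: measurableT_comp => //; exact: measurable_funM.
  - by move=> t _; rewrite lee_fin mulr_ge0 ?half_indic_ge0 ?expR_ge0.
  - by rewrite lee_fin divr_ge0 ?sqr_ge0.
apply: ge0_le_integral_any => t.
  rewrite mule_ge0//; first by rewrite lee_fin mulr_ge0 ?expR_ge0.
  by apply: integral_ge0 => z _; rewrite lee_fin mul1r gauss_ge0.
have ex0 := expR_ge0 (- e * t).
have [t0|t0|t0] := ltgtP t 0.
- by rewrite /h (half_indic_lt0 t0) !mul0r mul0e mule0.
- apply: (@le_trans _ _ ((h t * expR (- e * t))%:E * (pi ^+ 2 / t ^+ 2)%:E)%E).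
    apply: lee_wpmul2l; first by rewrite lee_fin mulr_ge0.
    by apply: integral_gaussM_le => // z; rewrite /cst ler01 lexx.
  rewrite -!EFinM lee_fin /h le_eqVlt; apply/orP; left; apply/eqP.
  by move: (pi ^+ 2) (expR _) (half_indic t) => p q r; field; rewrite gt_eqF.
- rewrite /h t0 expr0n /= mul0r mulr0 mul0r mul0e -EFinM lee_fin.
  by apply: mulr_ge0; [rewrite divr_ge0 ?sqr_ge0|rewrite mulr_ge0 ?half_indic_ge0 ?expR_ge0].
Qed.

(** [y^-2] is the Laplace transform of [t], and [t] times the Gaussian mass is [pi^2 / t]: between 1
    and [1 / e] it yields the logarithm with its sharp coefficient. Below 1 the volume of the ball
    takes over ([g1]), beyond [1 / e] the decay of [e^(- e t)] ([g3]). *)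
Lemma integral_pole_sqr (e V : R) : 0 < e -> e < 1 -> 0 <= V ->
  (\int[lam]_z (\1_(@B4 R) z)%:E <= V%:E)%E ->
  (\int[lam]_z (\1_(@B4 R) z * (sqnorm z + e)^-1 ^+ 2)%:E <=
    (V + pi ^+ 2 * ln e^-1 + pi ^+ 2)%:E)%E.
Proof.
move=> e0 e1 V0 BV.
have y0 z : 0 < sqnorm z + e by rewrite ltr_wpDl// sqnorm_ge0.
have ie1 : 1 < e^-1 by rewrite invf_gt1.
pose h (t : mR) : R := half_indic t * t.
have mh : measurable_fun setT h.
  by apply: measurable_funM; first exact: measurable_half_indic.
have h0 t : 0 <= h t.
  by rewrite /h half_indicE; case: (leP 0 t) => t0; rewrite ?mul0r ?mul1r.
have b01 z : 0 <= (\1_(@B4 R) z : R) <= 1 by rewrite indicE; case: (z \in _); rewrite /= ?lexx ?ler01.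
have -> : (\int[lam]_z (\1_(@B4 R) z * (sqnorm z + e)^-1 ^+ 2)%:E =
   \int[lam]_z ((\1_(@B4 R) z)%:E * \int[mu]_t (h t * expR (- (sqnorm z + e) * t))%:E))%E.
  apply: eq_integral => z _; rewrite EFinM; apply: congr1; rewrite exprVn -(exp_moment1 (y0 z)).
  by apply: eq_integral => t _; rewrite /h; apply: congr1; exact: mulrA.
rewrite Laplace_swap//; last exact: measurable_ball_indic.
have m01 := @measurable_unit_indic R.
have mI : measurable (`[1, e^-1]%classic : set mR) by exact: measurable_itv.
pose g1 (t : mR) := (V * unit_indic t)%:E.
pose g2 (t : mR) := ((pi ^+ 2 / t)%:E * (\1_(`[1, e^-1]%classic : set R) t)%:E)%E.
pose g3 (t : mR) := ((pi ^+ 2 * e)%:E * (half_indic t * expR (- e * t))%:E)%E.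
have mg1 : measurable_fun setT g1 by apply/measurable_EFinP; exact: measurable_funM.
have mg2 : measurable_fun setT g2.
  apply: emeasurable_funM; apply/measurable_EFinP; last exact: measurable_indic.
  by apply: measurable_funM => //; exact: measurable_invr.
have mg3' : measurable_fun setT (fun t : mR => (half_indic t * expR (- e * t))%:E).
  apply/measurable_EFinP; apply: measurable_funM; first exact: measurable_half_indic.
  by apply: measurableT_comp => //; exact: measurable_funM.
have mg3 : measurable_fun setT g3 by apply: emeasurable_funM => //; exact: measurable_cst.
have p20 : 0 <= pi ^+ 2 :> R by exact: sqr_ge0.
have g10 t : (0 <= g1 t)%E by rewrite lee_fin mulr_ge0 ?unit_indic_ge0.
have g20 t : (0 <= g2 t)%E.
  rewrite /g2 -EFinM lee_fin indicE; have [|_] := boolP (t \in _); last by rewrite mulr0.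
  rewrite inE /= in_itv/= => /andP[t1 _]; rewrite mulr1 divr_ge0//.
  exact: le_trans ler01 t1.
have g30 t : (0 <= g3 t)%E.
  rewrite /g3 -EFinM lee_fin; apply: mulr_ge0; first exact: mulr_ge0 p20 (ltW e0).
  by rewrite mulr_ge0 ?half_indic_ge0 ?expR_ge0.
apply: (@le_trans _ _ (\int[mu]_t (g1 t + g2 t + g3 t))%E).
  apply: ge0_le_integral_any => t.
    rewrite mule_ge0//; first by rewrite lee_fin mulr_ge0 ?expR_ge0.
    by apply: integral_ge0 => z _; rewrite lee_fin mulr_ge0 ?gauss_ge0//; have /andP[] := b01 z.
  have [t0|t0] := ltP t 0.
    by rewrite /h (half_indic_lt0 t0) !mul0r mul0e !adde_ge0.
  have hi1 := half_indic_ge t0.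
  have [t1|t1] := leP t 1.
    apply: (@le_trans _ _ (g1 t)); last by rewrite -addeA leeDl// adde_ge0.
    have u1 : unit_indic t = 1 by rewrite /unit_indic indicE mem_setE in_itv/= t0 t1.
    rewrite /g1 u1 mulr1 /h hi1 mul1r -[leRHS]mul1e; apply: lee_pmul.
    - by rewrite lee_fin mulr_ge0 ?expR_ge0.
    - by apply: integral_ge0 => z _; rewrite lee_fin mulr_ge0 ?gauss_ge0//; have /andP[] := b01 z.
    - rewrite lee_fin -[leRHS]mulr1; apply: ler_pM; [exact: t0|exact: expR_ge0|exact: t1|].
      by rewrite -[leRHS]expR0 ler_expR mulNr oppr_le0 mulr_ge0// ltW.
    - apply: le_trans BV; apply: ge0_le_integral_any => z; have /andP[z0 z1] := b01 z.
        by rewrite lee_fin mulr_ge0 ?gauss_ge0.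
      rewrite lee_fin -[leRHS]mulr1 ler_wpM2l// /gauss -[leRHS]expR0 ler_expR mulNr oppr_le0.
      by rewrite mulr_ge0 ?sqnorm_ge0.
  have t00 : 0 < t := lt_trans ltr01 t1.
  apply: (@le_trans _ _ ((h t * expR (- e * t))%:E * (pi ^+ 2 / t ^+ 2)%:E)%E).
    apply: lee_wpmul2l; first by rewrite lee_fin mulr_ge0 ?expR_ge0.
    exact: integral_gaussM_le.
  rewrite -EFinM /h hi1 mul1r.
  have -> : t * expR (- e * t) * (pi ^+ 2 / t ^+ 2) = pi ^+ 2 / t * expR (- e * t).
    by move: (pi ^+ 2) (expR _) => p q; field; rewrite gt_eqF.
  have pt0 : 0 <= pi ^+ 2 / t by rewrite divr_ge0// ltW.
  have [te|te] := leP t e^-1.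
    apply: (@le_trans _ _ (g2 t)); last by rewrite addeAC leeDr// adde_ge0.
    have i1 : \1_(`[1, e^-1]%classic : set R) t = 1 :> R.
      by rewrite indicE mem_setE in_itv/= (ltW t1) te.
    rewrite /g2 i1 mule1 lee_fin -[leRHS]mulr1 ler_wpM2l//.
    by rewrite -[leRHS]expR0 ler_expR mulNr oppr_le0 mulr_ge0// ltW.
  apply: (@le_trans _ _ (g3 t)); last by rewrite leeDr// adde_ge0.
  rewrite /g3 hi1 mul1r -EFinM lee_fin ler_wpM2r ?expR_ge0// ler_wpM2l//.
  by rewrite -[leRHS]invrK lef_pV2 ?posrE ?invr_gt0// ltW.
rewrite ge0_integralD//; last 2 first.
- by move=> t _; rewrite adde_ge0.
- exact: emeasurable_funD.
rewrite ge0_integralD//.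
have -> : (\int[mu]_t g1 t = V%:E)%E.
  rewrite /g1; under eq_integral do rewrite EFinM.
  rewrite ge0_integralZl//; last 2 first.
  - exact/measurable_EFinP.
  - by move=> t _; rewrite lee_fin unit_indic_ge0.
  by rewrite integral_unit_indic mule1.
have -> : (\int[mu]_t g2 t = (pi ^+ 2 * ln e^-1)%:E)%E.
  by rewrite /g2 integral_mul_indic integral_cst_div// ln1 mulr0 subr0.
have -> : (\int[mu]_t g3 t = (pi ^+ 2)%:E)%E.
  rewrite /g3 ge0_integralZl//; last 2 first.
  - by move=> t _; rewrite lee_fin mulr_ge0 ?half_indic_ge0 ?expR_ge0.
  - by rewrite lee_fin; exact: mulr_ge0 p20 (ltW e0).
  by rewrite exp_moment0// -EFinM mulfK// gt_eqF.
by rewrite -!EFinD.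
Qed.

Lemma measurable_sublevel (e : R) :
  measurable_fun setT (fun z : 'rV[R]_4 => ((sqnorm z <= e)%R%:R : R)).
Proof.
have mA : measurable [set z : 'rV[R]_4 | sqnorm z <= e].
  rewrite [X in measurable X](_ : _ = [set: 'rV[R]_4] `&` (@sqnorm R) @^-1` `]-oo, e]).
    exact: measurable_sqnorm.
  by apply/seteqP; split=> z /=; rewrite in_itv/= => // -[].
rewrite (_ : (fun z => _) = \1_[set z : 'rV[R]_4 | sqnorm z <= e]); first exact: measurable_indic.
by apply/funext => z; rewrite indicE mem_setE.
Qed.

(** A lower bound without polar coordinates: a Gaussian concentrated at the scale of the ball is at
    most the indicator of the ball plus a tail, estimated by Markov's inequality. *)
Lemma small_ball_volume (e : R) : 0 < e ->
  ((pi ^+ 2 * e ^+ 2 / 2 ^+ 9)%:E <= \int[lam]_z ((sqnorm z <= e)%R%:R)%:E)%E.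
Proof.
move=> e0; pose t := 16 / e.
have t0 : 0 < t by rewrite divr_gt0.
have p0 := @pi_neq0 R.
have mi : measurable_fun setT (fun z : 'rV[R]_4 => ((sqnorm z <= e)%R%:R : R)%:E).
  by apply/measurable_EFinP; exact: measurable_sublevel.
have mg s : measurable_fun setT (fun z => (gauss s z : R)%:E).
  by apply/measurable_EFinP; exact: measurable_gauss.
have h : (\int[lam]_z (gauss t z)%:E <= \int[lam]_z (((sqnorm z <= e)%R%:R)%:E +
   (e^-1 * (2 / t))%:E * (gauss (t / 2) z)%:E))%E.
  apply: ge0_le_integral_any => z; first by rewrite lee_fin gauss_ge0.
  have s0 := sqnorm_ge0 z; rewrite -EFinM -EFinD lee_fin.
  have g20 : 0 <= e^-1 * (2 / t) * gauss (t / 2) z.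
    by rewrite mulr_ge0 ?gauss_ge0// mulr_ge0 ?invr_ge0 ?divr_ge0// ltW.
  have [ze|ze] := leP (sqnorm z) e.
    apply: (@le_trans _ _ 1); last by rewrite lerDl.
    by rewrite /gauss -[leRHS]expR0 ler_expR mulNr oppr_le0 mulr_ge0// ltW.
  rewrite /= mulr0n add0r -mulrA; apply: le_trans (ler_wpM2l _ (gauss_moment1 z t0)); last by rewrite invr_ge0 ltW.
  rewrite mulrA ler_peMl ?gauss_ge0// mulrC ler_pdivlMr// mul1r ltW//.
move: h; rewrite integral_gauss// ge0_integralD//; last 2 first.
- by move=> z _; rewrite -EFinM lee_fin mulr_ge0 ?gauss_ge0// mulr_ge0 ?invr_ge0 ?divr_ge0// ltW.
- by apply: emeasurable_funM => //; exact: measurable_cst.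
rewrite ge0_integralZl//; last 2 first.
- by move=> z _; rewrite lee_fin gauss_ge0.
- by rewrite lee_fin mulr_ge0 ?invr_ge0 ?divr_ge0// ltW.
rewrite integral_gauss ?divr_gt0// -EFinM -leeBlDr// -EFinB => h.
apply: le_trans h; rewrite lee_fin le_eqVlt; apply/orP; left; apply/eqP.
by rewrite /t; move: (pi : R) p0 => p p0; field; rewrite gt_eqF.
Qed.

End pole_integrals.

(** * Test functions and failure of the inequality *)

Section critical.
Variable R : realType.
Implicit Types (u v : 'rV[R]_4 -> R) (x z : 'rV[R]_4) (i : 'I_4).
Local Notation lam := (@lebesgue_rV4 R).

Lemma lapZ u (k : R) x : smooth u -> lap (fun x => k * u x) x = k * lap u x.
Proof.
move=> su; rewrite /lap mulr_sumr; apply: eq_bigr => i _.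
have e1 := partialZ k i (su 1%N).
have e2 := partialZ k i (smooth_partial i su 1%N).
exact: (congr1 (fun f => f x) (etrans (congr1 (partial i) e1) e2)).
Qed.

(** The two terms have opposite signs, so the truncation cannot increase the square beyond that of
    the larger one; the leading constant of the energy is preserved. *)
Lemma sqr_combination_le (a b p q : R) : 0 <= a -> a <= 1 -> 0 <= b -> b <= 1 ->
  0 <= q -> q <= p -> (- a * (4 * p) + b * (4 * q)) ^+ 2 <= (4 * p) ^+ 2.
Proof.
move=> a0 a1 b0 b1 q0 qp; have p0 := le_trans q0 qp.
rewrite -[leLHS]real_normK ?num_real// ler_sqr ?nnegrE ?mulr_ge0// ler_norml.
have ap : a * p <= p by rewrite ler_piMl.
have ap0 : 0 <= a * p by rewrite mulr_ge0.
have bq : b * q <= q by rewrite ler_piMl.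
have bq0 : 0 <= b * q by rewrite mulr_ge0.
have -> : - a * (4 * p) + b * (4 * q) = - 4 * (a * p) + 4 * (b * q) by ring.
by apply/andP; split; lra.
Qed.

Lemma bounded_support_lap u : bounded_support u -> bounded_support (lap u).
Proof. by move=> bu; apply: bounded_support_sum => i; do 2 apply: bounded_support_partial. Qed.

Section test_function.
Variable e : R.
Hypothesis e0 : 0 < e.

Definition test_fun x := softplus (log_pole e x).

Lemma pole_gt0 x : 0 < sqnorm x + e.
Proof. by rewrite ltr_wpDl// sqnorm_ge0. Qed.

Lemma smooth_test_fun : smooth test_fun.
Proof. by move=> k; apply: Ck_comp; [exact: Ck1_softplus|exact: smooth_log_pole]. Qed.

(** The factor 2 in [log_pole] puts the cut at [|x|^2 + e = 1 / 2], so that the support stays away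
    from the sphere and [W >= 1 / 2] on it. *)
Lemma log_pole_gt0 x : (0 < log_pole e x) = (sqnorm x + e < 2^-1).
Proof.
have y0 := pole_gt0 x; rewrite /log_pole.
have i0 : 0 < (2 * (sqnorm x + e))^-1 by rewrite invr_gt0 mulr_gt0.
apply/idP/idP => h.
  rewrite ltNge; apply/negP => hy; move: h; apply/negP; rewrite -leNgt ln_le0//.
  rewrite invf_le1 ?mulr_gt0// mulrC -ler_pdivrMr// div1r //.
by rewrite ln_gt0// invf_gt1 ?mulr_gt0// mulrC -ltr_pdivlMr// div1r.
Qed.

Lemma test_fun_out x : 2^-1 <= sqnorm x + e -> test_fun x = 0.
Proof. by move=> h; rewrite /test_fun softplus_le0// leNgt log_pole_gt0 -leNgt. Qed.

Lemma Cinf_c_test_fun k : Cinf_c (fun x => k * test_fun x).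
Proof.
have cs : closed [set x : 'rV[R]_4 | sqnorm x <= 2^-1].
  apply: (@closed_comp _ _ (@sqnorm R) [set t | t <= 2^-1]); last exact: closed_le.
  by move=> x _; exact: (@Ck_sqnorm R 0%N).
have sub : closure [set x | k * test_fun x != 0] `<=` [set x | sqnorm x <= 2^-1].
  rewrite (closure_id [set x : 'rV[R]_4 | sqnorm x <= 2^-1]).1//.
  apply: closureS => x /=; apply: contraNT; rewrite -ltNge => sx.
  by rewrite test_fun_out ?mulr0// ltW// ltr_wpDr// ltW.
split.
- by move=> n; apply: CkZ; exact: smooth_test_fun.
- apply: (subclosed_compact _ (@compact_cube R 1)); first exact: closed_closure.
  move=> x /sub/= sx i; rewrite in_itv/= -ler_norml.
  rewrite -ler_sqr ?nnegrE// real_normK ?num_real// expr1n.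
  by apply: (le_trans (sqr_coord_le i x)); apply: (le_trans sx); rewrite invf_le1// ler1n.
- by move=> x /sub/= sx; rewrite /B4 /=; apply: le_lt_trans sx _; rewrite invf_lt1// ltr1n.
Qed.

(** With [y = |x|^2 + e], the dominating square is [16 (y + e)^2 / y^4], and [e <= y] bounds its
    excess over [16 / y^2] by [48 e / y^3]. The integral of this excess stays bounded as [e] tends
    to 0. *)
Lemma lap_test_fun_sqr x : lap test_fun x ^+ 2 <=
  16 * (\1_(@B4 R) x * (sqnorm x + e)^-1 ^+ 2) + 48 * e * (sqnorm x + e)^-1 ^+ 3.
Proof.
have y0 := pole_gt0 x; have s0 := sqnorm_ge0 x.
rewrite (lap_softplus_log_pole x e0).
have [w0|w0] := ltP 0 (log_pole e x); last first.
  have z n : flat n (log_pole e x) = 0 by rewrite /flat ifF//; apply/negbTE; rewrite -leNgt.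
  rewrite !z !mulr0 addr0 oppr0 !mul0r addr0 expr0n.
  have y30 : 0 <= (sqnorm x + e)^-1 ^+ 3 by rewrite exprn_ge0// invr_ge0 ltW.
  apply: addr_ge0; first by rewrite mulr_ge0// mulr_ge0 ?sqr_ge0.
  by rewrite mulr_ge0// mulr_ge0// ltW.
have sx : sqnorm x + e < 2^-1 by rewrite -log_pole_gt0.
have Bx : \1_(@B4 R) x = 1 :> R.
  rewrite indicE mem_set// /B4 /=.
  have : 2^-1 < 1 :> R by rewrite invf_lt1// ltr1n.
  by move: e0 sx; move: (2^-1) => h; lra.
rewrite Bx.
move: (softplus1_ge0 (log_pole e x)) (softplus1_le1 (log_pole e x)).
move: (softplus2_ge0 (log_pole e x)) (softplus2_le1 (log_pole e x)).
move: (36 * _) (_ + 6 * _) => b a b0 b1 a0 a1; rewrite mul1r.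
have [y yE] : exists y, y = sqnorm x + e by exists (sqnorm x + e).
have sE : sqnorm x = y - e by rewrite yE addrK.
rewrite -yE in y0 *.
rewrite sE in s0 *.
have q0 : 0 <= (y - e) / y ^+ 2 by rewrite divr_ge0 ?sqr_ge0.
have qp : (y - e) / y ^+ 2 <= (y + e) / y ^+ 2.
  apply: ler_wpM2r; first by rewrite invr_ge0 sqr_ge0.
  by rewrite lerD2l (le_trans _ (ltW e0))// oppr_le0 ltW.
have h : (- a * (4 * (y - e + 2 * e) / y ^+ 2) + b * (4 * (y - e) / y ^+ 2)) ^+ 2 <=
    (4 * ((y + e) / y ^+ 2)) ^+ 2.
  rewrite (_ : 4 * (y - e + 2 * e) / y ^+ 2 = 4 * ((y + e) / y ^+ 2)); last by rewrite mulrA; congr (_ * _ / _); ring.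
  rewrite -(mulrA 4 (y - e)); move: ((y - e) / _) ((y + e) / _) q0 qp => q p q0 qp.
  exact: sqr_combination_le.
apply: (le_trans h).
rewrite -subr_ge0 [X in 0 <= X](_ : _ = 16 * e * (y - e) / y ^+ 4); last by field; rewrite gt_eqF.
by rewrite divr_ge0 ?exprn_even_ge0// mulr_ge0// mulr_ge0// ltW.
Qed.

(** The squared logarithm is at most [2 / y] with [y = |x|^2 + e], and
    [2 / y <= eta / y^2 + 1 / eta]. A small [eta] makes the share of [ln (1 / e)] in the squared
    norm negligible against the energy; 16 bounds [W^-4]. *)
Lemma test_fun_sqr_le (eta : R) x : 0 < eta ->
  (test_fun x / W x ^+ 2) ^+ 2 <= 16 * (eta * (\1_(@B4 R) x * (sqnorm x + e)^-1 ^+ 2) + eta^-1 * \1_(@B4 R) x).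
Proof.
move=> h0; have y0 := pole_gt0 x; have s0 := sqnorm_ge0 x.
have [w0|w0] := ltP 0 (log_pole e x); last first.
  rewrite /test_fun softplus_le0// mul0r expr0n.
  rewrite mulr_ge0// addr_ge0// mulr_ge0// ?invr_ge0 ?(ltW h0)// mulr_ge0 ?sqr_ge0//.
have sx : sqnorm x + e < 2^-1 by rewrite -log_pole_gt0.
have Bx : \1_(@B4 R) x = 1 :> R.
  rewrite indicE mem_set// /B4 /=.
  have : 2^-1 < 1 :> R by rewrite invf_lt1// ltr1n.
  by move: e0 sx; move: (2^-1) => h; lra.
rewrite Bx mul1r mulr1.
have Wx : 2^-1 <= W x.
  have h1 : 2^-1 + 2^-1 = 1 :> R by field.
  by rewrite /W; move: e0 sx h1; move: (2^-1) => h; lra.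
have W0 : 0 < W x by apply: lt_le_trans Wx; rewrite invr_gt0.
have v2 : test_fun x ^+ 2 <= 2 / (sqnorm x + e).
  apply: (@le_trans _ _ (log_pole e x ^+ 2)).
    by rewrite ler_sqr ?nnegrE ?softplus_ge0 ?(ltW w0)//; exact: softplus_le.
  have := expR_ge_sqr (ltW w0); rewrite {2}/log_pole lnK ?posrE ?invr_gt0 ?mulr_gt0//.
  rewrite invfM; move: ((sqnorm x + e)^-1) (log_pole e x ^+ 2) => a b; lra.
have W4 : (W x ^+ 4)^-1 <= 16.
  rewrite -[leRHS]invrK lef_pV2 ?posrE ?invr_gt0 ?exprn_gt0//.
  rewrite (_ : 16^-1 = 2^-1 ^+ 4); last by field.
  by rewrite lerXn2r ?nnegrE ?(ltW W0)// invr_ge0.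
rewrite expr_div_n -exprM mulrC; apply: ler_pM => //.
- by rewrite invr_ge0 exprn_even_ge0.
- exact: sqr_ge0.
apply: (le_trans v2); move: ((sqnorm x + e)^-1) => y.
rewrite -subr_ge0 [X in 0 <= X](_ : _ = eta * (y - eta^-1) ^+ 2); last by field; rewrite gt_eqF.
by rewrite mulr_ge0 ?sqr_ge0// ltW.
Qed.

(** The loss 10 is the 6 of [softplus_ge] plus the bound [ln 4 < 4]. *)
Lemma test_fun_ge x : sqnorm x <= e -> ln e^-1 - 10 <= test_fun x.
Proof.
move=> se; have y0 := pole_gt0 x.
apply: le_trans (softplus_ge _).
have h : ln 4 < 4 :> R by exact: ln_sublinear.
suff : ln e^-1 - ln 4 <= log_pole e x by move: (ln e^-1) (ln 4) (log_pole e x) h => p q r; lra.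
apply: (@le_trans _ _ (ln (4 * e)^-1)).
  have -> : ln (4 * e)^-1 = ln e^-1 - ln 4 :> R; last by [].
  have p4 : (4 : R) \is Num.pos by rewrite posrE.
  by rewrite invfM lnM ?posrE ?invr_gt0// (lnV p4) addrC.
rewrite /log_pole ler_ln ?posrE ?invr_gt0 ?mulr_gt0// lef_pV2 ?posrE ?mulr_gt0//.
by lra.
Qed.

Variable V : R.
Hypothesis V0 : 0 <= V.
Hypothesis BV : (\int[lam]_z (\1_(@B4 R) z)%:E <= V%:E)%E.
Hypothesis e1 : e < 1.

Let y2 x := \1_(@B4 R) x * (sqnorm x + e)^-1 ^+ 2 : R.
Let y3 x := (sqnorm x + e)^-1 ^+ 3 : R.

Let y20 x : 0 <= y2 x. Proof. by rewrite mulr_ge0 ?sqr_ge0. Qed.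
Let y30 x : 0 <= y3 x. Proof. by rewrite exprn_ge0// invr_ge0 ltW// pole_gt0. Qed.
Let myi : measurable_fun setT (fun x : 'rV[R]_4 => (sqnorm x + e)^-1).
Proof.
apply: (measurableT_comp (@measurable_invr R)); apply: measurable_funD => //.
exact: measurable_sqnorm.
Qed.
Let my2 : measurable_fun setT (fun x => (y2 x)%:E).
Proof.
apply/measurable_EFinP; apply: measurable_funM; first exact: measurable_ball_indic.
exact: measurable_funX.
Qed.
Let my3 : measurable_fun setT (fun x => (y3 x)%:E).
Proof. by apply/measurable_EFinP; exact: measurable_funX. Qed.

Lemma test_fun_energy k : \int[lam]_x (lap (fun x => k * test_fun x) x ^+ 2) <=
  k ^+ 2 * (16 * pi ^+ 2 * ln e^-1 + (16 * V + 40 * pi ^+ 2)).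
Proof.
have cu := Cinf_c_test_fun k.
have su := Cinf_c_smooth cu; have bu := Cinf_c_bounded_support cu.
have il := integrable_sqr_support (Ck_continuous (smooth_lap su 0%N)) (bounded_support_lap bu).
rewrite -lee_fin /Rintegral fineK; last exact: (integrable_fin_num measurableT il).
have k2 : 0 <= k ^+ 2 by exact: sqr_ge0.
have c16 : 0 <= k ^+ 2 * 16 by rewrite mulr_ge0.
have c48 : 0 <= k ^+ 2 * (48 * e) by rewrite mulr_ge0// mulr_ge0// ltW.
apply: (@le_trans _ _ (\int[lam]_x ((k ^+ 2 * 16)%:E * (y2 x)%:E + (k ^+ 2 * (48 * e))%:E * (y3 x)%:E))%E).
  apply: ge0_le_integral_any => x; first by rewrite lee_fin sqr_ge0.
  rewrite -!EFinM -EFinD lee_fin (lapZ _ _ smooth_test_fun) exprMn.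
  rewrite [leRHS](_ : _ = k ^+ 2 * (16 * y2 x + 48 * e * y3 x)); last by ring.
  by rewrite ler_wpM2l//; exact: lap_test_fun_sqr.
rewrite ge0_integralD//; last 4 first.
- by move=> x _; rewrite -EFinM lee_fin mulr_ge0// mulr_ge0.
- by apply: emeasurable_funM => //; exact: measurable_cst.
- by move=> x _; rewrite -EFinM lee_fin mulr_ge0.
- by apply: emeasurable_funM => //; exact: measurable_cst.
have -> : (\int[lam]_x ((k ^+ 2 * 16)%:E * (y2 x)%:E) = (k ^+ 2 * 16)%:E * \int[lam]_x (y2 x)%:E)%E.
  apply: ge0_integralZl => //.
  by move=> x _; rewrite lee_fin; exact: y20.
have -> : (\int[lam]_x ((k ^+ 2 * (48 * e))%:E * (y3 x)%:E) = (k ^+ 2 * (48 * e))%:E * \int[lam]_x (y3 x)%:E)%E.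
  apply: ge0_integralZl => //.
  by move=> x _; rewrite lee_fin; exact: y30.
apply: (@le_trans _ _ ((k ^+ 2 * 16)%:E * (V + pi ^+ 2 * ln e^-1 + pi ^+ 2)%:E + (k ^+ 2 * (48 * e))%:E * (pi ^+ 2 / (2 * e))%:E)%E).
  apply: leeD; apply: lee_wpmul2l.
  - by rewrite lee_fin mulr_ge0.
  - exact: integral_pole_sqr.
  - by rewrite lee_fin.
  - exact: integral_pole_cube.
(* [40 pi^2] collects the [16 pi^2] of the quadratic pole and [48 / 2 = 24] times [pi^2] from the
   cubic one. *)
rewrite -!EFinM -EFinD lee_fin le_eqVlt; apply/orP; left; apply/eqP.
by move: (pi ^+ 2) (ln _) => p l; field; rewrite gt_eqF.
Qed.

Lemma test_fun_hyp_sqr k eta : 0 < eta -> hyp_sqr (fun x => k * test_fun x) <=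
  256 * k ^+ 2 * (eta * (V + pi ^+ 2 * ln e^-1 + pi ^+ 2) + eta^-1 * V).
Proof.
move=> h0; have cu := Cinf_c_test_fun k.
have k2 : 0 <= k ^+ 2 by exact: sqr_ge0.
have hi0 : 0 <= eta^-1 by rewrite invr_ge0 ltW.
suff : ((hyp_sqr (fun x => k * test_fun x) / 16)%:E <=
  (k ^+ 2 * 16 * (eta * (V + pi ^+ 2 * ln e^-1 + pi ^+ 2) + eta^-1 * V))%:E)%E.
  rewrite lee_fin ler_pdivrMr// => /le_trans; apply.
  by rewrite le_eqVlt; apply/orP; left; apply/eqP; move: (ln _) (pi ^+ 2) (eta^-1) => a b c; ring.
rewrite -hyp_sqrE//.
apply: (@le_trans _ _ (\int[lam]_x ((k ^+ 2 * 16 * eta)%:E * (y2 x)%:E + (k ^+ 2 * 16 * eta^-1)%:E * (\1_(@B4 R) x)%:E))%E).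
  apply: ge0_le_integral_any => x; first by rewrite lee_fin sqr_ge0.
  rewrite -!EFinM -EFinD lee_fin -mulrA exprMn -[leRHS](_ : k ^+ 2 * (16 * (eta * y2 x + eta^-1 * \1_(@B4 R) x)) = _); last by ring.
  by rewrite ler_wpM2l//; exact: test_fun_sqr_le.
have cc : 0 <= k ^+ 2 * 16 * eta by rewrite mulr_ge0 ?(ltW h0)// mulr_ge0.
have cc' : 0 <= k ^+ 2 * 16 * eta^-1 by rewrite mulr_ge0// mulr_ge0.
have mi : measurable_fun setT (fun x => (\1_(@B4 R) x : R)%:E).
  by apply/measurable_EFinP; exact: measurable_ball_indic.
rewrite ge0_integralD//; last 4 first.
- by move=> x _; rewrite -EFinM lee_fin mulr_ge0.
- by apply: emeasurable_funM => //; exact: measurable_cst.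
- by move=> x _; rewrite -EFinM lee_fin mulr_ge0.
- by apply: emeasurable_funM => //; exact: measurable_cst.
have -> : (\int[lam]_x ((k ^+ 2 * 16 * eta)%:E * (y2 x)%:E) = (k ^+ 2 * 16 * eta)%:E * \int[lam]_x (y2 x)%:E)%E.
  apply: ge0_integralZl => //.
  by move=> x _; rewrite lee_fin; exact: y20.
have -> : (\int[lam]_x ((k ^+ 2 * 16 * eta^-1)%:E * (\1_(@B4 R) x)%:E) =
    (k ^+ 2 * 16 * eta^-1)%:E * \int[lam]_x (\1_(@B4 R) x)%:E)%E.
  by apply: ge0_integralZl => // x _; rewrite lee_fin.
apply: (@le_trans _ _ ((k ^+ 2 * 16 * eta)%:E * (V + pi ^+ 2 * ln e^-1 + pi ^+ 2)%:E + (k ^+ 2 * 16 * eta^-1)%:E * V%:E)%E).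
  apply: leeD; apply: lee_wpmul2l; rewrite ?lee_fin//.
  exact: integral_pole_sqr.
rewrite -!EFinM -EFinD lee_fin le_eqVlt; apply/orP; left; apply/eqP.
by move: (pi ^+ 2) (ln _) (eta^-1) => p l h; ring.
Qed.

End test_function.

(** Restriction to the ball [|x|^2 <= e], where the density is at least [2^4]. *)
Lemma exp_integral_ge u (a e T : R) : Cinf_c u -> 0 < a -> 0 < e -> 0 <= T ->
  (forall x, sqnorm x <= e -> T <= a * u x ^+ 2) -> e < 1 ->
  (((expR T - 1) * (16 * (pi ^+ 2 * e ^+ 2 / 2 ^+ 9)))%:E <=
    \int[@hyp_vol R]_x (expR (a * u x ^+ 2) - 1)%:E)%E.
Proof.
move=> cu a0 e0 T0 uT e1.
have mu0 := continuous_measurable_rV4 (Ck_continuous (Cinf_c_smooth cu 0%N)).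
have me : measurable_fun setT (fun x => (expR (a * u x ^+ 2) - 1)%:E).
  apply/measurable_EFinP; apply: measurable_funB => //.
  by apply: measurableT_comp => //; apply: measurable_funM => //; exact: measurable_funX.
have ex0 x : 0 <= expR (a * u x ^+ 2) - 1.
  by rewrite subr_ge0 -expR0 ler_expR mulr_ge0 ?sqr_ge0// ltW.
have ET0 : 0 <= expR T - 1 by rewrite subr_ge0 -[leLHS]expR0 ler_expR.
rewrite ge0_integral_hyp_vol// integral_mkcond mulrA EFinM.
have c0 : 0 <= (expR T - 1) * 16 by rewrite mulr_ge0.
apply: (le_trans (lee_wpmul2l _ (small_ball_volume e0))); first by rewrite lee_fin.
have mi : measurable_fun setT (fun z : 'rV[R]_4 => ((sqnorm z <= e)%R%:R : R)%:E).
  by apply/measurable_EFinP; exact: measurable_sublevel.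
rewrite -ge0_integralZl//.
apply: ge0_le_integral_any => x; first by rewrite -EFinM lee_fin mulr_ge0.
have c40 := conf4_ge0 x.
have [xe|xe] := leP (sqnorm x) e; last first.
  rewrite mule0 patchE; case: ifPn => // _.
  by rewrite -EFinM lee_fin mulr_ge0.
rewrite mule1 patchE ifT; last by rewrite mem_set// /B4 /=; exact: le_lt_trans xe e1.
rewrite -EFinM lee_fin; apply: ler_pM => //.
  by rewrite lerD2r ler_expR uT.
have Wx : 0 < W x by rewrite -W_gt0 /B4 /=; exact: le_lt_trans xe e1.
rewrite conf_W (_ : 16 = 2 ^+ 4 :> R); last by ring.
have i1 : 1 <= (W x)^-1 by rewrite invf_ge1// W_le1.
have w2 : 2 <= 2 / W x :> R by rewrite ler_peMr.
by rewrite lerXn2r ?nnegrE// (le_trans _ w2).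
Qed.

(** Here [p] stands for [pi^2], [N] for the squared norm and [e2] for [e^2]. The integral side
    forces [dl <= C * N]; the choice of [eta] and the size of [Lam] make each of the two parts of
    the upper bound for [C * N] at most [dl / 4]. *)
Lemma final_contradiction (p C V k dl eta Lam D e2 N : R) : 0 < p -> 0 < C -> 0 <= V ->
  p * k = V + 5 / 2 * p -> 0 < dl -> dl = p * D / 64 -> eta = dl / (64 * C) ->
  V * (64 * C) / (eta * p * dl) <= Lam -> 0 < Lam -> 0 <= k -> e2 <= D / 2 ->
  p / 32 * (D - e2) <= C * N ->
  N <= 256 * (16 * p * (Lam + k))^-1 * (eta * (V + p * Lam + p) + eta^-1 * V) -> False.
Proof.
move=> p0 C0 V0 pk dl0 dlE etaE LV L0 k0 e2D h1 h2.
have eta0 : 0 < eta by rewrite etaE divr_gt0// mulr_gt0.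
have Lk : 0 < Lam + k by rewrite ltr_pwDl.
have pLk : 0 < p * (Lam + k) by rewrite mulr_gt0.
have A : dl <= C * N.
  apply: le_trans h1; rewrite dlE (_ : p * D / 64 = p / 32 * (D / 2)); last by field.
  by rewrite ler_wpM2l ?divr_ge0 ?(ltW p0)//; lra.
have B : C * N <= 16 * C * eta + 16 * C * V / (eta * (p * (Lam + k))).
  apply: (le_trans (ler_wpM2l (ltW C0) h2)).
  rewrite [leLHS](_ : _ = 16 * C * (eta * (V + p * Lam + p) / (p * (Lam + k))) + 16 * C * V / (eta * (p * (Lam + k)))); last first.
    by field; rewrite !gt_eqF.
  rewrite lerD2r ler_wpM2l ?mulr_ge0 ?(ltW C0)//.
  rewrite -mulrA ler_piMr ?(ltW eta0)// ler_pdivrMr// mul1r mulrDr pk; lra.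
have E1 : 16 * C * eta = dl / 4 by rewrite etaE; field; rewrite gt_eqF.
have E2 : 16 * C * V / (eta * (p * (Lam + k))) <= dl / 4.
  rewrite ler_pdivrMr ?mulr_gt0//.
  have : V * (64 * C) / (eta * p * dl) <= Lam + k by apply: (le_trans LV); rewrite lerDl.
  rewrite ler_pdivrMr ?mulr_gt0// => h.
  move: h; rewrite (_ : (Lam + k) * (eta * p * dl) = dl * (eta * (p * (Lam + k)))); last by ring.
  rewrite (_ : V * (64 * C) = 4 * (16 * C * V)); last by ring.
  rewrite (_ : dl / 4 * (eta * (p * (Lam + k))) = dl * (eta * (p * (Lam + k))) / 4); last by field.
  by move: (dl * _) (16 * C * V) => z w; lra.
by move: A B; rewrite E1 => A B; lra.
Qed.

Lemma adams_supercritical (al : R) : 32 * pi ^+ 2 <= al ->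
  ~ exists C : R, 0 < C /\ adams_ineq al C.
Proof.
move=> ha [C [C0 H]].
have [V V0 BV] := ball_volume_fin R.
have pp : 0 < pi :> R := pi_gt0 R.
have p0 : 0 < pi ^+ 2 :> R by exact: exprn_gt0.
(* Makes the bounded part [16 V + 40 pi^2] of the energy equal to [16 pi^2 k]. *)
pose k := (V + 5 / 2 * pi ^+ 2) / pi ^+ 2.
have pk : pi ^+ 2 * k = V + 5 / 2 * pi ^+ 2 by rewrite mulrC divfK// gt_eqF.
have k0 : 0 <= k.
  apply: divr_ge0; last exact: ltW.
  by apply: addr_ge0 => //; apply: mulr_ge0; [rewrite divr_ge0|exact: ltW].
(* The value of [e^2 exp (2 (Lam - 20 - k))] for [e = exp (- Lam)]: up to constants, what the small
   ball contributes for every [Lam]. *)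
pose D := expR (- (40 + 2 * k)).
have D0 : 0 < D by rewrite expR_gt0.
pose dl := pi ^+ 2 * D / 64.
have dl0 : 0 < dl by rewrite divr_gt0// mulr_gt0.
pose eta := dl / (64 * C).
have eta0 : 0 < eta by rewrite divr_gt0// mulr_gt0.
pose Z := V * (64 * C) / (eta * pi ^+ 2 * dl).
have Z0 : 0 <= Z.
  apply: divr_ge0; last exact: ltW (mulr_gt0 (mulr_gt0 eta0 p0) dl0).
  by apply: mulr_ge0 => //; apply: mulr_ge0 => //; exact: ltW.
(* [21 + k] keeps the exponent [2 (Lam - 20 - k)] at least 2, which gives [e ^+ 2 <= D / 2]; [Z] is
   the size required by [final_contradiction]. *)
pose Lam := 21 + k + Z.
have L0 : 0 < Lam by rewrite /Lam; move: k0 Z0; move: (k) (Z) => a b; lra.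
pose e := expR (- Lam).
have e0 : 0 < e by rewrite expR_gt0.
have e1 : e < 1 by rewrite expR_lt1 oppr_lt0.
have lnE : ln e^-1 = Lam by rewrite -expRN opprK expRK.
(* The bound of [test_fun_energy] at [ln (1 / e) = Lam] before scaling, so that [ka] brings the
   energy down to at most 1. *)
pose E := 16 * pi ^+ 2 * (Lam + k).
have E0 : 0 < E by rewrite !mulr_gt0// ltr_pwDl.
pose ka := (Num.sqrt E)^-1.
have ka2 : ka ^+ 2 = E^-1 by rewrite exprVn sqr_sqrtr// ltW.
pose u x := ka * test_fun e x.
have cu : Cinf_c u := Cinf_c_test_fun e0 ka.
have en : \int[lam]_x (lap u x ^+ 2) <= 1.
  apply: (le_trans (test_fun_energy e0 V0 BV e1 ka)).
  rewrite lnE ka2 (_ : 16 * V + 40 * pi ^+ 2 = 16 * pi ^+ 2 * k); last first.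
    by rewrite -mulrA pk; move: (pi ^+ 2) => p; field.
  by rewrite -mulrDr -/E mulVf// gt_eqF.
have T0 : 0 <= 2 * (Lam - 20 - k).
  by rewrite mulr_ge0// /Lam; move: Z0 => z0; lra.
have a0 : 0 < al by apply: lt_le_trans ha; rewrite mulr_gt0.
have uT x : sqnorm x <= e -> 2 * (Lam - 20 - k) <= al * u x ^+ 2.
  move=> xe; have := test_fun_ge e0 xe; rewrite lnE => vL.
  have L10 : 0 <= Lam - 10 by rewrite /Lam; lra.
  rewrite /u exprMn ka2.
  (* [32 pi^2] over the [16 pi^2] in [E] gives the factor 2 for which [exp (2 Lam)] balances the
     volume [e^2]. What remains is [(Lam - 10)^2 >= (Lam - 20 - k) (Lam + k)]. *)
  apply: (@le_trans _ _ (32 * pi ^+ 2 * (E^-1 * (Lam - 10) ^+ 2))).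
    rewrite (_ : 32 * pi ^+ 2 * (E^-1 * (Lam - 10) ^+ 2) = 2 * ((Lam - 10) ^+ 2 / (Lam + k))); last first.
      by rewrite /E; move: (pi ^+ 2) p0 => p p0'; field; rewrite !gt_eqF// ltr_pwDl.
    rewrite ler_wpM2l// ler_pdivlMr ?ltr_pwDl// -subr_ge0.
    rewrite [X in 0 <= X](_ : _ = 100 + 20 * k + k ^+ 2); last by ring.
    by rewrite addr_ge0 ?sqr_ge0// addr_ge0// mulr_ge0.
  apply: ler_pM => //.
  - by rewrite mulr_ge0// ltW.
  - by rewrite mulr_ge0 ?sqr_ge0// invr_ge0 ltW.
  - rewrite ler_wpM2l ?invr_ge0 ?(ltW E0)// ler_sqr ?nnegrE//; exact: le_trans L10 vL.
have h1 := exp_integral_ge cu a0 e0 T0 uT e1.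
have h2 := H u cu.
rewrite Paneitz_energy// lee_fin Lnorm_hyp_sqr// -EFinM in h2.
have := le_trans h1 (h2 en); rewrite lee_fin => h3.
have h4 := test_fun_hyp_sqr e0 V0 BV e1 ka eta0.
rewrite lnE ka2 -/u in h4.
apply: (@final_contradiction (pi ^+ 2) C V k dl eta Lam D (e ^+ 2) (hyp_sqr u)) => //.
- by rewrite -/Z /Lam; lra.
- have h : e ^+ 2 * expR 2 <= D.
    rewrite /D /e -expRM_natl -expRD ler_expR /Lam.
    by move: k0 Z0; move: (k) (Z) => a b; lra.
  have : e ^+ 2 * 2 <= e ^+ 2 * expR 2.
    apply: ler_wpM2l; first exact: sqr_ge0.
    by apply: le_trans (expR_ge1Dx 2); rewrite lerDr.
  by move: h; move: (e ^+ 2) (e ^+ 2 * expR 2) (D) => a c d; lra.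
- apply: le_trans h3.
  have -> : expR (2 * (Lam - 20 - k)) = D / e ^+ 2.
    rewrite /D /e -expRM_natl -expRN -expRD; congr expR; ring.
  rewrite le_eqVlt; apply/orP; left; apply/eqP.
  by move: (pi ^+ 2) => p; field; rewrite gt_eqF.
Qed.

End critical.

Theorem theorem1p2 (R : realType) :
  (forall alpha : R, 0 < alpha -> alpha < 32 * pi ^+ 2 ->
     exists C : R, 0 < C /\ adams_ineq alpha C) /\
  (forall alpha : R, 32 * pi ^+ 2 <= alpha ->
     ~ exists C : R, 0 < C /\ adams_ineq alpha C).
Proof. by split=> al; [exact: adams_subcritical|exact: adams_supercritical]. Qed.
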